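(* Let $0<\theta<\infty$ and let $\{X_i^\theta\}_{i\ge1}$ be a sequence of independent integer-valued random variables satisfying the four assumptions listed in the context; let $T_n(\theta)=\frac1n\sum_{i=1}^n iX_i^\theta$, and let $Z_\theta$, $I$, $(X_i^\theta)^*$, $U$ be as in the context. Let $\Delta_n$ be the quantity defined by $$\Delta_n=|\theta-\mathbb{E}[T_n(\theta)]|+\mathbb{E}\left[\left|U-\frac{I(X_I^\theta)^*}{n}\right|\right].$$ Then $$\mathcal{W}_3(T_n(\theta),Z_\theta)\le C_\theta\,\Delta_n\sqrt{|\log(\Delta_n)|}$$ for some $C_\theta>0$.
   Context: Assumptions on $\{X_i^\theta\}$: (1) $\lim_{i\to\infty}i\,\mathbb{P}(X_i^\theta=1)=\lim_{i\to\infty}i\,\mathbb{E}(X_i^\theta)=\theta$. (2) For all $i\ge1$ there exists a random variable $(X_i^\theta)^*$ such that for all $\phi$, $\mathbb{E}[X_i^\theta\phi(X_i^\theta)]=\mathbb{E}[X_i^\theta]\,\mathbb{E}[\phi(X_i^\theta+(X_i^\theta)^* )]$. (3) $\tilde\theta:=\sup_{i\ge1}(i\,\mathbb{E}(X_i^\theta))<+\infty$. (4) There exists $\gamma>0$ such that $\sup_{n\ge1}\sum_{k=1}^n\log\left(\mathbb{E}[\exp(kX_k^\theta\gamma/n)]\right)<+\infty$. $I$ is a random variable independent of $\{X_i^\theta\}$, with values in $\{1,\dots,n\}$, such that $\mathbb{P}(I=j)=\dfrac{j\,\mathbb{E}[X_j^\theta]}{\sum_{k=1}^nk\,\mathbb{E}[X_k^\theta]}$.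 $Z_\theta$ has the generalized Dickman distribution, defined by $\mathbb{E}[e^{itZ_\theta}]=\exp\left(\theta\int_0^1\frac{e^{itx}-1}{x}\,dx\right)$ for all $t\in\mathbb{R}$. $U$ is a uniform random variable on $[0,1]$ independent of $Z_\theta$. $\mathcal{W}_3(X,Y)=\sup|\mathbb{E}[h(X)]-\mathbb{E}[h(Y)]|$, the supremum being over $h\in\mathcal{C}^3(\mathbb{R})$ with $\|h^{(k)}\|_\infty\le1$ for all $0\le k\le3$.
   Formalization: The bound is proved for every n ≥ 1 with Δ_n ≠ 1 (at Δ_n = 1 the right side is 0 while W_3 > 0, so the claim fails there), and I is taken independent of the joint family of the X_i and (X_i)^*, not only of the X_i. *)

(* Defs.v *)
From HB Require Import structures.
From mathcomp Require Import all_boot all_order all_algebra.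
From mathcomp Require Import all_classical all_reals all_analysis.
From mathcomp Require Import complex.

Set Implicit Arguments.
Unset Strict Implicit.
Unset Printing Implicit Defensive.

Import Order.TTheory GRing.Theory Num.Theory.
Import numFieldNormedType.Exports.

Local Open Scope classical_set_scope.
Local Open Scope ring_scope.

(* Sequences written {X_i}_{i >= 1} are functions on nat whose value at 0 is
   never used: every condition on them is restricted to positive indices. *)

Section Independence.
Context d (T : measurableType d) (R : realType) (P : probability T R).

Definition mutually_independent (J : eqType) (D : set J) (X : J -> T -> R) : Prop :=
  forall (s : seq J) (B : J -> set R),
    uniq s -> {in s, forall i, D i} -> (forall i, measurable (B i)) ->
    P (\bigcap_(i in [set` s]) (X i @^-1` B i)) =
      (\prod_(i <- s) P (X i @^-1` B i))%E.

(* Independence of Y from the sigma-algebra generated by (X_i), i in D: the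
   events below form a pi-system generating that sigma-algebra. *)
Definition independent_of_family d' (S : measurableType d') (Y : T -> S)
    (J : eqType) (D : set J) (X : J -> T -> R) : Prop :=
  forall (A : set S) (s : seq J) (B : J -> set R),
    measurable A -> {in s, forall i, D i} -> (forall i, measurable (B i)) ->
    P ((Y @^-1` A) `&` \bigcap_(i in [set` s]) (X i @^-1` B i)) =
      (P (Y @^-1` A) * P (\bigcap_(i in [set` s]) (X i @^-1` B i)))%E.

Definition independent_pair (X Y : T -> R) : Prop :=
  forall A B : set R, measurable A -> measurable B ->
    P ((X @^-1` A) `&` (Y @^-1` B)) = (P (X @^-1` A) * P (Y @^-1` B))%E.

End Independence.

Section ComplexExpectation.
Local Open Scope complex_scope.
Context (R : realType).

Definition cexp (z : R[i]) : R[i] :=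
  (expR (complex.Re z) * cos (complex.Im z)) +i* (expR (complex.Re z) * sin (complex.Im z)).

Definition cexpectation d (T : measurableType d) (P : probability T R)
    (f : T -> R[i]) : R[i] :=
  fine 'E_P[fun w => complex.Re (f w)] +i* fine 'E_P[fun w => complex.Im (f w)].

Definition cRintegral (D : set R) (f : R -> R[i]) : R[i] :=
  Rintegral lebesgue_measure D (fun x => complex.Re (f x)) +i*
  Rintegral lebesgue_measure D (fun x => complex.Im (f x)).

(* The integrand takes the value 0 at x = 0 (division by zero), which does not
   affect the integral. *)
Definition generalized_dickman (theta : R) d (T : measurableType d)
    (P : probability T R) (Z : T -> R) : Prop :=
  forall t : R,
    cexpectation P (fun w => cexp (0 +i* (t * Z w))) =
    cexp (theta%:C *
          cRintegral `[0, 1] (fun x => (cexp (0 +i* (t * x)) - 1) / x%:C)).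

End ComplexExpectation.

Section Wasserstein3.
Context (R : realType).

Definition is_C3 (h : R -> R) : Prop :=
  (forall k : nat, (k < 3)%N -> forall x : R, derivable (derive1n k h) x 1) /\
  continuous (derive1n 3 h).

Definition W3_test (h : R -> R) : Prop :=
  is_C3 h /\ forall k : nat, (k <= 3)%N -> forall x : R, `|derive1n k h x| <= 1.

Definition W3 d (T : measurableType d) (P : probability T R)
    (X Y : T -> R) : \bar R :=
  ereal_sup [set (`| 'E_P[h \o X] - 'E_P[h \o Y] |)%E | h in W3_test].

End Wasserstein3.

Section Setting.
Context d (T : measurableType d) (R : realType) (P : probability T R).

Definition integer_valued (X : T -> R) : Prop := forall w, X w \is a Num.int.

Definition size_bias_increment (X Xs : T -> R) : Prop :=
  forall phi : R -> R, measurable_fun setT phi ->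
    (exists M : R, forall x, `|phi x| <= M) ->
    ('E_P[fun w => (X w * phi (X w))%R] =
     'E_P[X] * 'E_P[fun w => phi (X w + Xs w)%R])%E.

Definition weighted_sum (X : nat -> T -> R) (n : nat) : T -> R :=
  fun w => n%:R^-1 * \sum_(1 <= i < n.+1) i%:R * X i w.

Definition total_weight (X : nat -> T -> R) (n : nat) : R :=
  \sum_(1 <= k < n.+1) k%:R * fine 'E_P[X k].

Definition uniform01 (U : T -> R) : Prop :=
  forall A : set R, measurable A -> P (U @^-1` A) = uniform_prob (@ltr01 R) A.

(* The joint family indexed by nat + nat: left summand for X, right for Xs. *)
Definition joint_family (X Xs : nat -> T -> R) (k : nat + nat) : T -> R :=
  match k with inl i => X i | inr i => Xs i end.

Definition positive_index (k : nat + nat) : Prop :=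
  match k with inl i => (0 < i)%N | inr i => (0 < i)%N end.

(* The law is required only when its normalizing constant is nonzero, as it is
   meaningless otherwise. *)
Definition random_index (X Xs : nat -> T -> R) (n : nat) (I : T -> nat) : Prop :=
  [/\ forall w, (1 <= I w <= n)%N,
      independent_of_family P I positive_index (joint_family X Xs) &
      total_weight X n != 0 ->
      forall j : nat, (1 <= j <= n)%N ->
        P (I @^-1` [set j]) =
          (j%:R * fine 'E_P[X j] / total_weight X n)%:E].

(* Under the assumptions on X, both expectations are finite whenever
   total_weight X n is nonzero. *)
Definition Delta (theta : R) (X Xs : nat -> T -> R) (n : nat)
    (I : T -> nat) (U : T -> R) : R :=
  `|theta - fine 'E_P[weighted_sum X n]| +
  fine 'E_P[fun w => `|U w - (I w)%:R * Xs (I w) w / n%:R|].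

End Setting.

(* Main.v *)
Require Import Defs.
From mathcomp Require Import all_boot all_order all_algebra.
From mathcomp Require Import all_classical all_reals all_analysis.
From mathcomp Require Import measurable_realfun ring lra.
From mathcomp Require Import complex.
Import Order.TTheory GRing.Theory Num.Theory.
Import numFieldNormedType.Exports.
Local Open Scope classical_set_scope.
Local Open Scope ring_scope.
Set Implicit Arguments.
Unset Strict Implicit.
Unset Printing Implicit Defensive.

(** Write [Tn] for the weighted sum, [m k] for the mean of [X k], [W] for the sum
of the [k%:R * m k] and [V] for the increment [I * Xs I / n].

The law of [Z] is the stationary law of the perpetuity
[Z -> U `^ theta^-1 * (Z + 1)] with [U] uniform and independent of [Z]. So [Z] gives
[h] and [step h] the same mean, where [step] averages a test function over one
move of the perpetuity ([dickman_step]). This is read off the characteristic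
function, which solves a first-order linear equation; that characteristic
functions determine laws is obtained by mixing them into means of Cauchy kernels
and then of arctangents ([same_charfun_law]).

The operator [step] multiplies the bounds on the first two derivatives by the
mean [theta / (theta + 1)] of [U `^ theta^-1] ([smooth_step]). Its iterates on [h]
therefore flatten out, and the difference between the means of [h] at [Tn] and
at [Z] is the sum of the differences between the means at [Tn] of successive
iterates. One such difference is a Stein functional:
[theta * (g x - step g x) = x * phi x - theta * E (phi (x + U))] with [phi] the
derivative of an average of [g] ([step_stein]). Size bias turns
[E (Tn * phi Tn)] into [W / n * E (phi (Tn + V))] with an error of order [1 / n].
This error is itself dominated by [E `|U - V|], because [V] almost surely lives on the lattice of
multiples of [1 / n] and a uniform variable does not ([lattice_gap]). Summing the
geometric series bounds the distance by a multiple of [Delta], uniformly in [n]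
([mean_comparison]).

The factor [sqrt |ln Delta|] could only spoil this where [Delta] is close to 1.
The moment assumptions force [Xs I * I / n] to be close to [I / n] in the mean: the
sums of [(k / n) ^+ 2 * E (X k * `|X k - 1|)] tend to 0, since an integer is
different from 0 and 1 only on an event that the exponential moments and the
common limit of [k * P (X k = 1)] and [k * m k] make negligible
([quadratic_sum_small]). Hence [Delta] is eventually at most [9 / 10]
([discrepancy_le_eventually]), the factor is bounded below from then on, and the
remaining finitely many [n] are absorbed into the constant
([log_factor_bound]). *)

(** * Means of real functions and Fubini *)

Section Mean.
Context d (T : measurableType d) (R : realType).

Definition mean (P : probability T R) (f : T -> R) : R := \int[P]_w f w.

Definition bounded_measurable (f : T -> R) : Prop :=
  measurable_fun setT f /\ exists M, forall x, `|f x| <= M.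

Definition has_mean (P : probability T R) (f : T -> R) : Prop :=
  P.-integrable setT (EFin \o f).

Variable P : probability T R.
Implicit Types f g : T -> R.

Lemma has_mean_measurable f : has_mean P f -> measurable_fun setT f.
Proof. by move=> /integrableP[/measurable_EFinP]. Qed.

Lemma has_mean_bounded f : bounded_measurable f -> has_mean P f.
Proof.
move=> [mf [M fM]]; apply: measurable_bounded_integrable => //.
  exact: le_lt_trans (probability_le1 P measurableT) (ltry _).
exists M; split; first exact: num_real.
by move=> x Mx w _; apply: le_trans (fM w) _; exact: ltW.
Qed.

Lemma has_mean_cst c : has_mean P (cst c).
Proof.
by apply: has_mean_bounded; split; [exact: measurable_cst | exists `|c| => ?].
Qed.

Lemma has_mean_le f g : measurable_fun setT f -> has_mean P g ->
  (forall x, `|f x| <= `|g x|) -> has_mean P f.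
Proof.
move=> mf ig fg; apply: (le_integrable _ _ _ ig) => //; first exact/measurable_EFinP.
by move=> x _ /=; rewrite lee_fin fg.
Qed.

Lemma has_meanD f g : has_mean P f -> has_mean P g ->
  has_mean P (fun x => f x + g x).
Proof. by move=> If Ig; exact: (integrableD measurableT If Ig). Qed.

Lemma has_meanB f g : has_mean P f -> has_mean P g ->
  has_mean P (fun x => f x - g x).
Proof. by move=> If Ig; exact: (integrableB measurableT If Ig). Qed.

Lemma has_meanZ c f : has_mean P f -> has_mean P (fun x => c * f x).
Proof. by move=> If; exact: (integrableZl measurableT c If). Qed.

Lemma has_mean_norm f : has_mean P f -> has_mean P (fun x => `|f x|).
Proof. by move=> ?; exact: integrable_norm. Qed.

Lemma has_mean_sum (I : Type) (s : seq I) (F : I -> T -> R) :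
  (forall i, has_mean P (F i)) -> has_mean P (fun x => \sum_(i <- s) F i x).
Proof.
move=> iF; elim: s => [|i s IH].
  by under eq_fun do rewrite big_nil; exact: has_mean_cst.
by under eq_fun do rewrite big_cons; exact: has_meanD.
Qed.

Lemma eq_mean f g : (forall x, f x = g x) -> mean P f = mean P g.
Proof. by move=> fg; congr (mean P _); exact/funext. Qed.

Lemma meanE f : mean P f = fine ('E_P[f])%E.
Proof. by rewrite unlock. Qed.

Lemma EFin_mean f : has_mean P f -> (mean P f)%:E = ('E_P[f])%E.
Proof.
by move=> mf; rewrite meanE fineK// unlock; exact: integrable_fin_num.
Qed.

Lemma mean_cst c : mean P (fun=> c) = c.
Proof.
rewrite /mean Rintegral_cst//.
by have /= -> := @probability_setT _ _ _ P; rewrite mulr1.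
Qed.

Lemma meanD f g : has_mean P f -> has_mean P g ->
  mean P (fun x => f x + g x) = mean P f + mean P g.
Proof. by move=> ? ?; exact: RintegralD. Qed.

Lemma meanB f g : has_mean P f -> has_mean P g ->
  mean P (fun x => f x - g x) = mean P f - mean P g.
Proof. by move=> ? ?; exact: RintegralB. Qed.

Lemma meanZ c f : has_mean P f -> mean P (fun x => c * f x) = c * mean P f.
Proof. by move=> ?; exact: RintegralZl. Qed.

Lemma mean_sum (I : Type) (s : seq I) (F : I -> T -> R) :
  (forall i, has_mean P (F i)) ->
  mean P (fun x => \sum_(i <- s) F i x) = \sum_(i <- s) mean P (F i).
Proof.
move=> iF; elim: s => [|i s IH].
  rewrite (eq_mean (g := fun=> 0)) ?mean_cst ?big_nil// => x.
  by rewrite big_nil.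
rewrite big_cons -IH -meanD//; last exact: has_mean_sum.
by apply: eq_mean => x; rewrite big_cons.
Qed.

Lemma le_mean f g : has_mean P f -> has_mean P g ->
  (forall x, f x <= g x) -> mean P f <= mean P g.
Proof. by move=> ? ? fg; apply: le_Rintegral. Qed.

Lemma mean_ge0 f : (forall x, 0 <= f x) -> 0 <= mean P f.
Proof. by move=> f0; exact: Rintegral_ge0. Qed.

Lemma norm_mean_le f g : measurable_fun setT f -> has_mean P g ->
  (forall x, `|f x| <= g x) -> `|mean P f| <= mean P g.
Proof.
move=> mf ig fg.
have ifm : has_mean P f.
  by apply: has_mean_le ig _ => // x; apply: le_trans (fg x) _; exact: ler_norm.
apply: le_trans (le_normr_Rintegral measurableT ifm) _.
by apply: le_mean => //; exact: has_mean_norm.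
Qed.

Lemma norm_mean_le_cst f c : measurable_fun setT f ->
  (forall x, `|f x| <= c) -> `|mean P f| <= c.
Proof.
by move=> mf fc; rewrite -(mean_cst c); apply: norm_mean_le => //; exact: has_mean_cst.
Qed.

Lemma bounded_measurable_indic (A : set T) : measurable A ->
  bounded_measurable (\1_A : T -> R).
Proof.
move=> mA; split; first exact: measurable_indic.
by exists 1 => x; rewrite indicE ger0_norm// lern1 leq_b1.
Qed.

Lemma mean_indic (A : set T) : measurable A -> mean P (\1_A) = fine (P A).
Proof. by move=> mA; rewrite /mean /Rintegral integral_indic// setIT. Qed.

Lemma ae_eq_mean f g : measurable_fun setT f -> measurable_fun setT g ->
  {ae P, forall x, f x = g x} -> mean P f = mean P g.
Proof.
move=> mf mg fg; rewrite /mean /Rintegral; congr fine.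
apply: ae_eq_integral => //; try exact/measurable_EFinP.
by apply: filterS fg => x /= -> _.
Qed.

Lemma has_mean_ae0 f : measurable_fun setT f -> {ae P, forall x, f x = 0} ->
  has_mean P f.
Proof.
move=> mf f0; apply/integrableP; split; first exact/measurable_EFinP.
rewrite (@ae_eq_integral _ _ _ P setT (cst 0%E)).
- by rewrite integral0 ltry.
- by [].
- by apply: measurableT_comp => //; exact/measurable_EFinP.
- exact: measurable_cst.
- by apply: filterS f0 => x /= -> _; rewrite normr0.
Qed.

Lemma mean_dominated_cvg (F : nat -> T -> R) f c :
  (forall n, measurable_fun setT (F n)) -> measurable_fun setT f ->
  (forall x, F ^~ x @ \oo --> f x) -> (forall n x, `|F n x| <= c) ->
  (fun n => mean P (F n)) @ \oo --> mean P f.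
Proof.
move=> mF mf Ff Fc.
have [|||||if_ _ cF] := @dominated_convergence _ _ _ P setT measurableT
  (fun n => EFin \o F n) (EFin \o f) (cst c%:E).
- by move=> n; exact/measurable_EFinP.
- exact/measurable_EFinP.
- by apply: aeW => x _; exact/cvg_EFin/Ff/nearW.
- exact: (has_mean_cst c).
- by apply: aeW => x n _; rewrite /= lee_fin.
apply: fine_cvg; rewrite fineK//; exact: integrable_fin_num.
Qed.

End Mean.

Section Fubini.
Context d1 d2 (T1 : measurableType d1) (T2 : measurableType d2) (R : realType).
Variables (P1 : probability T1 R) (P2 : probability T2 R).
Variable f : T1 * T2 -> R.

Lemma measurable_mean2 : bounded_measurable f ->
  measurable_fun setT (fun x => mean P2 (fun y => f (x, y))).
Proof.
move=> bf; have := measurable_fubini_F (has_mean_bounded (P1 \x P2)%E bf).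
exact: (measurableT_comp (fine_measurable measurableT)).
Qed.

Lemma measurable_slice2 x : measurable_fun setT f ->
  measurable_fun setT (fun y => f (x, y)).
Proof. by move=> mf; exact: measurableT_comp. Qed.

Lemma measurable_slice1 y : measurable_fun setT f ->
  measurable_fun setT (fun x => f (x, y)).
Proof. by move=> mf; exact: measurableT_comp. Qed.

Lemma mean_product12 : bounded_measurable f ->
  mean (P1 \x P2)%E f = mean P1 (fun x => mean P2 (fun y => f (x, y))).
Proof.
move=> bf; have If := has_mean_bounded (P1 \x P2)%E bf.
rewrite /mean {1}/Rintegral -(integral12_prod_meas1 If).
rewrite /Rintegral; congr fine; apply: eq_integral => x _.
rewrite /fubini_F fineK//; apply: integrable_fin_num => //.
apply: (has_mean_bounded P2); case: bf => mf [M fM].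
by split; [exact: measurable_slice2 | exists M].
Qed.

Lemma mean_product21 : bounded_measurable f ->
  mean (P1 \x P2)%E f = mean P2 (fun y => mean P1 (fun x => f (x, y))).
Proof.
move=> bf; have If := has_mean_bounded (P1 \x P2)%E bf.
rewrite /mean {1}/Rintegral -(integral21_prod_meas1 If).
rewrite /Rintegral; congr fine; apply: eq_integral => y _.
rewrite /fubini_G fineK//; apply: integrable_fin_num => //.
apply: (has_mean_bounded P1); case: bf => mf [M fM].
by split; [exact: measurable_slice1 | exists M].
Qed.

Lemma mean_exchange : bounded_measurable f ->
  mean P1 (fun x => mean P2 (fun y => f (x, y))) =
  mean P2 (fun y => mean P1 (fun x => f (x, y))).
Proof. by move=> bf; rewrite -mean_product12// mean_product21. Qed.

End Fubini.

(** * Smooth functions and the averaging operator *)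

Section Smooth.
Context (R : realType).
Implicit Types (a b : R) (g dg : R -> R).

(** Differentiability with a bounded Lipschitz derivative, encoded by a
second-order remainder: both bounds are linear in [g] and [dg] jointly, so they
pass through means, and they scale with a dilation of the variable. *)
Definition smooth a b g dg : Prop :=
  (forall x, `|dg x| <= a) /\
  (forall x y, `|g y - g x - dg x * (y - x)| <= b * (y - x) ^+ 2).

Lemma smooth_derivative_lipschitz a b g dg : smooth a b g dg ->
  forall x y, `|dg x - dg y| <= 2 * b * `|x - y|.
Proof.
move=> [_ gb] x y; have [->|xy] := eqVneq x y; first by rewrite !subrr normr0 mulr0.
have nz : 0 < `|x - y| by rewrite normr_gt0 subr_eq0.
rewrite -(ler_pM2r nz) -normrM.
have -> : (dg x - dg y) * (x - y) =
  (g y - g x - dg x * (y - x)) + (g x - g y - dg y * (x - y)) by ring.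
apply: le_trans (ler_normD _ _) _.
have := lerD (gb x y) (gb y x) => /le_trans; apply.
have -> : 2 * b * `|x - y| * `|x - y| = 2 * b * (x - y) ^+ 2.
  by rewrite -[in RHS]real_normK ?num_real//; ring.
have -> : (y - x) ^+ 2 = (x - y) ^+ 2 by ring.
lra.
Qed.

Lemma smooth_is_derive a b g dg : smooth a b g dg ->
  forall x : R, is_derive x 1 g (dg x).
Proof.
move=> [_ gb] x.
have cg : (fun h : R => h^-1 *: ((g \o shift x) (h *: (1 : R)) - g x)) @ 0^' --> dg x.
  apply/cvgrPdist_le => e e0.
  near=> h.
  have h0 : h != 0 by near: h; exact: nbhs_dnbhs_neq.
  have hb : `|h| <= e / (`|b| + 1).
    near: h; apply: (@dnbhs0_le _ (R : normedModType R)).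
    by rewrite divr_gt0// ltr_wpDl.
  rewrite /= /GRing.scale /= mulr1.
  have -> : dg x - h^-1 * (g (h + x) - g x) =
      - (h^-1 * (g (h + x) - g x - dg x * (h + x - x))).
    by field.
  rewrite normrN normrM normfV ler_pdivrMl ?normr_gt0//.
  apply: le_trans (gb _ _) _; rewrite addrK.
  rewrite -real_normK ?num_real// expr2 mulrA mulrC.
  apply: ler_wpM2l => //.
  apply: le_trans (_ : (`|b| + 1) * `|h| <= _).
    by rewrite ler_wpM2r// (le_trans (ler_norm b))// lerDl.
  by rewrite mulrC -ler_pdivlMr// ltr_wpDl.
apply: DeriveDef; last exact/cvg_lim.
by apply/cvg_ex; exists (dg x).
Unshelve. all: by end_near. Qed.

Lemma is_derive_continuous g (x l : R) : is_derive x 1 g l -> {for x, continuous g}.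
Proof. by move=> gl; apply/differentiable_continuous/derivable1_diffP. Qed.

Lemma continuous_lipschitz (f : R -> R) (c : R) :
  (forall x y, `|f x - f y| <= c * `|x - y|) -> continuous f.
Proof.
move=> fc x; apply/cvgrPdist_le => e e0.
near=> y.
apply: le_trans (fc _ _) _.
have hb : `|x - y| <= e / (`|c| + 1).
  near: y; apply: cvgr_dist_le; first exact: cvg_id.
  by rewrite divr_gt0// ltr_wpDl.
apply: le_trans (_ : (`|c| + 1) * `|x - y| <= _).
  by rewrite ler_wpM2r// (le_trans (ler_norm c))// lerDl.
by rewrite mulrC -ler_pdivlMr// ltr_wpDl.
Unshelve. all: by end_near. Qed.

Lemma mean_value (f df : R -> R) : (forall x : R, is_derive x 1 f (df x)) ->
  forall x y, exists2 c, `|c - x| <= `|y - x| & f y - f x = df c * (y - x).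
Proof.
move=> fdf x y.
have cf A : {within A, continuous f}.
  by apply: continuous_subspaceT => z; exact: is_derive_continuous.
have [xy|/ltW yx] := leP x y.
  have [c /[!in_itv]/= /andP[xc cy] ->] := MVT_segment xy (fun z _ => fdf z) (cf _).
  by exists c => //; rewrite !ger0_norm ?subr_ge0// lerD2r.
have [c /[!in_itv]/= /andP[yc cx] E] := MVT_segment yx (fun z _ => fdf z) (cf _).
exists c; first by rewrite !ler0_norm ?subr_le0// lerN2 lerD2r.
by rewrite -opprB E -mulrN opprB.
Qed.

Lemma derivative_bound_lipschitz (f df : R -> R) (a : R) :
  (forall x : R, is_derive x 1 f (df x)) -> (forall x, `|df x| <= a) ->
  forall x y, `|f x - f y| <= a * `|x - y|.
Proof.
move=> fdf dfa x y; have [c _ ->] := mean_value fdf y x.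
by rewrite normrM ler_wpM2r.
Qed.

Lemma smooth_lipschitz a b g dg : smooth a b g dg ->
  forall x y, `|g x - g y| <= a * `|x - y|.
Proof.
by move=> sg; apply: (derivative_bound_lipschitz (smooth_is_derive sg)); case: sg.
Qed.

Lemma lipschitz_derivative_smooth a b g dg : 0 <= b ->
  (forall x : R, is_derive x 1 g (dg x)) -> (forall x, `|dg x| <= a) ->
  (forall x y, `|dg x - dg y| <= b * `|x - y|) -> smooth a b g dg.
Proof.
move=> b0 gdg dga dgb; split => // x y.
have [c cx ->] := mean_value gdg x y.
rewrite -mulrBl normrM -real_normK ?num_real// expr2 mulrA.
apply: ler_wpM2r => //; apply: le_trans (dgb _ _) _.
exact: ler_wpM2l.
Qed.

Lemma continuous_measurableT (f : R -> R) : continuous f -> measurable_fun setT f.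
Proof. exact: continuous_measurable_fun. Qed.

Lemma smooth_continuous a b g dg : smooth a b g dg -> continuous g.
Proof. by move=> /smooth_lipschitz; exact: continuous_lipschitz. Qed.

Lemma smooth_continuous_derivative a b g dg : smooth a b g dg -> continuous dg.
Proof. by move=> /smooth_derivative_lipschitz; exact: continuous_lipschitz. Qed.

(** Differentiation under the integral sign: the remainder estimate holds for
each slice and is averaged as it stands. *)
Lemma smooth_mean d (T : measurableType d) (P : probability T R)
    (a b : T -> R) (G dG : R -> T -> R) :
  has_mean P a -> has_mean P b ->
  (forall w, smooth (a w) (b w) (G ^~ w) (dG ^~ w)) ->
  (forall x, has_mean P (G x)) -> (forall x, measurable_fun setT (dG x)) ->
  smooth (mean P a) (mean P b) (fun x => mean P (G x)) (fun x => mean P (dG x)).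
Proof.
move=> ia ib sG iG mdG.
have idG x : has_mean P (dG x).
  apply: has_mean_le ia _ => // w; have [+ _] := sG w => /(_ x) /le_trans; apply.
  exact: ler_norm.
split=> [x|x y].
  by apply: norm_mean_le => // w; have [+ _] := sG w => /(_ x).
rewrite -meanB// -[X in _ - X]mulrC -meanZ// -meanB//; last exact: has_meanZ.
  rewrite mulrC -meanZ//; apply: norm_mean_le.
  - apply: (@has_mean_measurable _ _ _ P); apply: has_meanB; last exact: has_meanZ.
    exact: has_meanB.
  - exact: has_meanZ.
  - move=> w /=; have [_] := sG w => /(_ x y).
    by rewrite [X in _ - X]mulrC [X in _ <= X]mulrC.
exact: has_meanB.
Qed.

End Smooth.

Section Uniform.
Context (R : realType).
Notation unif := (uniform_prob (@ltr01 R)).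

Lemma mean_uniform (f : R -> R) : bounded_measurable f ->
  mean unif f = \int[lebesgue_measure]_(x in `[0%R, 1%R]) f x.
Proof.
move=> [mf [M fM]].
have M0 : 0 <= M by exact: le_trans (fM 0).
have L1 : (@lebesgue_measure R `[0%R, 1%R]%classic = 1)%E.
  by rewrite lebesgue_measure_itv /= lte_fin ltr01 oppr0 adde0.
have L01 : (@lebesgue_measure R `[0%R, 1%R]%classic < +oo)%E by rewrite L1 ltry.
have ifl : (@lebesgue_measure R).-integrable `[0%R, 1%R] (EFin \o f).
  apply: measurable_bounded_integrable => //.
  - exact: measurable_funTS.
  - exists M; split; first exact: num_real.
    by move=> x Mx w _; apply: le_trans (fM w) _; exact: ltW.
have icl : (@lebesgue_measure R).-integrable `[0%R, 1%R] (EFin \o cst M).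
  apply: measurable_bounded_integrable => //.
  - exists M; split; first exact: num_real.
    by move=> x Mx w _ /=; rewrite ger0_norm// ltW.
apply: (@addIr _ M); rewrite -[in LHS](mean_cst unif M) -meanD//; last 2 first.
- by apply: has_mean_bounded; split => //; exists M.
- exact: has_mean_cst.
have -> : \int[lebesgue_measure]_(x in `[0%R, 1%R]) f x + M =
    \int[lebesgue_measure]_(x in `[0%R, 1%R]) (f x + M).
  rewrite RintegralD// Rintegral_cst//.
  by have /= -> := L1; rewrite mulr1.
rewrite /mean /Rintegral; congr fine.
rewrite integral_uniform.
- by rewrite subr0 invr1 mul1e.
- by apply/measurable_EFinP; apply: measurable_funD.
- by move=> x; rewrite lee_fin -lerBlDr sub0r; have := fM x; rewrite ler_norml => /andP[].
Qed.

Lemma mean_uniform_FTC (f F : R -> R) : bounded_measurable f ->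
  {within `[0%R, 1%R], continuous f} ->
  F x @[x --> 0^'+] --> F 0 -> F x @[x --> 1^'-] --> F 1 ->
  (forall x : R, 0 < x < 1 -> is_derive x 1 F (f x)) ->
  mean unif f = F 1 - F 0.
Proof.
move=> bf cf F0 F1 dF; rewrite mean_uniform// /Rintegral.
rewrite (continuous_FTC2 (F := F) ltr01 cf)//.
- split => // x /[!in_itv]/= x01.
  by have := dF x x01.
- move=> x /[!in_itv]/= x01; rewrite derive1E.
  by have := dF x x01 => ?; exact: derive_val.
Qed.

Lemma mean_uniform_translate a b (G dG : R -> R) (x : R) : smooth a b G dG ->
  mean unif (fun v => dG (x + v)) = G (x + 1) - G x.
Proof.
move=> sG.
have cs : continuous (fun v : R => x + v).
  by move=> v; apply: cvgD; [exact: cvg_cst|exact: cvg_id].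
have cdG : continuous (fun v => dG (x + v)).
  by move=> v; apply: continuous_comp; [exact: cs|exact: (smooth_continuous_derivative sG)].
have cG : continuous (fun v => G (x + v)).
  by move=> v; apply: continuous_comp; [exact: cs|exact: (smooth_continuous sG)].
rewrite -{3}[x]addr0; apply: (mean_uniform_FTC (F := fun v => G (x + v))).
- split; first exact: continuous_measurableT.
  by exists a => v; case: sG.
- exact: continuous_subspaceT.
- exact/cvg_at_right_filter/cG.
- exact/cvg_at_left_filter/cG.
- move=> v _; have := smooth_is_derive sG (x + v) => H.
  have H2 : is_derive v 1 (fun v : R => x + v) (1 : R).
    by rewrite -[X in is_derive _ _ _ X]add0r; apply: is_deriveD.
  by rewrite -[dG _]mulr1; exact: (is_derive1_comp H H2).
Qed.

End Uniform.

Section Averaging.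
Context (R : realType) (theta : R).
Hypothesis theta_gt0 : 0 < theta.
Notation unif := (uniform_prob (@ltr01 R)).

(** The variable [U `^ theta^-1] for uniform [U], truncated so that it lies in
the unit interval everywhere and not just on the support of the law of [U]. *)
Definition pull (u : R) : R := Num.min 1 (u `^ theta^-1).

Lemma pull_ge0 u : 0 <= pull u.
Proof. by rewrite le_min ler01 powR_ge0. Qed.

Lemma pull_le1 u : pull u <= 1.
Proof. by rewrite ge_min lexx. Qed.

Lemma pull01 u : 0 <= u <= 1 -> pull u = u `^ theta^-1.
Proof.
move=> /andP[u0 u1]; apply/min_idPr.
have := @ge0_ler_powR R theta^-1.
rewrite invr_ge0 (ltW theta_gt0) => /(_ isT u 1).
by rewrite !nnegrE u0 ler01 powR1 => /(_ isT isT u1).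
Qed.

Lemma pull0 : pull 0 = 0.
Proof. by rewrite pull01 ?lexx ?ler01// powR0// invr_eq0 gt_eqF. Qed.

Lemma pull1 : pull 1 = 1.
Proof. by rewrite pull01 ?lexx ?ler01// powR1. Qed.

Lemma measurable_pull : measurable_fun setT pull.
Proof.
by apply: measurable_minr => //; exact: measurable_powR.
Qed.

Lemma bounded_measurable_pull : bounded_measurable pull.
Proof.
split; first exact: measurable_pull.
by exists 1 => u; rewrite ger0_norm ?pull_ge0 ?pull_le1.
Qed.

Lemma is_derive_pull (u : R) : 0 < u < 1 ->
  is_derive u 1 pull (theta^-1 * u `^ (theta^-1 - 1)).
Proof.
move=> /andP[u0 u1].
have uI : u \in `]0, +oo[ by rewrite in_itv/= u0.
have H : is_derive u 1 (fun u : R => u `^ theta^-1) (theta^-1 * u `^ (theta^-1 - 1)).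
  apply: DeriveDef; first exact: derivable_powR.
  by rewrite -derive1E powR_derive1.
apply: near_eq_is_derive H => //.
have uJ : u \in `]0, 1[ by rewrite in_itv/= u0.
near=> z; rewrite pull01//.
have : z \in `]0, 1[ by near: z; exact: near_in_itvoo.
by rewrite in_itv/= => /andP[/ltW -> /ltW ->].
Unshelve. all: by end_near. Qed.

Lemma pull_cvg0 : pull u @[u --> 0^'+] --> pull 0.
Proof.
rewrite pull0.
have H := @powR_cvg0 R theta^-1; rewrite invr_gt0 in H; have {}H := H theta_gt0.
apply: cvg_trans H; apply: near_eq_cvg; near=> z; rewrite pull01//.
by apply/andP; split; near: z; [exact: nbhs_right_ge | exact: nbhs_right_le].
Unshelve. all: by end_near. Qed.

Lemma pull_cvg1 : pull u @[u --> 1^'-] --> pull 1.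
Proof.
have H : is_derive (1 : R) 1 (fun u : R => u `^ theta^-1) (theta^-1 * 1 `^ (theta^-1 - 1)).
  have uI : (1 : R) \in `]0, +oo[ by rewrite in_itv/= ltr01.
  apply: DeriveDef; first exact: derivable_powR.
  by rewrite -derive1E powR_derive1.
have {}H := cvg_at_left_filter (is_derive_continuous H).
rewrite powR1 in H; rewrite pull1.
apply: cvg_trans H; apply: near_eq_cvg; near=> z; rewrite pull01//.
by apply/andP; split; near: z; [exact: nbhs_left_ge | exact: nbhs_left_le].
Unshelve. all: by end_near. Qed.

Lemma pull_continuous_within : {within `[0%R, 1%R], continuous pull}.
Proof.
apply/continuous_within_itvP; first exact: ltr01.
split; [|exact: pull_cvg0|exact: pull_cvg1] => u /[!in_itv]/= /is_derive_pull.
exact: is_derive_continuous.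
Qed.

Definition avg (g : R -> R) (x : R) : R := mean unif (fun u => g (pull u * x)).

Definition davg (dg : R -> R) (x : R) : R :=
  mean unif (fun u => pull u * dg (pull u * x)).

Definition pull_mean : R := mean unif pull.

Lemma has_mean_pull : has_mean unif pull.
Proof. by apply: has_mean_bounded; exact: bounded_measurable_pull. Qed.

Lemma measurable_pullM (f : R -> R) (x : R) : continuous f ->
  measurable_fun setT (fun u => f (pull u * x)).
Proof.
move=> cf; apply: (measurableT_comp (f := f)); first exact: continuous_measurableT.
by apply: measurable_funM => //; exact: measurable_pull.
Qed.

Lemma bounded_smooth_pull a b g dg (x : R) : smooth a b g dg ->
  bounded_measurable (fun u => g (pull u * x)).
Proof.
move=> sg; have cg := smooth_continuous sg.
split; first exact: measurable_pullM.
have a0 : 0 <= a by case: sg => /(_ 0) ga _; exact: le_trans ga.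
exists (`|g 0| + a * `|x|) => u.
rewrite -[g (pull u * x)](subrK (g 0)) addrC.
apply: le_trans (ler_normD _ _) _; rewrite lerD2l.
apply: le_trans (smooth_lipschitz sg _ _) _.
rewrite subr0 normrM ler_wpM2l// ler_piMl//.
by rewrite ger0_norm ?pull_le1// pull_ge0.
Qed.

Lemma bounded_smooth_dpull a b g dg (x : R) : smooth a b g dg ->
  bounded_measurable (fun u => pull u * dg (pull u * x)).
Proof.
move=> sg; have cg := smooth_continuous_derivative sg.
split.
  by apply: measurable_funM; [exact: measurable_pull | exact: measurable_pullM].
exists a => u; rewrite normrM -[a]mul1r ler_pM//; last by case: sg.
by rewrite ger0_norm ?pull_le1// pull_ge0.
Qed.

Lemma smooth_avg a b g dg : smooth a b g dg ->
  smooth (a * pull_mean) (b * pull_mean) (avg g) (davg dg).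
Proof.
move=> sg.
have a0 : 0 <= a by case: sg => /(_ 0) ga _; exact: le_trans ga.
have b0 : 0 <= b.
  case: sg => _ /(_ 0 1); rewrite subr0 expr1n !mulr1 => H; exact: le_trans (normr_ge0 _) H.
rewrite /pull_mean -!meanZ; [|exact: has_mean_pull|exact: has_mean_pull].
apply: (@smooth_mean R _ _ unif (fun u => a * pull u) (fun u => b * pull u)
  (fun x u => g (pull u * x)) (fun x u => pull u * dg (pull u * x))).
- exact/has_meanZ/has_mean_pull.
- exact/has_meanZ/has_mean_pull.
- move=> u; have p0 := pull_ge0 u; have p1 := pull_le1 u; split=> [x|x y].
    by rewrite normrM ger0_norm// mulrC ler_wpM2r//; case: sg.
  have := proj2 sg (pull u * x) (pull u * y).
  rewrite -mulrBr exprMn mulrA [dg _ * _]mulrC => /le_trans; apply.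
  rewrite mulrA ler_wpM2r ?sqr_ge0//.
  by rewrite ler_wpM2l// expr2 ler_piMl.
- by move=> x; apply: has_mean_bounded; exact: bounded_smooth_pull sg.
- by move=> x; case: (bounded_smooth_dpull x sg).
Qed.

(** The first-order equation [theta * avg g + x * (avg g)' = theta * g]:
integrate the derivative of [u * g (u `^ theta^-1 * x)] over the unit
interval. *)
Lemma avg_equation a b g dg (x : R) : smooth a b g dg ->
  theta * (g x - avg g x) = x * davg dg x.
Proof.
move=> sg.
have cg := smooth_continuous sg; have cdg := smooth_continuous_derivative sg.
have bm := bounded_smooth_pull x sg; have bd := bounded_smooth_dpull x sg.
pose F u := u * g (pull u * x).
pose f u := g (pull u * x) + theta^-1 * x * (pull u * dg (pull u * x)).
have bf : bounded_measurable f.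
  case: bm => mg [M Mb]; case: bd => md [N Nb]; split.
    by apply: measurable_funD => //; apply: measurable_funM.
  exists (M + `|theta^-1 * x| * N) => u; apply: le_trans (ler_normD _ _) _.
  by rewrite lerD// normrM ler_wpM2l.
have cpx : {within `[0%R, 1%R], continuous (fun u => pull u * x)}.
  by move=> u; apply: cvgM; [exact: pull_continuous_within|exact: cvg_cst].
have cgp (h : R -> R) : continuous h -> {within `[0%R, 1%R], continuous (fun u => h (pull u * x))}.
  by move=> ch u; apply: continuous_comp; [exact: cpx|exact: ch].
have cf : {within `[0%R, 1%R], continuous f}.
  move=> u; apply: cvgD; first exact: cgp.
  apply: cvgM; first exact: cvg_cst.
  by apply: cvgM; [exact: pull_continuous_within|exact: cgp].
have cF : {within `[0%R, 1%R], continuous F}.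
  move=> u; apply: cvgM; last exact: cgp.
  by apply: continuous_subspaceT => v; exact: cvg_id.
have /(continuous_within_itvP _ (@ltr01 R))[_ F0 F1] := cF.
have : mean unif f = F 1 - F 0.
  apply: mean_uniform_FTC => // u u01.
  have dp := is_derive_pull u01.
  have [u0 u1] := andP u01.
  have dpx : is_derive u 1 (fun u => pull u * x) (theta^-1 * u `^ (theta^-1 - 1) * x).
    have := is_deriveM dp (is_derive_cst x u 1).
    move/is_derive_eq; apply; rewrite /GRing.scale /= mulr0 add0r mulrC; done.
  have dgp := @is_derive1_comp R g (fun u => pull u * x) u _ _ (smooth_is_derive sg (pull u * x)) dpx.
  have := is_deriveM (is_derive_id u 1) dgp.
  move/is_derive_eq; apply; rewrite /f /GRing.scale /= mulr1 addrC; congr (_ + _).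
  have -> : pull u = u * u `^ (theta^-1 - 1).
    by rewrite mulr_powRB1 ?(ltW u0) ?invr_gt0// pull01// !ltW.
  by ring.
rewrite /F pull1 !mul1r mul0r subr0 => <-.
rewrite /f meanD ?meanZ; [|exact: has_mean_bounded|exact: has_mean_bounded|].
  rewrite /avg /davg [mean _ _ + _]addrC addrK.
  by rewrite -mulrA mulrA mulfV ?gt_eqF// mul1r.
by apply: has_meanZ; exact: has_mean_bounded.
Qed.

Lemma pull_mean_ge0 : 0 <= pull_mean.
Proof. by apply: mean_ge0 => u; exact: pull_ge0. Qed.

(** For the identity function the averaging equation reads
[theta * (1 - pull_mean) = pull_mean]. *)
Lemma pull_mean_lt1 : pull_mean < 1.
Proof.
have sid : smooth 1 0 (fun x : R => x) (fun=> 1).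
  by split=> [x|x y]; rewrite ?normr1// mul1r subrr normr0 mul0r.
have := avg_equation 1 sid; rewrite /avg /davg mul1r.
have -> : mean unif (fun u => pull u * 1) = pull_mean.
  by apply: eq_mean => u; rewrite mulr1.
move=> H; rewrite ltNge; apply/negP => p1.
have : 0 < pull_mean by exact: lt_le_trans p1.
by rewrite -H pmulr_rgt0// subr_gt0 ltNge p1.
Qed.

(** The transition operator of the perpetuity [Z -> U `^ theta^-1 * (Z + 1)],
whose stationary law is the generalized Dickman law. *)
Definition step (g : R -> R) (x : R) : R := avg g (x + 1).
Definition dstep (dg : R -> R) (x : R) : R := davg dg (x + 1).

Lemma smooth_step a b g dg : smooth a b g dg ->
  smooth (a * pull_mean) (b * pull_mean) (step g) (dstep dg).
Proof.
move=> /smooth_avg[ga gb]; split=> [x|x y]; first exact: ga.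
have := gb (x + 1) (y + 1).
by have -> : y + 1 - (x + 1) = y - x by ring.
Qed.

(** The change from [g] to [step g] is the Stein operator of the Dickman law,
[phi -> x * phi x - theta * E (phi (x + U))], applied to the derivative of
[avg g]: the averaging equation supplies the first term and the fundamental
theorem of calculus the second. *)
Lemma step_stein a b g dg (x : R) : smooth a b g dg ->
  theta * (g x - step g x) =
  x * davg dg x - theta * mean unif (fun v => davg dg (x + v)).
Proof.
move=> sg; rewrite -(avg_equation x sg) (mean_uniform_translate x (smooth_avg sg)).
by rewrite /step; ring.
Qed.

Lemma avg_bounded g M (x : R) : continuous g -> (forall x, `|g x| <= M) ->
  `|avg g x| <= M.
Proof.
by move=> cg gM; apply: norm_mean_le_cst => //; exact: measurable_pullM.
Qed.

End Averaging.

(** * Characteristic functions determine laws *)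

Section CauchyKernel.
Context (R : realType).
Notation unif := (uniform_prob (@ltr01 R)).

Lemma is_derive_change (f g : R -> R) (x l l' : R) : is_derive x 1 f l ->
  (forall y, f y = g y) -> l = l' -> is_derive x 1 g l'.
Proof. by move=> fl /funext <- <-. Qed.

Lemma continuous_cos_scale (t : R) : continuous (fun x : R => cos (t * x)).
Proof.
move=> x; apply: (@continuous_comp _ _ _ (fun x => t * x) cos); last exact: continuous_cos.
by apply: cvgM; [exact: cvg_cst|exact: cvg_id].
Qed.

Lemma continuous_sin_scale (t : R) : continuous (fun x : R => sin (t * x)).
Proof.
move=> x; apply: (@continuous_comp _ _ _ (fun x => t * x) sin); last exact: continuous_sin.
by apply: cvgM; [exact: cvg_cst|exact: cvg_id].
Qed.

Lemma norm_cos_le1 (x : R) : `|cos x| <= 1.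
Proof. by rewrite ler_norml cos_geN1 cos_le1. Qed.

Lemma norm_sin_le1 (x : R) : `|sin x| <= 1.
Proof. by rewrite ler_norml sin_geN1 sin_le1. Qed.

Lemma measurable_cos : measurable_fun setT (@cos R).
Proof. by apply: continuous_measurableT; exact: continuous_cos. Qed.

Lemma measurable_sin : measurable_fun setT (@sin R).
Proof. by apply: continuous_measurableT; exact: continuous_sin. Qed.

Lemma measurable_atan : measurable_fun setT (@atan R).
Proof. by apply: continuous_measurableT; exact: continuous_atan. Qed.

Lemma measurable_cos_scale (t : R) : measurable_fun setT (fun x : R => cos (t * x)).
Proof. by apply: continuous_measurableT; exact: continuous_cos_scale. Qed.

Lemma measurable_sin_scale (t : R) : measurable_fun setT (fun x : R => sin (t * x)).
Proof. by apply: continuous_measurableT; exact: continuous_sin_scale. Qed.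

(** The identity on the support of the uniform law, extended so that integrands
built from it are bounded on the whole line. *)
Definition clamp (u : R) : R := Num.max 0 (Num.min 1 u).

Lemma clamp_ge0 u : 0 <= clamp u.
Proof. by rewrite le_max lexx. Qed.

Lemma clamp_le1 u : clamp u <= 1.
Proof. by rewrite ge_max ler01 ge_min lexx. Qed.

Lemma clamp01 u : 0 <= u <= 1 -> clamp u = u.
Proof. by move=> /andP[u0 u1]; rewrite /clamp (min_idPr u1) (max_idPr u0). Qed.

Lemma measurable_clamp : measurable_fun setT clamp.
Proof.
by apply: measurable_maxr => //; apply: measurable_minr => //; exact: measurable_id.
Qed.

Definition cauchy_integrand (x u : R) : R := clamp u * cos (x * ln (clamp u)).

Lemma cauchy_integrand_le1 x u : `|cauchy_integrand x u| <= 1.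
Proof.
rewrite normrM ger0_norm ?clamp_ge0// mulr_ile1 ?clamp_ge0 ?clamp_le1//.
exact: norm_cos_le1.
Qed.

Lemma measurable_cauchy_integrand d (T : measurableType d) (f : T -> R) (g : T -> R) :
  measurable_fun setT f -> measurable_fun setT g ->
  measurable_fun setT (fun x => cauchy_integrand (f x) (g x)).
Proof.
move=> mf mg; have mc : measurable_fun setT (fun x => clamp (g x)).
  exact: (measurableT_comp measurable_clamp).
apply: measurable_funM => //; apply: (measurableT_comp measurable_cos).
by apply: measurable_funM => //; exact: (measurableT_comp (@measurable_ln R)).
Qed.

(** With [u = expR (- s)] this is the cosine transform of [expR (- 2 * s)] on
the half-line. The rate 2 leaves a factor [u], which makes the integrand
continuous on the closed unit interval. *)
Lemma mean_cauchy_integrand (x : R) :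
  mean unif (cauchy_integrand x) = 2 / (4 + x ^+ 2).
Proof.
have x40 : 4 + x ^+ 2 != 0 :> R.
  by rewrite gt_eqF// ltr_wpDr// sqr_ge0.
pose F (u : R) := u ^+ 2 * (2 * cos (x * ln u) + x * sin (x * ln u)) / (4 + x ^+ 2).
have bf : bounded_measurable (cauchy_integrand x).
  split; first by apply: measurable_cauchy_integrand.
  by exists 1 => u; exact: cauchy_integrand_le1.
have dln (u : R) : 0 < u -> is_derive u 1 (fun u => x * ln u) (x / u).
  move=> u0; have := is_deriveM (is_derive_cst x u 1) (is_derive1_ln u0).
  by move/is_derive_eq; apply; rewrite /GRing.scale /= mulr0 addr0.
have dc (u : R) : 0 < u -> is_derive u 1 (fun u => cos (x * ln u)) (- sin (x * ln u) * (x / u)).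
  by move=> u0; exact: (@is_derive1_comp R cos _ u _ _ (is_derive_cos _) (dln u u0)).
have ds (u : R) : 0 < u -> is_derive u 1 (fun u => sin (x * ln u)) (cos (x * ln u) * (x / u)).
  by move=> u0; exact: (@is_derive1_comp R sin _ u _ _ (is_derive_sin _) (dln u u0)).
have dF (u : R) : 0 < u -> is_derive u 1 F (u * cos (x * ln u)).
  move=> u0.
  have H1 := is_deriveD (is_deriveM (is_derive_cst (2 : R) u 1) (dc u u0))
                        (is_deriveM (is_derive_cst x u 1) (ds u u0)).
  have H2 := is_deriveM (is_deriveM (is_derive_id u (1 : R)) (is_derive_id u (1 : R))) H1.
  apply: (is_derive_change (is_deriveM H2 (is_derive_cst (4 + x ^+ 2)^-1 u 1))).
    by move=> y; rewrite /F expr2.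
  have uu : u / u = 1 by rewrite mulfV// gt_eqF.
  rewrite /GRing.scale /= !fctE /cst !mulr0 add0r !addr0.
  have -> : u * u * (2 * (- sin (x * ln u) * (x / u)) + x * (cos (x * ln u) * (x / u))) =
     (u / u) * u * x * (x * cos (x * ln u) - 2 * sin (x * ln u)) by ring.
  by rewrite uu; field.
have F1 : F 1 = 2 / (4 + x ^+ 2).
  by rewrite /F ln1 mulr0 cos0 sin0; ring.
have F0 : F 0 = 0 by rewrite /F; ring.
have cp (u : R) : 0 < u -> {for u, continuous (fun u : R => u * cos (x * ln u))}.
  move=> u0; apply: cvgM; first exact: cvg_id.
  exact: (is_derive_continuous (dc u u0)).
have sq0 (h : R -> R) (M : R) : (forall u, `|h u| <= M) -> (u * h u) @[u --> 0^'+] --> (0 : R).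
  move=> hM; have M0 : 0 <= M by exact: le_trans (hM 0).
  apply/cvgrPdist_le => e e0; near=> u; rewrite sub0r normrN normrM.
  have u0 : 0 <= u by near: u; exact: nbhs_right_ge.
  have hu : u <= e / (M + 1).
    by near: u; apply: nbhs_right_le; rewrite divr_gt0// ltr_wpDl.
  rewrite ger0_norm//; apply: le_trans (_ : u * (M + 1) <= _).
    by rewrite ler_wpM2l// (le_trans (hM u))// lerDl.
  by rewrite -ler_pdivlMr// ltr_wpDl.
have ci (u : R) : 0 <= u <= 1 -> cauchy_integrand x u = u * cos (x * ln u).
  by move=> u01; rewrite /cauchy_integrand clamp01.
transitivity (F 1 - F 0); last by rewrite F1 F0 subr0.
apply: mean_uniform_FTC => //.
- apply/continuous_within_itvP; first exact: ltr01.
  split.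
  + move=> u uI; have /[!in_itv]/= /andP[u0 u1] := uI.
    rewrite /continuous_at ci ?ltW//.
    apply: cvg_trans (cp u u0); apply: near_eq_cvg; near=> z.
    have : z \in `]0, 1[ by near: z; exact: near_in_itvoo.
    by rewrite in_itv/= => /andP[z0 z1]; rewrite ci// !ltW.
  + have -> : cauchy_integrand x 0 = 0 by rewrite ci ?lexx ?ler01// mul0r.
    have H := sq0 (fun u => cos (x * ln u)) 1 (fun u => norm_cos_le1 _).
    apply: cvg_trans H; apply: near_eq_cvg; near=> z; rewrite ci//.
    by apply/andP; split; near: z; [exact: nbhs_right_ge|exact: nbhs_right_le].
  + rewrite ci ?lexx ?ler01//.
    apply: cvg_trans (cvg_at_left_filter (cp 1 ltr01)).
    apply: near_eq_cvg; near=> z; rewrite ci//.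
    by apply/andP; split; near: z; [exact: nbhs_left_ge|exact: nbhs_left_le].
- have hb u : `|(2 * cos (x * ln u) + x * sin (x * ln u)) / (4 + x ^+ 2)| <=
      (2 + `|x|) / `|4 + x ^+ 2|.
    rewrite normrM normfV ler_wpM2r// (le_trans (ler_normD _ _))// lerD//.
      by rewrite normrM normr_nat ler_piMr// norm_cos_le1.
    by rewrite normrM ler_piMr// norm_sin_le1.
  have H := sq0 _ _ hb.
  rewrite F0 -[X in _ --> X](mul0r (0 : R)).
  have -> : F = (fun u => u * (u * ((2 * cos (x * ln u) + x * sin (x * ln u)) / (4 + x ^+ 2)))).
    by apply/funext => u; rewrite /F; ring.
  by apply: cvgM; [exact: cvg_at_right_filter cvg_id | exact: H].
- exact/cvg_at_left_filter/(is_derive_continuous (dF 1 ltr01)).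
- by move=> u /andP[u0 u1]; rewrite ci ?ltW//; exact: dF.
Unshelve. all: by end_near. Qed.

Lemma cauchy_is_derive (c x : R) : is_derive x 1 (fun x => atan ((x - c) / 2))
   (2 / (4 + (x - c) ^+ 2)).
Proof.
have H : is_derive x 1 (fun x : R => (x - c) / 2) (2^-1 : R).
  have := is_deriveM (is_deriveB (is_derive_id x (1 : R)) (is_derive_cst c x 1))
     (is_derive_cst (2^-1 : R) x 1).
  by move/is_derive_eq; apply; rewrite /GRing.scale /=; ring.
have := @is_derive1_comp R atan _ x _ _ (is_derive1_atan _) H.
move/is_derive_eq; apply.
have x40 : 4 + (x - c) ^+ 2 != 0 :> R by rewrite gt_eqF// ltr_wpDr// sqr_ge0.
have -> : 1 + ((x - c) / 2) ^+ 2 = (4 + (x - c) ^+ 2) / 4 by field.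
by rewrite invf_div; field.
Qed.

Lemma norm_cauchy_le1 (y : R) : `|2 / (4 + y ^+ 2)| <= 1.
Proof.
rewrite ger0_norm; last by rewrite divr_ge0// addr_ge0// sqr_ge0.
rewrite ler_pdivrMr ?mul1r; last by rewrite ltr_wpDr// sqr_ge0.
by have := sqr_ge0 y; lra.
Qed.

(** Integrating Cauchy kernels over their location turns what is known from the
characteristic function into differences of arctangents, that is, into smooth
approximations of indicators of intervals. *)
Lemma mean_cauchy_translate (a b z : R) :
  (b - a) * mean unif (fun v => 2 / (4 + (z - a - (b - a) * v) ^+ 2)) =
  atan ((z - a) / 2) - atan ((z - b) / 2).
Proof.
pose F (v : R) := - atan ((z - a - (b - a) * v) / 2).
pose f (v : R) := (b - a) * (2 / (4 + (z - a - (b - a) * v) ^+ 2)).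
have x40 (y : R) : 4 + y ^+ 2 != 0 :> R.
  by rewrite gt_eqF// ltr_wpDr// sqr_ge0.
have ca : continuous (fun v : R => z - a - (b - a) * v).
  move=> v; apply: cvgB; first exact: cvg_cst.
  by apply: cvgM; [exact: cvg_cst|exact: cvg_id].
have ck : continuous (fun v : R => 2 / (4 + (z - a - (b - a) * v) ^+ 2)).
  move=> v; apply: cvgM; first exact: cvg_cst.
  apply: cvgV; first exact: x40.
  apply: cvgD; first exact: cvg_cst.
  exact: (cvgM (ca v) (ca v)).
have bk : bounded_measurable (fun v : R => 2 / (4 + (z - a - (b - a) * v) ^+ 2)).
  by split; [exact: continuous_measurableT | exists 1 => v; exact: norm_cauchy_le1].
have cf : continuous f.
  by move=> v; apply: cvgM; [exact: cvg_cst|exact: ck].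
have dF (v : R) : is_derive v 1 F (f v).
  have H : is_derive v 1 (fun v : R => z - a - (b - a) * v) (- (b - a)).
    have := is_deriveB (is_derive_cst (z - a) v 1)
      (is_deriveM (is_derive_cst (b - a) v 1) (is_derive_id v (1 : R))).
    by move/is_derive_eq; apply; rewrite /GRing.scale /= /cst; ring.
  have := is_deriveN (@is_derive1_comp R (fun y => atan ((y - 0) / 2)) _ v _ _ (cauchy_is_derive 0 _) H).
  have -> : - ((fun y => atan ((y - 0) / 2)) \o (fun v : R => z - a - (b - a) * v)) = F.
    by apply/funext => y; rewrite /F /= fctE /= subr0.
  by move/is_derive_eq; apply; rewrite /f subr0; ring.
rewrite -meanZ; last exact: has_mean_bounded.
have cF : continuous F by move=> v; exact: (is_derive_continuous (dF v)).
transitivity (F 1 - F 0); last first.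
  by rewrite /F mulr1 mulr0 subr0; have -> : z - a - (b - a) = z - b; ring.
apply: (mean_uniform_FTC (f := f)) => //.
- split; first exact: continuous_measurableT.
  by exists `|b - a| => v; rewrite normrM ler_piMr// norm_cauchy_le1.
- exact: continuous_subspaceT.
- exact/cvg_at_right_filter/cF.
- exact/cvg_at_left_filter/cF.
Qed.

End CauchyKernel.

Section CharacteristicFunction.
Context (R : realType).
Notation unif := (uniform_prob (@ltr01 R)).

Definition same_charfun d1 d2 (T1 : measurableType d1) (T2 : measurableType d2)
    (P1 : probability T1 R) (P2 : probability T2 R) (Z1 : T1 -> R) (Z2 : T2 -> R) :=
  forall t : R, mean P1 (fun w => cos (t * Z1 w)) = mean P2 (fun w => cos (t * Z2 w)) /\
                mean P1 (fun w => sin (t * Z1 w)) = mean P2 (fun w => sin (t * Z2 w)).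

Section OneVariable.
Context d (T : measurableType d) (P : probability T R) (Z : T -> R).
Hypothesis mZ : measurable_fun setT Z.

Lemma bounded_measurable_cos (t : R) : bounded_measurable (fun w => cos (t * Z w)).
Proof.
split; last by exists 1 => w; exact: norm_cos_le1.
by apply: (measurableT_comp (@measurable_cos R)); apply: measurable_funM.
Qed.

Lemma bounded_measurable_sin (t : R) : bounded_measurable (fun w => sin (t * Z w)).
Proof.
split; last by exists 1 => w; exact: norm_sin_le1.
by apply: (measurableT_comp (@measurable_sin R)); apply: measurable_funM.
Qed.

Lemma mean_cos_shift (t c : R) : mean P (fun w => cos ((Z w - c) * t)) =
  cos (t * c) * mean P (fun w => cos (t * Z w)) +
  sin (t * c) * mean P (fun w => sin (t * Z w)).
Proof.
have ic := has_mean_bounded P (bounded_measurable_cos t).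
have is_ := has_mean_bounded P (bounded_measurable_sin t).
rewrite -!meanZ// -meanD; [|exact: has_meanZ|exact: has_meanZ].
apply: eq_mean => w; have -> : (Z w - c) * t = t * Z w - t * c by ring.
by rewrite cosB; ring.
Qed.

Lemma bounded_measurable_cauchy_integrand (c : R) :
  bounded_measurable (fun p : T * R => cauchy_integrand (Z p.1 - c) p.2).
Proof.
split; last by exists 1 => p; exact: cauchy_integrand_le1.
apply: measurable_cauchy_integrand => //.
by apply: measurable_funB => //; exact: measurableT_comp.
Qed.

(** Fubini: the kernel is a mixture of cosines, so its mean under the law of [Z]
is a mixture of values of the characteristic function. *)
Lemma mean_cauchy (c : R) : mean P (fun w => 2 / (4 + (Z w - c) ^+ 2)) =
  mean unif (fun u => clamp u *
    (cos (ln (clamp u) * c) * mean P (fun w => cos (ln (clamp u) * Z w)) +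
     sin (ln (clamp u) * c) * mean P (fun w => sin (ln (clamp u) * Z w)))).
Proof.
transitivity (mean P (fun w => mean unif (fun u => cauchy_integrand (Z w - c) u))).
  by apply: eq_mean => w; rewrite mean_cauchy_integrand.
rewrite (mean_exchange P unif (bounded_measurable_cauchy_integrand c)).
apply: eq_mean => u /=; rewrite /cauchy_integrand meanZ ?mean_cos_shift//.
apply: has_mean_bounded; split; last by exists 1 => w; exact: norm_cos_le1.
apply: (measurableT_comp (@measurable_cos R)); apply: measurable_funM => //.
exact: measurable_funB.
Qed.

Lemma measurable_cauchy d' (T' : measurableType d') (f : T' -> R) :
  measurable_fun setT f -> measurable_fun setT (fun w => 2 / (4 + f w ^+ 2)).
Proof.
move=> mf; have ck : continuous (fun y : R => 2 / (4 + y ^+ 2)).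
  move=> v; apply: cvgM; first exact: cvg_cst.
  apply: cvgV; first by rewrite gt_eqF// ltr_wpDr// sqr_ge0.
  apply: cvgD; first exact: cvg_cst.
  exact: (cvgM (@cvg_id _ (nbhs v)) (@cvg_id _ (nbhs v))).
exact: (measurableT_comp (continuous_measurableT ck)).
Qed.

Lemma mean_atan_diff (a b : R) :
  mean P (fun w => atan ((Z w - a) / 2) - atan ((Z w - b) / 2)) =
  (b - a) * mean unif (fun v => mean P (fun w => 2 / (4 + (Z w - (a + (b - a) * v)) ^+ 2))).
Proof.
pose f (p : T * R) := 2 / (4 + (Z p.1 - (a + (b - a) * p.2)) ^+ 2).
have bf : bounded_measurable f.
  split; last by exists 1 => p; exact: norm_cauchy_le1.
  apply: measurable_cauchy; apply: measurable_funB; first exact: measurableT_comp.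
  by apply: measurable_funD => //; apply: measurable_funM.
rewrite -(mean_exchange P unif bf) -meanZ; last first.
  apply: has_mean_bounded; split; first exact: measurable_mean2.
  exists 1 => w; apply: norm_mean_le_cst => [|v]; last exact: norm_cauchy_le1.
  by apply: (measurable_slice2 (f := f)); case: bf.
apply: eq_mean => w; rewrite -mean_cauchy_translate; congr (_ * _).
apply: eq_mean => v; rewrite /f /=.
by have -> : Z w - a - (b - a) * v = Z w - (a + (b - a) * v) by ring.
Qed.

End OneVariable.

Lemma same_mean_atan_diff d1 d2 (T1 : measurableType d1) (T2 : measurableType d2)
    (P1 : probability T1 R) (P2 : probability T2 R) (Z1 : T1 -> R) (Z2 : T2 -> R) :
  measurable_fun setT Z1 -> measurable_fun setT Z2 ->
  same_charfun P1 P2 Z1 Z2 -> forall a b,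
  mean P1 (fun w => atan ((Z1 w - a) / 2) - atan ((Z1 w - b) / 2)) =
  mean P2 (fun w => atan ((Z2 w - a) / 2) - atan ((Z2 w - b) / 2)).
Proof.
move=> m1 m2 H a b; rewrite !mean_atan_diff//; congr (_ * _); apply: eq_mean => v.
rewrite !mean_cauchy//; apply: eq_mean => u.
by have [-> ->] := H (ln (clamp u)).
Qed.

Lemma atan_cvg_ninfty (f : nat -> R) : (f n @[n --> \oo] --> -oo) ->
  atan (f n) @[n --> \oo] --> - (pi / 2 : R).
Proof.
move=> fN; have H : - f n @[n --> \oo] --> +oo by apply/cvgNry.
have H2 : atan (- f n) @[n --> \oo] --> (pi / 2 : R) := cvg_comp _ _ H (@cvgy_atan R).
have -> : (fun n => atan (f n)) = - (fun n => atan (- f n)).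
  by apply/funext => n; rewrite fctE atanN opprK.
exact: cvgN.
Qed.

(** Arctangents of steeper and steeper slope converge to a step function, so
the distribution function is a limit of the quantities above. *)
Lemma same_charfun_tail d1 d2 (T1 : measurableType d1) (T2 : measurableType d2)
    (P1 : probability T1 R) (P2 : probability T2 R) (Z1 : T1 -> R) (Z2 : T2 -> R) :
  measurable_fun setT Z1 -> measurable_fun setT Z2 ->
  same_charfun P1 P2 Z1 Z2 -> forall a,
  P1 (Z1 @^-1` `]a, +oo[) = P2 (Z2 @^-1` `]a, +oo[).
Proof.
move=> m1 m2 H a.
pose k n : R := n.+1%:R ^+ 2.
pose l n : R := a + n.+1%:R^-1.
pose r n : R := a + n.+1%:R.
pose A n (z : R) := atan ((k n * z - k n * l n) / 2) - atan ((k n * z - k n * r n) / 2).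
have AN n : mean P1 (fun w => A n (Z1 w)) = mean P2 (fun w => A n (Z2 w)).
  apply: (same_mean_atan_diff (Z1 := fun w => k n * Z1 w) (Z2 := fun w => k n * Z2 w)).
  - exact: measurable_funM.
  - exact: measurable_funM.
  - move=> t; have [E1 E2] := H (t * k n); split.
      under eq_mean do rewrite mulrA.
      by rewrite E1; apply: eq_mean => w; rewrite mulrA.
    under eq_mean do rewrite mulrA.
    by rewrite E2; apply: eq_mean => w; rewrite mulrA.
have Alim z : A ^~ z @ \oo --> pi * \1_(`]a, +oo[%classic) z.
  have right : atan ((k n * z - k n * r n) / 2) @[n --> \oo] --> - (pi / 2 : R).
    apply: atan_cvg_ninfty; apply/cvgrNyPle => B; near=> n.
    have n1 : z - a + 1 <= n%:R by near: n; exact: nbhs_infty_ger.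
    have n2 : - (2 * B) <= n%:R by near: n; exact: nbhs_infty_ger.
    rewrite /k /r -[n.+1]addn1 natrD; have n0 : 0 <= n%:R :> R by [].
    by nra.
  have scaled (N : R) : N != 0 -> N ^+ 2 * z - N ^+ 2 * (a + N^-1) = N * (N * (z - a) - 1).
    by move=> N0; field.
  have -> : (pi : R) * \1_(`]a, +oo[%classic) z =
      (if a < z then pi / 2 else - (pi / 2) : R) - - (pi / 2).
    rewrite indicE; case: ifPn => az.
      rewrite mem_set /= ?in_itv/= ?az//; lra.
    rewrite memNset /= ?in_itv/= ?andbT; last exact/negP.
    lra.
  apply: cvgB right; case: ifPn => az.
    apply: (cvg_comp _ _ _ (@cvgy_atan R)); apply/cvgryPge => B; near=> n.
    have n1 : 2 / (z - a) <= n%:R by near: n; exact: nbhs_infty_ger.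
    have n2 : 2 * B <= n%:R by near: n; exact: nbhs_infty_ger.
    have za : 0 < z - a by rewrite subr_gt0.
    rewrite ler_pdivrMr// in n1.
    rewrite /k /l scaled ?pnatr_eq0//.
    rewrite -[n.+1]addn1 natrD; have n0 : 0 <= n%:R :> R by [].
    rewrite ler_pdivlMr//; apply: le_trans (_ : n%:R + 1 <= _).
      by rewrite mulrC (le_trans n2)// lerDl.
    by rewrite ler_peMr// ?addr_ge0// mulrDl mul1r; lra.
  apply: atan_cvg_ninfty; apply/cvgrNyPle => B; near=> n.
  have n2 : - (2 * B) <= n%:R by near: n; exact: nbhs_infty_ger.
  rewrite -leNgt in az.
  rewrite /k /l scaled ?pnatr_eq0// -[n.+1]addn1 natrD.
  have n0 : 0 <= n%:R :> R by [].
  by nra.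
have mA n : measurable_fun setT (A n).
  apply: measurable_funB; apply: (measurableT_comp (@measurable_atan R));
  by apply: measurable_funM => //; apply: measurable_funB => //; exact: measurable_funM.
have Ab n z : `|A n z| <= pi.
  have := atan_ltpi2 ((k n * z - k n * l n) / 2).
  have := atan_gtNpi2 ((k n * z - k n * l n) / 2).
  have := atan_ltpi2 ((k n * z - k n * r n) / 2).
  have := atan_gtNpi2 ((k n * z - k n * r n) / 2).
  by rewrite /A ler_norml => *; apply/andP; split; lra.
have lim d (T : measurableType d) (P : probability T R) (Z : T -> R) :
    measurable_fun setT Z ->
    (fun n => mean P (fun w => A n (Z w))) @ \oo --> pi * fine (P (Z @^-1` `]a, +oo[)).
  move=> mZ.
  have mS : measurable (Z @^-1` `]a, +oo[) by rewrite -[X in measurable X]setTI; apply: mZ.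
  have -> : pi * fine (P (Z @^-1` `]a, +oo[)) =
      mean P (fun w => pi * \1_(`]a, +oo[%classic) (Z w)).
    rewrite -mean_indic// -meanZ; last exact/has_mean_bounded/bounded_measurable_indic.
    by apply: eq_mean => w; congr (_ * _); rewrite !indicE; congr (_%:R).
  apply: (mean_dominated_cvg (c := pi)) => //.
  - by move=> n; exact: measurableT_comp.
  - apply: measurable_funM => //.
    have mi : measurable_fun setT (\1_(`]a, +oo[%classic) : R -> R) by exact: measurable_indic.
    exact: (measurableT_comp mi mZ).
have E : fine (P1 (Z1 @^-1` `]a, +oo[)) = fine (P2 (Z2 @^-1` `]a, +oo[)).
  have := lim _ _ P1 Z1 m1; under eq_fun do rewrite AN.
  move=> H1; have E := cvg_unique (@Rhausdorff R) H1 (lim _ _ P2 Z2 m2).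
  have pi0 : (pi : R) != 0 by rewrite gt_eqF// pi_gt0.
  exact: (mulfI pi0 (E _)).
have mS d (T : measurableType d) (Z : T -> R) : measurable_fun setT Z ->
    measurable (Z @^-1` `]a, +oo[).
  by move=> mZ; rewrite -[X in measurable X]setTI; apply: mZ.
rewrite -(fineK (fin_num_measure P1 _ (mS _ _ _ m1))) E fineK//.
exact: fin_num_measure P2 _ (mS _ _ _ m2).
Unshelve. all: by end_near. Qed.

(** Uniqueness of the law with a given characteristic function: half-lines
generate the Borel sets. *)
Lemma same_charfun_law d1 d2 (T1 : measurableType d1) (T2 : measurableType d2)
    (P1 : probability T1 R) (P2 : probability T2 R) (Z1 : T1 -> R) (Z2 : T2 -> R) :
  measurable_fun setT Z1 -> measurable_fun setT Z2 -> same_charfun P1 P2 Z1 Z2 ->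
  forall h : R -> R, bounded_measurable h ->
  mean P1 (fun w => h (Z1 w)) = mean P2 (fun w => h (Z2 w)).
Proof.
move=> m1 m2 H h bh.
pose X1 : {mfun T1 >-> R} := mfun_Sub (mem_set m1).
pose X2 : {mfun T2 >-> R} := mfun_Sub (mem_set m2).
have tail := same_charfun_tail m1 m2 H.
have E : forall A, measurable A -> distribution P1 X1 A = distribution P2 X2 A.
  apply: (measure_unique (@RGenOInfty.G R) (fun n => `] - n%:R, +oo[%classic)).
  - exact: RGenOInfty.measurableE.
  - move=> _ _ [x ->] [y ->]; exists (Num.max x y).
    by apply/seteqP; split=> z /=; rewrite !in_itv/= !andbT gt_max;
      [move=> [-> ->]|move/andP].
  - by move=> n; exists (- n%:R).
  - apply/seteqP; split=> // x _; exists (Num.truncn `|x|).+1 => //=.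
    rewrite in_itv/= andbT ltrNl (le_lt_trans (ler_norm _))// normrN.
    exact: truncnS_gt.
  - by move=> _ [x ->]; exact: tail.
  - by move=> n; rewrite (le_lt_trans (probability_le1 _ _)) ?ltry.
have I d (T : measurableType d) (P : probability T R) (X : {mfun T >-> R}) :
    mean P (fun w => h (X w)) = mean (distribution P X) h.
  rewrite /mean /Rintegral integral_distribution//.
    by apply/measurable_EFinP; case: bh.
  apply: has_mean_bounded; case: bh => mh [M hM]; split; last by exists M => ?.
  exact: measurableT_comp.
rewrite (I _ _ P1 X1) (I _ _ P2 X2) /mean /Rintegral; congr fine.
by apply: eq_measure_integral => A mA _; exact: E.
Qed.

End CharacteristicFunction.

(** * The generalized Dickman law is stationary for the averaging step *)

Section DickmanLaw.
Context (R : realType) (theta : R).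
Hypothesis theta_gt0 : 0 < theta.
Notation unif := (uniform_prob (@ltr01 R)).
Notation ind := (\1_(`]0%R, 1%R]%classic) : R -> R).

(** The quotients below by [u] are controlled on the half-open interval only;
its indicator changes no mean under the uniform law. *)
Lemma mean_uniform_oc (f : R -> R) : bounded_measurable f ->
  mean unif (fun u => ind u * f u) = mean unif f.
Proof.
move=> [mf [M fM]].
have bi : bounded_measurable (fun u => ind u * f u).
  split; first by apply: measurable_funM => //; exact: measurable_indic.
  exists M => u; apply: le_trans (fM u); rewrite normrM ler_piMl// indicE.
  by rewrite ger0_norm// lern1 leq_b1.
have L01 : (@lebesgue_measure R `]0%R, 1%R]%classic < +oo)%E.
  by rewrite lebesgue_measure_itv /= lte_fin ltr01 oppr0 adde0 ltry.
have ib (g : R -> R) : bounded_measurable g ->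
   (@lebesgue_measure R).-integrable `]0%R, 1%R] (EFin \o g).
  move=> [mg [N gN]]; apply: measurable_bounded_integrable => //.
  - exact: measurable_funTS.
  - exists N; split; first exact: num_real.
    by move=> x Mx w _; apply: le_trans (gN w) _; exact: ltW.
have bf : bounded_measurable f by split => //; exists M.
rewrite !mean_uniform// -!Rintegral_itv_obnd_cbnd; [|exact: ib|exact: ib].
by apply: eq_Rintegral => u u01; rewrite indicE u01 mul1r.
Qed.

Lemma mean_sin_scale (t : R) : t * mean unif (fun u => - sin (t * u)) = cos t - 1.
Proof.
have bs : bounded_measurable (fun u : R => - sin (t * u)).
  split; first by apply: measurable_funN; exact: measurable_sin_scale.
  by exists 1 => u; rewrite normrN norm_sin_le1.
have dl (u : R) : is_derive u 1 (fun u => t * u) t.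
  apply: (is_derive_change (is_deriveM (is_derive_cst t u 1) (is_derive_id u (1 : R)))) => //.
  by rewrite /GRing.scale /= /cst; ring.
rewrite -meanZ; last exact: has_mean_bounded.
transitivity (cos (t * 1) - cos (t * 0)); last by rewrite mulr1 mulr0 cos0.
apply: (mean_uniform_FTC (F := fun u => cos (t * u))).
- case: bs => ms [M Ms]; split; first exact: measurable_funM.
  by exists (`|t| * M) => u; rewrite normrM ler_wpM2l.
- apply: continuous_subspaceT => u; apply: cvgM; first exact: cvg_cst.
  by apply: cvgN; exact: continuous_sin_scale.
- exact/cvg_at_right_filter/continuous_cos_scale.
- exact/cvg_at_left_filter/continuous_cos_scale.
- move=> u _.
  apply: (is_derive_change (@is_derive1_comp R cos _ u _ _ (is_derive_cos _) (dl u))) => //.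
  by ring.
Qed.

Lemma mean_cos_scale (t : R) : t * mean unif (fun u => cos (t * u)) = sin t.
Proof.
have bs : bounded_measurable (fun u : R => cos (t * u)).
  split; first exact: measurable_cos_scale.
  by exists 1 => u; rewrite norm_cos_le1.
have dl (u : R) : is_derive u 1 (fun u => t * u) t.
  apply: (is_derive_change (is_deriveM (is_derive_cst t u 1) (is_derive_id u (1 : R)))) => //.
  by rewrite /GRing.scale /= /cst; ring.
rewrite -meanZ; last exact: has_mean_bounded.
transitivity (sin (t * 1) - sin (t * 0)); last by rewrite mulr1 mulr0 sin0 subr0.
apply: (mean_uniform_FTC (F := fun u => sin (t * u))).
- case: bs => ms [M Ms]; split; first exact: measurable_funM.
  by exists (`|t| * M) => u; rewrite normrM ler_wpM2l.
- apply: continuous_subspaceT => u; apply: cvgM; first exact: cvg_cst.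
  exact: continuous_cos_scale.
- exact/cvg_at_right_filter/continuous_sin_scale.
- exact/cvg_at_left_filter/continuous_sin_scale.
- move=> u _.
  apply: (is_derive_change (@is_derive1_comp R sin _ u _ _ (is_derive_sin _) (dl u))) => //.
  by ring.
Qed.

(** Real and imaginary parts of the exponent of the Dickman characteristic
function, divided by [theta], with their derivatives in [t]. *)
Definition exponent_re (t : R) : R := mean unif (fun u => ind u * ((cos (t * u) - 1) / u)).
Definition exponent_im (t : R) : R := mean unif (fun u => ind u * (sin (t * u) / u)).
Definition dexponent_re (t : R) : R := mean unif (fun u => ind u * - sin (t * u)).
Definition dexponent_im (t : R) : R := mean unif (fun u => ind u * cos (t * u)).

Lemma sin_lipschitz (x y : R) : `|sin x - sin y| <= `|x - y|.
Proof.
rewrite -[X in _ <= X]mul1r.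
by apply: (derivative_bound_lipschitz (@is_derive_sin R)); exact: norm_cos_le1.
Qed.

Lemma cos_lipschitz (x y : R) : `|cos x - cos y| <= `|x - y|.
Proof.
rewrite -[X in _ <= X]mul1r.
apply: (derivative_bound_lipschitz (@is_derive_cos R)) => z.
by rewrite normrN norm_sin_le1.
Qed.

Lemma smooth0 : smooth 1 1 (fun _ : R => 0) (fun=> 0).
Proof.
split=> [x|x y]; first by rewrite normr0.
by rewrite mul0r !subr0 normr0 mul1r sqr_ge0.
Qed.

Lemma smooth_cos_slice (u : R) :
  smooth 1 1 (fun t => ind u * ((cos (t * u) - 1) / u)) (fun t => ind u * - sin (t * u)).
Proof.
have [u01|/negbTE u01] := boolP (u \in `]0%R, 1%R]%classic); last first.
  have E f : (fun t : R => ind u * f t) = fun=> 0.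
    by apply/funext => t; rewrite indicE u01 mul0r.
  by rewrite (E (fun t => (cos (t * u) - 1) / u)) (E (fun t => - sin (t * u))); exact: smooth0.
have E f : (fun t : R => ind u * f t) = f.
  by apply/funext => t; rewrite indicE u01 mul1r.
rewrite (E (fun t => (cos (t * u) - 1) / u)) (E (fun t => - sin (t * u))).
move: u01; rewrite inE /= in_itv/= => /andP[u0 u1].
apply: lipschitz_derivative_smooth => // [t|t|t s].
- have dl : is_derive t 1 (fun t => t * u) u.
    apply: (is_derive_change (is_deriveM (is_derive_id t (1 : R)) (is_derive_cst u t 1))) => //.
    by rewrite /GRing.scale /= /cst; ring.
  have dc := @is_derive1_comp R cos _ t _ _ (is_derive_cos _) dl.
  apply: (is_derive_change (is_deriveM (is_deriveB dc (is_derive_cst (1 : R) t 1)) (is_derive_cst u^-1 t 1))) => //.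
  by rewrite /GRing.scale /= /cst; field; rewrite gt_eqF.
- by rewrite normrN norm_sin_le1.
- rewrite mul1r -opprD normrN; apply: le_trans (sin_lipschitz _ _) _.
  by rewrite -mulrBl normrM ler_piMr// ger0_norm// ltW.
Qed.

Lemma smooth_sin_slice (u : R) :
  smooth 1 1 (fun t => ind u * (sin (t * u) / u)) (fun t => ind u * cos (t * u)).
Proof.
have [u01|/negbTE u01] := boolP (u \in `]0%R, 1%R]%classic); last first.
  have E f : (fun t : R => ind u * f t) = fun=> 0.
    by apply/funext => t; rewrite indicE u01 mul0r.
  by rewrite (E (fun t => sin (t * u) / u)) (E (fun t => cos (t * u))); exact: smooth0.
have E f : (fun t : R => ind u * f t) = f.
  by apply/funext => t; rewrite indicE u01 mul1r.
rewrite (E (fun t => sin (t * u) / u)) (E (fun t => cos (t * u))).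
move: u01; rewrite inE /= in_itv/= => /andP[u0 u1].
apply: lipschitz_derivative_smooth => // [t|t|t s].
- have dl : is_derive t 1 (fun t => t * u) u.
    apply: (is_derive_change (is_deriveM (is_derive_id t (1 : R)) (is_derive_cst u t 1))) => //.
    by rewrite /GRing.scale /= /cst; ring.
  have dc := @is_derive1_comp R sin _ t _ _ (is_derive_sin _) dl.
  apply: (is_derive_change (is_deriveM dc (is_derive_cst u^-1 t 1))) => //.
  by rewrite /GRing.scale /= /cst; field; rewrite gt_eqF.
- by rewrite norm_cos_le1.
- rewrite mul1r; apply: le_trans (cos_lipschitz _ _) _.
  by rewrite -mulrBl normrM ler_piMr// ger0_norm// ltW.
Qed.

Lemma measurable_ind_div (f : R -> R) : measurable_fun setT f ->
  measurable_fun setT (fun u => ind u * (f u / u)).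
Proof.
move=> mf; have -> : (fun u => ind u * (f u / u)) = (fun u => ind u * (f u * u `^ (- 1))).
  apply/funext => u; rewrite indicE.
  have [u01|_] := boolP (u \in `]0%R, 1%R]%classic); last by rewrite !mul0r.
  by move: u01; rewrite inE /= in_itv/= => /andP[u0 _]; rewrite powR_inv1 ?ltW.
apply: measurable_funM; first exact: measurable_indic.
by apply: measurable_funM => //; exact: measurable_powR.
Qed.

Lemma bounded_cos_slice (t : R) :
  bounded_measurable (fun u => ind u * ((cos (t * u) - 1) / u)).
Proof.
split.
  by apply: measurable_ind_div; apply: measurable_funB => //; exact: measurable_cos_scale.
exists `|t| => u; have := smooth_lipschitz (smooth_cos_slice u) t 0.
by rewrite mul0r cos0 subrr mul0r mulr0 !subr0 mul1r.
Qed.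

Lemma bounded_sin_slice (t : R) :
  bounded_measurable (fun u => ind u * (sin (t * u) / u)).
Proof.
split; first by apply: measurable_ind_div; exact: measurable_sin_scale.
exists `|t| => u; have := smooth_lipschitz (smooth_sin_slice u) t 0.
by rewrite mul0r sin0 mul0r mulr0 !subr0 mul1r.
Qed.

Lemma smooth_exponent_re : smooth 1 1 exponent_re dexponent_re.
Proof.
rewrite -[X in smooth X](mean_cst unif 1) -[X in smooth _ X](mean_cst unif 1).
apply: (@smooth_mean R _ _ unif _ _ (fun t u => ind u * ((cos (t * u) - 1) / u))
  (fun t u => ind u * - sin (t * u))).
- exact: has_mean_cst.
- exact: has_mean_cst.
- exact: smooth_cos_slice.
- by move=> t; apply: has_mean_bounded; exact: bounded_cos_slice.
- move=> t; apply: measurable_funM; first exact: measurable_indic.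
  by apply: measurable_funN; exact: measurable_sin_scale.
Qed.

Lemma smooth_exponent_im : smooth 1 1 exponent_im dexponent_im.
Proof.
rewrite -[X in smooth X](mean_cst unif 1) -[X in smooth _ X](mean_cst unif 1).
apply: (@smooth_mean R _ _ unif _ _ (fun t u => ind u * (sin (t * u) / u))
  (fun t u => ind u * cos (t * u))).
- exact: has_mean_cst.
- exact: has_mean_cst.
- exact: smooth_sin_slice.
- by move=> t; apply: has_mean_bounded; exact: bounded_sin_slice.
- move=> t; apply: measurable_funM; first exact: measurable_indic.
  exact: measurable_cos_scale.
Qed.

(** Differentiating in [t] cancels the denominator [u], so the derivatives of
the exponent are elementary. *)
Lemma dexponent_reE (t : R) : t * dexponent_re t = cos t - 1.
Proof.
rewrite /dexponent_re mean_uniform_oc ?mean_sin_scale//.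
split; first by apply: measurable_funN; exact: measurable_sin_scale.
by exists 1 => u; rewrite normrN norm_sin_le1.
Qed.

Lemma dexponent_imE (t : R) : t * dexponent_im t = sin t.
Proof.
rewrite /dexponent_im mean_uniform_oc ?mean_cos_scale//.
split; first exact: measurable_cos_scale.
by exists 1 => u; rewrite norm_cos_le1.
Qed.

Lemma lipschitz_mul (f g : R -> R) (a b A B : R) :
  (forall x y, `|f x - f y| <= a * `|x - y|) -> (forall x y, `|g x - g y| <= b * `|x - y|) ->
  (forall x, `|f x| <= A) -> (forall x, `|g x| <= B) ->
  forall x y, `|f x * g x - f y * g y| <= (a * B + A * b) * `|x - y|.
Proof.
move=> fa gb fA gB x y.
have -> : f x * g x - f y * g y = (f x - f y) * g x + f y * (g x - g y) by ring.
rewrite [leRHS]mulrDl; apply: le_trans (ler_normD _ _) _; rewrite !normrM lerD//.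
  by rewrite mulrAC ler_pM.
by rewrite -mulrA ler_pM.
Qed.

Lemma cexp_im (y : R) : cexp (Complex 0 y) = Complex (cos y) (sin y).
Proof. by rewrite /cexp /= expR0 !mul1r. Qed.

Section Solution.
Context d (T : measurableType d) (P : probability T R) (Z : T -> R).
Hypothesis mZ : measurable_fun setT Z.
Hypothesis dickmanZ : generalized_dickman theta P Z.

Let psi_re t := mean P (fun w => cos (t * Z w)).
Let psi_im t := mean P (fun w => sin (t * Z w)).

Lemma dickman_charfun t :
  psi_re t = expR (theta * exponent_re t) * cos (theta * exponent_im t) /\
  psi_im t = expR (theta * exponent_re t) * sin (theta * exponent_im t).
Proof.
have quot (z : R[i]) (x : R) : z / (real_complex R x) = Complex (complex.Re z / x) (complex.Im z / x).
  have -> : (real_complex R x)^-1 = real_complex R x^-1 by rewrite fmorphV.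
  by case: z => a b; simpc.
have slice (f g : R -> R) : bounded_measurable (fun u => ind u * f u) ->
    g 0 = 0 -> (forall u, g u = f u) ->
    mean unif (fun u => ind u * f u) = \int[lebesgue_measure]_(x in `[0%R, 1%R]) g x.
  move=> bf g0 gf; rewrite mean_uniform//; apply: eq_Rintegral => u.
  rewrite inE /= in_itv/= => /andP[u0 u1]; rewrite indicE.
  have [u01|] := boolP (u \in `]0%R, 1%R]%classic); first by rewrite mul1r gf.
  rewrite notin_setE /= in_itv/= u1 andbT => /negP; rewrite -leNgt => u0'.
  by have -> : u = 0 by [apply/eqP; rewrite eq_le u0 u0']; rewrite g0 mul0r.
have Ere : exponent_re t = \int[lebesgue_measure]_(x in `[0%R, 1%R])
    complex.Re ((cexp (Complex 0 (t * x)) - 1) / (real_complex R x)).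
  apply: slice; first exact: bounded_cos_slice.
    by rewrite quot invr0 !mulr0.
  by move=> u; rewrite quot cexp_im.
have Eim : exponent_im t = \int[lebesgue_measure]_(x in `[0%R, 1%R])
    complex.Im ((cexp (Complex 0 (t * x)) - 1) / (real_complex R x)).
  apply: slice; first exact: bounded_sin_slice.
    by rewrite quot invr0 !mulr0.
  by move=> u; rewrite quot cexp_im /= subr0.
have := dickmanZ t; rewrite /cexpectation /cRintegral -Ere -Eim.
have -> : real_complex R theta * Complex (exponent_re t) (exponent_im t) =
   Complex (theta * exponent_re t) (theta * exponent_im t).
  by simpc.
rewrite {3}/cexp /= => -[H1 H2]; split.
  rewrite -H1 /psi_re meanE; congr (fine (expectation P _)).
  by apply/funext => w; rewrite expR0 mul1r.
rewrite -H2 /psi_im meanE; congr (fine (expectation P _)).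
by apply/funext => w; rewrite expR0 mul1r.
Qed.

Lemma norm_psi_re t : `|psi_re t| <= 1.
Proof.
apply: norm_mean_le_cst => [|w]; last exact: norm_cos_le1.
by case: (bounded_measurable_cos mZ t).
Qed.

Lemma norm_psi_im t : `|psi_im t| <= 1.
Proof.
apply: norm_mean_le_cst => [|w]; last exact: norm_sin_le1.
by case: (bounded_measurable_sin mZ t).
Qed.

Let dpsi_re t := theta * (dexponent_re t * psi_re t - dexponent_im t * psi_im t).
Let dpsi_im t := theta * (dexponent_re t * psi_im t + dexponent_im t * psi_re t).

(** In complex form, [t * psi' t = theta * (expR (i * t) - 1) * psi t]. *)
Lemma is_derive_psi (t : R) :
  is_derive t 1 psi_re (dpsi_re t) /\ is_derive t 1 psi_im (dpsi_im t).
Proof.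
have scal (f : R -> R) l : is_derive t 1 f l -> is_derive t 1 (fun t => theta * f t) (theta * l).
  move=> fl; apply: (is_derive_change (is_deriveM (is_derive_cst theta t 1) fl)) => //.
  by rewrite /GRing.scale /= /cst; ring.
have dr := scal _ _ (smooth_is_derive smooth_exponent_re t).
have di := scal _ _ (smooth_is_derive smooth_exponent_im t).
have de := @is_derive1_comp R expR _ t _ _ (is_derive_expR _) dr.
have dc := @is_derive1_comp R cos _ t _ _ (is_derive_cos _) di.
have ds := @is_derive1_comp R sin _ t _ _ (is_derive_sin _) di.
split.
  apply: (is_derive_change (is_deriveM de dc)).
    by move=> y; have [-> _] := dickman_charfun y.
  rewrite /dpsi_re; have [-> ->] := dickman_charfun t.
  by rewrite /GRing.scale /=; ring.
apply: (is_derive_change (is_deriveM de ds)).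
  by move=> y; have [_ ->] := dickman_charfun y.
rewrite /dpsi_im; have [-> ->] := dickman_charfun t.
by rewrite /GRing.scale /=; ring.
Qed.

Lemma norm_dpsi t : `|dpsi_re t| <= 2 * theta /\ `|dpsi_im t| <= 2 * theta.
Proof.
have [r1 _] := smooth_exponent_re; have [i1 _] := smooth_exponent_im.
have pr := norm_psi_re t; have pi_ := norm_psi_im t.
rewrite /dpsi_re /dpsi_im !normrM gtr0_norm// ![theta * _]mulrC !(ler_pM2r theta_gt0).
split.
  apply: le_trans (ler_normB _ _) _; rewrite !normrM.
  by rewrite (_ : 2 = 1 + 1)// lerD// mulr_ile1.
apply: le_trans (ler_normD _ _) _; rewrite !normrM.
by rewrite (_ : 2 = 1 + 1)// lerD// mulr_ile1.
Qed.

Lemma smooth_psi : exists b, smooth (2 * theta) b psi_re dpsi_re /\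
  smooth (2 * theta) b psi_im dpsi_im.
Proof.
have [r1 _] := smooth_exponent_re; have [i1 _] := smooth_exponent_im.
have rl := smooth_derivative_lipschitz smooth_exponent_re.
have il := smooth_derivative_lipschitz smooth_exponent_im.
have pl := derivative_bound_lipschitz (fun t => proj1 (is_derive_psi t))
   (fun t => proj1 (norm_dpsi t)).
have ql := derivative_bound_lipschitz (fun t => proj2 (is_derive_psi t))
   (fun t => proj2 (norm_dpsi t)).
pose c := 2 * 1 * 1 + 1 * (2 * theta).
have c0 : 0 <= c by rewrite /c; have := theta_gt0; lra.
have l1 := lipschitz_mul rl pl r1 norm_psi_re.
have l2 := lipschitz_mul il ql i1 norm_psi_im.
have l3 := lipschitz_mul rl ql r1 norm_psi_im.
have l4 := lipschitz_mul il pl i1 norm_psi_re.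
have th0 := ltW theta_gt0.
exists (theta * (c + c)); split; apply: lipschitz_derivative_smooth.
- by rewrite mulr_ge0// addr_ge0.
- by move=> t; have [] := is_derive_psi t.
- by move=> t; have [] := norm_dpsi t.
- move=> x y; rewrite /dpsi_re -mulrBr normrM ger0_norm// -mulrA ler_wpM2l//.
  have -> : dexponent_re x * psi_re x - dexponent_im x * psi_im x -
    (dexponent_re y * psi_re y - dexponent_im y * psi_im y) =
    (dexponent_re x * psi_re x - dexponent_re y * psi_re y) -
    (dexponent_im x * psi_im x - dexponent_im y * psi_im y) by ring.
  by rewrite mulrDl; apply: le_trans (ler_normB _ _) _; rewrite lerD.
- by rewrite mulr_ge0// addr_ge0.
- by move=> t; have [] := is_derive_psi t.
- by move=> t; have [] := norm_dpsi t.
- move=> x y; rewrite /dpsi_im -mulrBr normrM ger0_norm// -mulrA ler_wpM2l//.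
  have -> : dexponent_re x * psi_im x + dexponent_im x * psi_re x -
    (dexponent_re y * psi_im y + dexponent_im y * psi_re y) =
    (dexponent_re x * psi_im x - dexponent_re y * psi_im y) +
    (dexponent_im x * psi_re x - dexponent_im y * psi_re y) by ring.
  by rewrite mulrDl; apply: le_trans (ler_normD _ _) _; rewrite lerD.
Qed.

(** By the differential equation for the characteristic function [psi] and the
averaging equation, [psi] is the average of [t -> expR (i * t) * psi t], which
is the characteristic function of [Z + 1]. *)
Lemma psi_fixed x :
  psi_re x = mean unif (fun u => cos (pull theta u * x) * psi_re (pull theta u * x) -
                                 sin (pull theta u * x) * psi_im (pull theta u * x)) /\
  psi_im x = mean unif (fun u => cos (pull theta u * x) * psi_im (pull theta u * x) +
                                 sin (pull theta u * x) * psi_re (pull theta u * x)).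
Proof.
have [b [sr si]] := smooth_psi.
have er := avg_equation theta_gt0 x sr; have ei := avg_equation theta_gt0 x si.
have br := bounded_smooth_pull theta x sr; have bi := bounded_smooth_pull theta x si.
have dr := bounded_smooth_dpull theta x sr; have di := bounded_smooth_dpull theta x si.
have key (f df g : R -> R) : bounded_measurable (fun u => f (pull theta u * x)) ->
  bounded_measurable (fun u => pull theta u * df (pull theta u * x)) ->
  theta * (f x - avg theta f x) = x * davg theta df x ->
  (forall y, y * df y = theta * (g y - f y)) ->
  f x = mean unif (fun u => g (pull theta u * x)).
  move=> bf bd e dfg.
  have : theta * mean unif (fun u => g (pull theta u * x)) =
      theta * avg theta f x + x * davg theta df x.
    rewrite /avg /davg -!meanZ; [|exact: has_mean_bounded..|].
      rewrite -meanD; [|exact/has_meanZ/has_mean_bounded..].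
      apply: eq_mean => u; have := dfg (pull theta u * x).
      by rewrite mulrA [x * _]mulrC => ->; ring.
    have -> : (fun u => g (pull theta u * x)) = (fun u => f (pull theta u * x) +
        theta^-1 * x * (pull theta u * df (pull theta u * x))).
      apply/funext => u; have := dfg (pull theta u * x) => E.
      have -> : theta^-1 * x * (pull theta u * df (pull theta u * x)) =
         theta^-1 * (pull theta u * x * df (pull theta u * x)) by ring.
      by rewrite E; field; rewrite gt_eqF.
    by apply: has_meanD; [|apply: has_meanZ]; exact: has_mean_bounded.
  rewrite -e => E; apply: (mulfI (lt0r_neq0 theta_gt0)).
  by rewrite E; ring.
split.
  apply: (key psi_re dpsi_re (fun y => cos y * psi_re y - sin y * psi_im y)) => // y.
  rewrite /dpsi_re.
  have -> : y * (theta * (dexponent_re y * psi_re y - dexponent_im y * psi_im y)) =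
    theta * ((y * dexponent_re y) * psi_re y - (y * dexponent_im y) * psi_im y) by ring.
  by rewrite dexponent_reE dexponent_imE; ring.
apply: (key psi_im dpsi_im (fun y => cos y * psi_im y + sin y * psi_re y)) => // y.
rewrite /dpsi_im.
have -> : y * (theta * (dexponent_re y * psi_im y + dexponent_im y * psi_re y)) =
  theta * ((y * dexponent_re y) * psi_im y + (y * dexponent_im y) * psi_re y) by ring.
by rewrite dexponent_reE dexponent_imE; ring.
Qed.

Let W (p : measurableTypeR R * T) := pull theta p.1 * (Z p.2 + 1).

Let mW : measurable_fun setT W.
Proof.
apply: measurable_funM; first exact: (measurableT_comp (@measurable_pull R theta)).
by apply: measurable_funD => //; exact: measurableT_comp.
Qed.

Lemma dickman_same_charfun : same_charfun P (unif \x P)%E Z W.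
Proof.
move=> t; have [er ei] := psi_fixed t.
have bc := bounded_measurable_cos mW t; have bs := bounded_measurable_sin mW t.
have ic x := has_mean_bounded P (bounded_measurable_cos mZ x).
have is_ x := has_mean_bounded P (bounded_measurable_sin mZ x).
rewrite (mean_product12 unif P bc) (mean_product12 unif P bs); split.
  rewrite -/(psi_re t) er; apply: eq_mean => u; rewrite /W /= /psi_re /psi_im.
  rewrite -!meanZ// -meanB; [|exact: has_meanZ..].
  apply: eq_mean => w.
  have -> : t * (pull theta u * (Z w + 1)) = pull theta u * t * Z w + pull theta u * t by ring.
  by rewrite cosD; ring.
rewrite -/(psi_im t) ei; apply: eq_mean => u; rewrite /W /= /psi_re /psi_im.
rewrite -!meanZ// -meanD; [|exact: has_meanZ..].
apply: eq_mean => w.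
have -> : t * (pull theta u * (Z w + 1)) = pull theta u * t * Z w + pull theta u * t by ring.
by rewrite sinD; ring.
Qed.

(** The distributional identity Z = U `^ theta^-1 * (Z + 1), with U uniform and
independent of Z, in terms of means of test functions. *)
Lemma dickman_step h : bounded_measurable h ->
  mean P (fun w => h (Z w)) = mean P (fun w => step theta h (Z w)).
Proof.
move=> bh; rewrite (same_charfun_law mZ mW dickman_same_charfun bh).
rewrite mean_product21//; case: bh => mh [M hM]; split; last by exists M.
exact: measurableT_comp.
Qed.

End Solution.

End DickmanLaw.

(** * Independence *)

Section Independence.
Context d (T : measurableType d) (R : realType) (P : probability T R).

(** Two independent variables may be sampled on separate copies of the
probability space. *)
Lemma independent_pair_law (X Y : T -> R) :
  measurable_fun setT X -> measurable_fun setT Y -> independent_pair P X Y ->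
  forall E : set (R * R), measurable E ->
  P ((fun w => (X w, Y w)) @^-1` E) =
  (P \x P)%E ((fun p : T * T => (X p.1, Y p.2)) @^-1` E).
Proof.
move=> mX mY XY E mE.
pose XX : {mfun T >-> R} := mfun_Sub (mem_set mX).
pose YY : {mfun T >-> R} := mfun_Sub (mem_set mY).
have mXY : measurable_fun setT (fun w => (X w, Y w)) by exact: measurable_fun_pair.
have mXY2 : measurable_fun setT (fun p : T * T => (X p.1, Y p.2)).
  by apply: measurable_fun_pair; exact: measurableT_comp.
pose J1 : {mfun T >-> (R * R)%type} := mfun_Sub (mem_set mXY).
pose J2 : {mfun (T * T)%type >-> (R * R)%type} := mfun_Sub (mem_set mXY2).
have H1 := @product_measure_unique _ _ _ _ _ (distribution P XX) (distribution P YY)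
  (distribution P J1).
have H2 := @product_measure_unique _ _ _ _ _ (distribution P XX) (distribution P YY)
  (distribution (P \x P)%E J2).
have mpre (f : {mfun T >-> R}) A : measurable A -> measurable (f @^-1` A).
  by move=> mA; exact: measurable_funPTI.
transitivity ((distribution P XX \x distribution P YY)%E E).
  by rewrite H1// => A B mA mB; exact: XY.
rewrite H2// => A B mA mB.
exact: (product_measure1E P P (mpre XX A mA) (mpre YY B mB)).
Qed.

(** The dominating function of the first variable alone gives integrability on
the product space, hence Fubini. *)
Lemma mean_independent (X Y : T -> R) (f : R * R -> R) (g : R -> R) :
  measurable_fun setT X -> measurable_fun setT Y -> independent_pair P X Y ->
  measurable_fun setT f -> (forall x y, `|f (x, y)| <= g x) ->
  has_mean P (fun w => g (X w)) ->
  mean P (fun w => f (X w, Y w)) =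
  mean P (fun w' => mean P (fun w => f (X w, Y w'))).
Proof.
move=> mX mY XY mf fg ig.
have mXY : measurable_fun setT (fun w => (X w, Y w)) by exact: measurable_fun_pair.
have mXY2 : measurable_fun setT (fun p : T * T => (X p.1, Y p.2)).
  by apply: measurable_fun_pair; exact: measurableT_comp.
pose J1 : {mfun T >-> (R * R)%type} := mfun_Sub (mem_set mXY).
pose J2 : {mfun (T * T)%type >-> (R * R)%type} := mfun_Sub (mem_set mXY2).
have mf2 : measurable_fun setT (fun p : T * T => f (X p.1, Y p.2)) by exact: measurableT_comp.
have gn w y : `|f (X w, Y y)| <= `|g (X w)| by exact: le_trans (fg _ _) (ler_norm _).
have i1 : has_mean P (fun w => f (X w, Y w)).
  by apply: has_mean_le ig _ => //; exact: measurableT_comp.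
have i1y y : has_mean P (fun w => f (X w, Y y)).
  apply: has_mean_le ig _ => //; apply: (measurableT_comp mf).
  exact: measurable_fun_pair.
have i2 : has_mean (P \x P)%E (fun p : T * T => f (X p.1, Y p.2)).
  apply/integrable21ltyP; first exact/measurable_EFinP.
  apply: (@le_lt_trans _ _ (\int[P]_y \int[P]_x `|g (X x)|%:E)%E).
    apply: ge0_le_integral => //.
    - by move=> y _; apply: integral_ge0.
    - apply: (measurable_fun_fubini_tonelli_G (fun p : T * T => (`|f (X p.1, Y p.2)|)%:E)).
        by apply/measurable_EFinP; exact: measurableT_comp.
      by move=> p; rewrite lee_fin.
    - move=> y _; apply: ge0_le_integral => //.
      + apply/measurable_EFinP; apply: measurableT_comp => //.
        exact: has_mean_measurable (i1y y).
      + by apply/measurable_EFinP; apply: measurableT_comp => //; exact: has_mean_measurable ig.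
      + by move=> x _; rewrite lee_fin.
  rewrite integral_cst//.
  have /= -> := @probability_setT _ _ _ P; rewrite mule1.
  by have /integrableP[_] := ig.
have -> : mean P (fun w => f (X w, Y w)) = mean (P \x P)%E (fun p : T * T => f (X p.1, Y p.2)).
  rewrite /mean /Rintegral; congr fine.
  have mfE : measurable_fun setT (EFin \o f) by exact/measurable_EFinP.
  have := @integral_distribution _ _ _ _ _ P J1 (EFin \o f) mfE i1.
  have := @integral_distribution _ _ _ _ _ (P \x P)%E J2 (EFin \o f) mfE i2.
  rewrite /= => <- <-.
  by apply: eq_measure_integral => E mE _; exact: independent_pair_law.
rewrite /mean {1}/Rintegral -(integral21_prod_meas1 i2).
rewrite /Rintegral; congr fine; apply: eq_integral => y _.
by rewrite /fubini_G fineK//; apply: integrable_fin_num => //; exact: i1y.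
Qed.

(** Finite intersections of events [X i \in C i] with [i] in [s] form a
pi-system generating the sigma-algebra that the sum is measurable for. *)
Lemma independent_sum (X : nat -> {RV P >-> R}) (c : nat -> R) (s : seq nat) (k : nat) :
  mutually_independent P [set i | (0 < i)%N] X ->
  uniq s -> (0 < k)%N -> k \notin s -> all (ltn 0) s ->
  independent_pair P (X k) (fun w => \sum_(j <- s) c j * X j w).
Proof.
move=> indX us k0 ks s0 A B mA mB.
pose G : set (set T) := [set E | exists2 C : nat -> set R, (forall i, measurable (C i)) &
   E = \bigcap_(i in [set` s]) (X i @^-1` C i)].
have mXA : measurable (X k @^-1` A) by exact: measurable_funPTI.
pose m1 := mrestr P mXA.
pose q : {nonneg R} := NngNum (fine_ge0 (measure_ge0 P (X k @^-1` A))).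
pose m2 := mscale q P.
have GC : forall E, G E -> P (X k @^-1` A `&` E) = (P (X k @^-1` A) * P E)%E.
  move=> E [C mC ->].
  have sp : {in s, forall i, (0 < i)%N} by move=> i /(allP s0).
  have -> : X k @^-1` A `&` \bigcap_(i in [set` s]) (X i @^-1` C i) =
      \bigcap_(i in [set` k :: s]) (X i @^-1` (if i == k then A else C i)).
    have ik i : i \in s -> (i == k) = false.
      by move=> is_; apply/eqP => ik; move: ks; rewrite -ik is_.
    apply/seteqP; split=> [w [Aw Cw] i|w Cw].
      rewrite /= inE; case: eqP => [-> //|_ /= is_]; exact: Cw.
    split; first by have := Cw k; rewrite /= inE eqxx; exact.
    by move=> i /= is_; have := Cw i; rewrite /= inE is_ orbT ik//; exact.
  rewrite indX//=; last 3 first.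
  - by rewrite ks.
  - by move=> i; rewrite inE => /orP[/eqP ->|/sp].
  - by move=> i; case: ifP.
  rewrite big_cons eqxx; congr (_ * _)%E; rewrite indX//.
  apply: eq_big_seq => i is_; case: eqP => // ik.
  by move: ks; rewrite -ik is_.
have mG : G `<=` measurable.
  move=> E [C mC ->]; apply: bigcap_measurableType => //= i _.
  exact: measurable_funPTI.
have setIG : setI_closed G.
  move=> _ _ [C1 mC1 ->] [C2 mC2 ->]; exists (fun i => C1 i `&` C2 i).
    by move=> i; exact: measurableI.
  by rewrite -bigcapI; apply: eq_bigcapr => i _; rewrite preimage_setI.
have GT : G setT.
  exists (fun=> setT) => //; apply/esym/seteqP; split=> // w _ i _ //=.
have mS : measurable_fun (setT : set (g_sigma_algebraType G)) (fun w => \sum_(j <- s) c j * X j w).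
  have -> : (fun w => \sum_(j <- s) c j * X j w) =
      (fun w => \sum_(j <- s) c j * (if j \in s then X j w else 0)).
    by apply/funext => w; apply: eq_big_seq => j ->.
  apply: measurable_sum => j; apply: measurable_funM; first exact: measurable_cst.
  have [js|_] := boolP (j \in s); last exact: measurable_cst.
  move=> _ C mC; rewrite setTI; apply: sub_sigma_algebra.
  exists (fun i => if i == j then C else setT); first by move=> i; case: ifP.
  apply/seteqP; split=> w.
    by move=> Cw i _ /=; case: eqP => [->|].
  by move=> /(_ j js) /=; rewrite eqxx.
have sG : <<s G >> ((fun w => \sum_(j <- s) c j * X j w) @^-1` B).
  by have := mS measurableT B mB; rewrite setTI.
have U := @g_sigma_algebra_measure_unique _ _ _ G mG (fun=> setT) (fun=> GT) _ m1 m2 setIG _ _ _ sG.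
rewrite setIC; apply: etrans (U _ _ _) _.
- by apply/seteqP; split=> // w _; exists 0.
- move=> E GE.
  change (P (E `&` X k @^-1` A) = ((fine (P (X k @^-1` A)))%:E * P E)%E).
  by rewrite setIC GC// fineK// fin_num_measure.
- move=> _; change (P (setT `&` X k @^-1` A) < +oo)%E.
  by rewrite setTI (le_lt_trans (probability_le1 P _)) ?ltry.
- set S := _ @^-1` B.
  change (((fine (P (X k @^-1` A)))%:E * P S)%E = (P (X k @^-1` A) * P S)%E).
  by rewrite fineK// fin_num_measure.
Qed.

End Independence.

(** * Size bias and the random index *)

Section SizeBias.
Context d (T : measurableType d) (R : realType) (P : probability T R).
Variables X Xs : {RV P >-> R}.
Hypothesis X_integrable : has_mean P X.
Hypothesis biased : size_bias_increment P X Xs.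

Lemma size_bias_mean (phi : R -> R) : bounded_measurable phi ->
  mean P (fun w => X w * phi (X w)) = mean P X * mean P (fun w => phi (X w + Xs w)).
Proof.
move=> [mphi [M phiM]]; have := biased mphi (ex_intro _ M phiM).
have i1 : has_mean P (fun w => X w * phi (X w)).
  apply: (has_mean_le (g := fun w => M * X w)) => [||w].
  - by apply: measurable_funM => //; exact: measurableT_comp.
  - exact: has_meanZ.
  - rewrite !normrM mulrC ler_wpM2r//; exact: le_trans (phiM _) (ler_norm _).
have i2 : has_mean P (fun w => phi (X w + Xs w)).
  apply: has_mean_bounded; split; last by exists M.
  by apply: (measurableT_comp mphi); exact: measurable_funD.
rewrite -(EFin_mean i1) -(EFin_mean i2) -(EFin_mean X_integrable) -EFinM.
by case.
Qed.

(** Under the size-bias identity a nonnegative mean makes [X] almost surely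
nonnegative:
on the indicator of the negative numbers the defining identity has a
nonpositive left-hand side and a nonnegative right-hand side. *)
Lemma size_bias_mean_norm : 0 <= mean P X -> mean P (fun w => `|X w|) = mean P X.
Proof.
move=> m0; have mneg : measurable [set x : R | x < 0].
  by have -> : [set x : R | x < 0] = `]-oo, 0[%classic by apply/seteqP; split=> x /=; rewrite in_itv.
have bi : bounded_measurable (\1_[set x : R | x < 0] : R -> R).
  exact: bounded_measurable_indic.
have E := size_bias_mean bi.
have H : 0 <= mean P (fun w => X w * \1_[set x : R | x < 0] (X w)).
  by rewrite E mulr_ge0// mean_ge0// => w; rewrite indicE.
apply/eqP; rewrite eq_le; apply/andP; split; last first.
  by apply: le_mean => // [|w]; [exact: has_mean_norm|exact: ler_norm].
have i1 : has_mean P (fun w => X w * \1_[set x : R | x < 0] (X w)).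
  apply: has_mean_le X_integrable _ => // [|w].
    have [mi _] := bi; apply: measurable_funM => //; exact: (measurableT_comp mi).
  by rewrite normrM ler_piMr// indicE ger0_norm// lern1 leq_b1.
have -> : mean P (fun w => `|X w|) =
    mean P (fun w => X w - 2 * (X w * \1_[set x : R | x < 0] (X w))).
  apply: eq_mean => w; rewrite indicE; case: (ltP (X w) 0) => Xw.
    by rewrite mem_set// ltr0_norm//=; lra.
  by rewrite memNset /= ?ger0_norm//; [lra|apply/negP; rewrite -leNgt].
rewrite meanB ?meanZ//; last exact: has_meanZ.
by lra.
Qed.

End SizeBias.

Section RandomIndex.
Context d (T : measurableType d) (R : realType) (P : probability T R).
Variables (X Xs : nat -> {RV P >-> R}) (n : nat) (I : {RV P >-> nat}).
Hypothesis I_index : random_index P X Xs n I.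
Let m k := mean P (X k).
Let W := total_weight P X n.
Hypothesis W_neq0 : W != 0.

Lemma total_weightE : W = \sum_(1 <= k < n.+1) k%:R * m k.
Proof. by apply: eq_bigr => k _; rewrite /m meanE. Qed.

(** When [m k = 0] the index avoids [k] almost surely, and both sides vanish. *)
Lemma mean_random_index_term (k : nat) (psi : R -> R) : (1 <= k <= n)%N ->
  measurable_fun setT psi -> (m k != 0 -> has_mean P (fun w => psi (Xs k w))) ->
  has_mean P (fun w => (I w == k)%:R * psi (Xs k w)) /\
  W * mean P (fun w => (I w == k)%:R * psi (Xs k w)) =
  k%:R * m k * mean P (fun w => psi (Xs k w)).
Proof.
move=> kn mpsi ipsi; have [_ indI lawI] := I_index.
have k0 : (0 < k)%N by case/andP: kn.
have mI : measurable_fun setT (fun w => (I w == k)%:R : R).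
  have -> : (fun w => (I w == k)%:R : R) = \1_(I @^-1` [set k]).
    apply/funext => w; rewrite indicE; congr (_%:R).
    by apply: congr1; apply/eqP/idP => [|]; rewrite inE.
  by apply: measurable_indic; exact: measurable_funPTI.
have mS : measurable (I @^-1` [set k]) by exact: measurable_funPTI.
have mp : measurable_fun setT (fun w => psi (Xs k w)) by exact: measurableT_comp.
have meanI : mean P (fun w => (I w == k)%:R) = k%:R * m k / W.
  rewrite (_ : (fun w => _) = \1_(I @^-1` [set k])).
    by rewrite mean_indic// lawI//= /m meanE.
  apply/funext => w; rewrite indicE; congr (_%:R).
  by apply: congr1; apply/eqP/idP => [|]; rewrite inE.
have [mk0|mk0] := eqVneq (m k) 0.
  have P0 : P (I @^-1` [set k]) = 0%E.
    by rewrite lawI//= -meanE -/(m k) mk0 mulr0 mul0r.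
  have ae0 : {ae P, forall w, (I w == k)%:R * psi (Xs k w) = 0}.
    exists (I @^-1` [set k]); split => // w /= H.
    by apply/eqP/negPn/negP => /negbTE E; apply: H; rewrite E mul0r.
  split; last first.
    rewrite mk0 mulr0 mul0r (ae_eq_mean _ _ ae0) ?mean_cst ?mulr0//.
    exact: measurable_funM.
  apply: has_mean_ae0 => //; exact: measurable_funM.
have ip := ipsi mk0.
have ind : independent_pair P (Xs k) (fun w => (I w == k)%:R : R).
  move=> A B mA mB.
  have cap : \bigcap_(i in [set` [:: (inr k : nat + nat)]])
      (joint_family (fun x : nat => X x) (fun x : nat => Xs x) i @^-1` A) = Xs k @^-1` A.
    apply/seteqP; split=> w; first by move=> /(_ (inr k)); apply; rewrite /= inE.
    by move=> Aw i /=; rewrite inE => /eqP ->.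
  have := indI [set j | B ((j == k)%:R)] [:: inr k] (fun=> A) Logic.I _ (fun=> mA).
  rewrite cap setIC muleC; apply.
  by move=> i; rewrite inE => /eqP ->.
split.
  apply: has_mean_le ip _ => // [|w]; first exact: measurable_funM.
  by rewrite normrM ler_piMl// ger0_norm// lern1 leq_b1.
pose f (p : R * R) := psi p.1 * clamp p.2.
have -> : mean P (fun w => (I w == k)%:R * psi (Xs k w)) =
    mean P (fun w => f (Xs k w, (I w == k)%:R)).
  apply: eq_mean => w; rewrite /f /= mulrC; congr (_ * _).
  by rewrite clamp01//; case: eqP => _ /=; rewrite ?lexx ?ler01.
rewrite (mean_independent (g := fun x => `|psi x|)) //.
- have -> : mean P (fun w' => mean P (fun w => f (Xs k w, (I w' == k)%:R))) =
      mean P (fun w' => mean P (fun w => psi (Xs k w)) * (I w' == k)%:R).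
    apply: eq_mean => w'; rewrite mulrC -meanZ//; apply: eq_mean => w.
    rewrite /f /= mulrC; congr (_ * _).
    by rewrite clamp01//; case: eqP => _ /=; rewrite ?lexx ?ler01.
  rewrite meanZ ?meanI; first by field.
  apply: has_mean_bounded; split => //; exists 1 => w.
  by rewrite ger0_norm// lern1 leq_b1.
- apply: measurable_funM; first exact: measurableT_comp.
  by apply: (measurableT_comp (@measurable_clamp R)).
- move=> x y; rewrite /f normrM ler_piMr// ger0_norm ?clamp_ge0//.
  exact: clamp_le1.
- exact: has_mean_norm.
Qed.

(** The law of [I] makes a mean over the randomly chosen increment the average
of the means over the increments, with weights [k%:R * m k]. *)
Lemma mean_random_index (psi : nat -> R -> R) :
  (forall k, measurable_fun setT (psi k)) ->
  (forall k, (1 <= k <= n)%N -> m k != 0 -> has_mean P (fun w => psi k (Xs k w))) ->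
  has_mean P (fun w => psi (I w) (Xs (I w) w)) /\
  W * mean P (fun w => psi (I w) (Xs (I w) w)) =
  \sum_(1 <= k < n.+1) k%:R * m k * mean P (fun w => psi k (Xs k w)).
Proof.
move=> mpsi ipsi; have [In _ _] := I_index.
pose F k w := if (1 <= k <= n)%N then (I w == k)%:R * psi k (Xs k w) else 0.
have term k : has_mean P (F k).
  have [kn|/negbTE kn] := boolP (1 <= k <= n)%N; rewrite /F kn; last exact: has_mean_cst.
  by have [] := mean_random_index_term kn (mpsi k) (ipsi k kn).
have E w : psi (I w) (Xs (I w) w) = \sum_(1 <= k < n.+1) F k w.
  rewrite (bigD1_seq (I w)) ?iota_uniq//=; last by rewrite mem_index_iota ltnS In.
  rewrite /F In eqxx mul1r big1 ?addr0// => k kI.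
  by rewrite eq_sym (negbTE kI) mul0r; case: ifP.
have -> : (fun w => psi (I w) (Xs (I w) w)) = (fun w => \sum_(1 <= k < n.+1) F k w).
  exact/funext.
split; first exact: has_mean_sum.
rewrite mean_sum// mulr_sumr; apply: eq_big_nat => k; rewrite ltnS => kn.
rewrite /F kn.
by have [] := mean_random_index_term kn (mpsi k) (ipsi k kn).
Qed.

End RandomIndex.

Section Fluctuation.
Context d (T : measurableType d) (R : realType) (P : probability T R).

Lemma cosD2pi_nat (x : R) (k : nat) : cos (x + 2 * pi * k%:R) = cos x.
Proof.
elim: k => [|k IH]; first by rewrite mulr0 addr0.
have -> : x + 2 * pi * k.+1%:R = (x + 2 * pi * k%:R) + pi + pi by rewrite -addn1 natrD; ring.
by rewrite !cosDpi opprK.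
Qed.

Lemma cosD2pi_int (x y : R) : y \is a Num.int -> cos (x + 2 * pi * y) = cos x.
Proof.
move=> /intrP[[k|k] ->]; first exact: cosD2pi_nat.
rewrite NegzE -(cosD2pi_nat _ k.+1); congr cos.
by rewrite mulrNz mulrN subrK.
Qed.

Lemma mean_uniform01 (U : {RV P >-> R}) (h : R -> R) : uniform01 P U ->
  bounded_measurable h -> mean P (fun w => h (U w)) = mean (uniform_prob (@ltr01 R)) h.
Proof.
move=> uU bh; have [mh [M hM]] := bh.
have mU : measurable_fun setT (U : T -> measurableTypeR R).
  by move=> mT B mB; exact: (@measurable_funPT _ _ _ _ U mT B mB).
pose V : {mfun T >-> measurableTypeR R} := @mfun_Sub _ _ T (measurableTypeR R) U (mem_set mU).
have -> : mean P (fun w => h (U w)) = mean (distribution P V) h.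
  rewrite /mean /Rintegral integral_distribution//; first exact/measurable_EFinP.
  apply: has_mean_bounded; split; last by exists M => ?.
  exact: measurableT_comp.
rewrite /mean /Rintegral; congr fine.
by apply: eq_measure_integral => A mA _; exact: uU.
Qed.

End Fluctuation.

(** * The Stein functional of a weighted sum *)

Section SteinBound.
Context d (T : measurableType d) (R : realType) (P : probability T R).
Variables (X Xs : nat -> {RV P >-> R}) (K : R).
Hypothesis X_indep : mutually_independent P [set i | (0 < i)%N] X.
Hypothesis X_int : forall i, (0 < i)%N -> integer_valued (X i).
Hypothesis X_integrable : forall i, (0 < i)%N -> has_mean P (X i).
Hypothesis biased : forall i, (0 < i)%N -> size_bias_increment P (X i) (Xs i).
Notation m k := (mean P (X k)).
Hypothesis m_ge0 : forall i, (0 < i)%N -> 0 <= m i.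
Hypothesis m_le : forall i, (0 < i)%N -> i%:R * m i <= K.

Variable n : nat.
Hypothesis n_gt0 : (0 < n)%N.
Notation Tn := (weighted_sum X n).
Notation c k := (n%:R^-1 * k%:R : R).

Let n0 : 0 < n%:R :> R. Proof. by rewrite ltr0n. Qed.

Let c_ge0 k : 0 <= c k. Proof. by rewrite mulr_ge0// invr_ge0. Qed.

Let K_ge0 : 0 <= K.
Proof. by apply: le_trans (m_le (ltn0Sn 0)); rewrite mul1r m_ge0. Qed.

Lemma weighted_sumE w : Tn w = \sum_(1 <= k < n.+1) c k * X k w.
Proof. by rewrite /weighted_sum mulr_sumr; apply: eq_bigr => k _; rewrite mulrA. Qed.

Lemma measurable_weighted_sum : measurable_fun setT Tn.
Proof.
rewrite (_ : Tn = fun w => \sum_(1 <= k < n.+1) c k * X k w); last exact/funext/weighted_sumE.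
by apply: measurable_sum => k; exact: measurable_funM.
Qed.

Lemma weighted_sum_split k w : (1 <= k <= n)%N ->
  Tn w = \sum_(j <- [seq j <- index_iota 1 n.+1 | j != k]) c j * X j w + c k * X k w.
Proof.
move=> kn; rewrite weighted_sumE big_filter addrC.
by rewrite [LHS](bigD1_seq k) ?iota_uniq//= mem_index_iota ltnS.
Qed.

Variables (phi : R -> R) (a L : R).
Hypothesis phi_bound : forall x, `|phi x| <= a.
Hypothesis phi_lipschitz : forall x y, `|phi x - phi y| <= L * `|x - y|.

Let mphi : measurable_fun setT phi.
Proof. by apply: continuous_measurableT; exact: continuous_lipschitz phi_lipschitz. Qed.

Let L_ge0 : 0 <= L.
Proof.
have := phi_lipschitz 1 0; rewrite subr0 normr1 mulr1; exact: le_trans.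
Qed.

Let bphi d' (T' : measurableType d') (f : T' -> R) : measurable_fun setT f ->
  bounded_measurable (fun w => phi (f w)).
Proof. by move=> mf; split; [exact: (measurableT_comp mphi)|exists a]. Qed.

Let mean_bounded (f : T * T -> R) : measurable_fun setT f ->
  bounded_measurable (fun w' => mean P (fun w => phi (f (w', w)))).
Proof.
move=> mf; split; first exact: (measurable_mean2 P P (bphi mf)).
exists a => w'; apply: norm_mean_le_cst => //.
by apply: (measurableT_comp mphi); exact: measurable_slice2.
Qed.

(** Replacing one summand by its size-biased version, and then putting an
independent copy of the increment on top of the full sum: the summand is small
on average, so that the possible dependence between it and its increment is
harmless. *)
Lemma stein_term k : (1 <= k <= n)%N ->
  `|mean P (fun w => X k w * phi (Tn w)) -
    m k * mean P (fun w' => mean P (fun w => phi (Tn w' + c k * Xs k w)))| <=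
  2 * L * c k * m k ^+ 2.
Proof.
move=> kn; have k0 : (0 < k)%N by case/andP: kn.
pose S w := \sum_(j <- [seq j <- index_iota 1 n.+1 | j != k]) c j * X j w.
have mS : measurable_fun setT S by apply: measurable_sum => j; exact: measurable_funM.
have Sk : independent_pair P (X k) S.
  apply: independent_sum X_indep _ k0 _ _.
  - by rewrite filter_uniq// iota_uniq.
  - by rewrite mem_filter eqxx.
  - by apply/allP => j; rewrite mem_filter mem_index_iota => /and3P[_ j0 _].
have mX : measurable_fun setT (X k) by [].
have mXs : measurable_fun setT (Xs k) by [].
have mnorm := size_bias_mean_norm (X_integrable k0) (biased k0) (m_ge0 k0).
pose psi w' := mean P (fun w => phi (S w' + c k * (X k w + Xs k w))).
pose chi w' := mean P (fun w => phi (Tn w' + c k * Xs k w)).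
have mT := measurable_weighted_sum.
have fst_snd (f g : T -> R) : measurable_fun setT f -> measurable_fun setT g ->
    measurable_fun setT (fun p : T * T => f p.1 + c k * g p.2).
  move=> mf mg; apply: measurable_funD; first exact: measurableT_comp.
  by apply: measurable_funM => //; exact: measurableT_comp.
have mpsi : bounded_measurable psi.
  by apply: (mean_bounded (f := fun p => S p.1 + c k * (X k p.2 + Xs k p.2)));
    exact: (fst_snd S (fun w => X k w + Xs k w) mS (measurable_funD mX mXs)).
have mchi : bounded_measurable chi by apply: (mean_bounded (f := fun p => Tn p.1 + c k * Xs k p.2)); exact: fst_snd.
have E : mean P (fun w => X k w * phi (Tn w)) = m k * mean P psi.
  pose f (p : R * R) := p.1 * phi (p.2 + c k * p.1).
  have -> : mean P (fun w => X k w * phi (Tn w)) = mean P (fun w => f (X k w, S w)).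
    by apply: eq_mean => w; rewrite /f /= -weighted_sum_split.
  rewrite (mean_independent (g := fun x => a * `|x|)) //.
  - rewrite -meanZ; last exact: has_mean_bounded.
    apply: eq_mean => w'.
    rewrite /f /= (size_bias_mean (X_integrable k0) (biased k0) (phi := fun x => phi (S w' + c k * x)))//.
    apply: bphi; apply: measurable_funD => //; exact: measurable_funM.
  - apply: measurable_funM; first exact: measurable_fst.
    apply: (measurableT_comp mphi); apply: measurable_funD; first exact: measurable_snd.
    by apply: measurable_funM => //; exact: measurable_fst.
  - by move=> x y; rewrite /f /= normrM mulrC ler_wpM2r.
  - by apply: has_meanZ; apply: has_mean_norm; exact: X_integrable.
have iX := X_integrable k0.
have diff w' : `|psi w' - chi w'| <= L * c k * (m k + `|X k w'|).
  rewrite /psi /chi -meanB; last 2 first.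
  - apply: has_mean_bounded; apply: bphi; apply: measurable_funD => //.
    by apply: measurable_funM => //; exact: measurable_funD.
  - apply: has_mean_bounded; apply: bphi; apply: measurable_funD => //.
    exact: measurable_funM.
  rewrite -[X in _ * (X + _)]mnorm -{1}(mean_cst P (`|X k w'|)) -meanD; last 2 first.
  - exact: has_mean_norm.
  - exact: has_mean_cst.
  rewrite -meanZ; last by apply: has_meanD; [exact: has_mean_norm|exact: has_mean_cst].
  apply: norm_mean_le => [||w].
  - apply: measurable_funB; apply: (measurableT_comp mphi); apply: measurable_funD => //;
      apply: measurable_funM => //; exact: measurable_funD.
  - by apply: has_meanZ; apply: has_meanD; [exact: has_mean_norm|exact: has_mean_cst].
  - apply: le_trans (phi_lipschitz _ _) _; rewrite -mulrA ler_wpM2l//.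
    rewrite (weighted_sum_split _ kn) -/(S w').
    have -> : S w' + c k * (X k w + Xs k w) - (S w' + c k * X k w' + c k * Xs k w) =
      c k * (X k w - X k w') by ring.
    by rewrite normrM ger0_norm// ler_wpM2l// ler_normB.
rewrite E -mulrBr -meanB; [|exact: has_mean_bounded..].
rewrite normrM ger0_norm ?m_ge0//.
have -> : 2 * L * c k * m k ^+ 2 = m k * (L * c k * (m k + m k)) by ring.
rewrite ler_wpM2l ?m_ge0//.
rewrite -[X in _ * (_ + X)]mnorm -{1}(mean_cst P (m k)) -meanD; last 2 first.
- exact: has_mean_cst.
- exact: has_mean_norm.
rewrite -meanZ; last by apply: has_meanD; [exact: has_mean_cst|exact: has_mean_norm].
apply: norm_mean_le => [||w'].
- by apply: measurable_funB; [case: mpsi|case: mchi].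
- by apply: has_meanZ; apply: has_meanD; [exact: has_mean_cst|exact: has_mean_norm].
- exact: diff.
Qed.

Lemma has_mean_weighted : has_mean P (fun w => Tn w * phi (Tn w)) /\
  mean P (fun w => Tn w * phi (Tn w)) =
  \sum_(1 <= k < n.+1) c k * mean P (fun w => X k w * phi (Tn w)).
Proof.
pose F k w := if (0 < k)%N then c k * (X k w * phi (Tn w)) else 0.
have mT := measurable_weighted_sum.
have iX k : (0 < k)%N -> has_mean P (fun w => X k w * phi (Tn w)).
  move=> k0; apply: (has_mean_le (g := fun w => a * X k w)) => [||w].
  - by apply: measurable_funM => //; exact: (measurableT_comp mphi).
  - by apply: has_meanZ; exact: X_integrable.
  - by rewrite !normrM mulrC ler_wpM2r// (le_trans (phi_bound _))// ler_norm.
have iF k : has_mean P (F k).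
  rewrite /F; case: (ltnP 0 k) => k0; last exact: has_mean_cst.
  by apply: has_meanZ; exact: iX.
have E : (fun w => Tn w * phi (Tn w)) = (fun w => \sum_(1 <= k < n.+1) F k w).
  apply/funext => w; rewrite [X in X * _]weighted_sumE mulr_suml; apply: eq_big_nat => k /andP[k0 _].
  by rewrite /F k0 mulrA.
rewrite E; split; first exact: has_mean_sum.
rewrite mean_sum//; apply: eq_big_nat => k /andP[k0 _].
by rewrite /F k0 meanZ//; exact: iX.
Qed.

Lemma mean_weighted_sum : mean P Tn = total_weight P X n / n%:R.
Proof.
pose F k w := if (0 < k)%N then c k * X k w else 0.
have iF k : has_mean P (F k).
  rewrite /F; case: (ltnP 0 k) => k0; last exact: has_mean_cst.
  by apply: has_meanZ; exact: X_integrable.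
rewrite (eq_mean P (g := fun w => \sum_(1 <= k < n.+1) F k w)); last first.
  by move=> w; rewrite weighted_sumE; apply: eq_big_nat => k /andP[k0 _]; rewrite /F k0.
rewrite mean_sum// mulrC mulr_sumr; apply: eq_big_nat => k /andP[k0 _].
by rewrite /F k0 meanZ ?meanE ?mulrA//; exact: X_integrable.
Qed.

Variables (I : {RV P >-> nat}) (U : {RV P >-> R}) (theta : R).
Hypothesis I_index : random_index P X Xs n I.
Hypothesis U_unif : uniform01 P U.
Notation W := (total_weight P X n).
Notation V w := ((I w)%:R * Xs (I w) w / n%:R).
Notation delta := (mean P (fun w => `|U w - V w|)).
Notation unif := (uniform_prob (@ltr01 R)).
Hypothesis gap_integrable : W != 0 -> has_mean P (fun w => U w - V w).

Let gap_norm_integrable : W != 0 -> has_mean P (fun w => `|U w - V w|).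
Proof. by move=> W0; exact/has_mean_norm/gap_integrable. Qed.

Let W_ge0 : 0 <= W.
Proof.
rewrite total_weightE big_nat_cond; apply: sumr_ge0 => k /andP[/andP[k0 _] _].
by rewrite mulr_ge0// m_ge0.
Qed.

Let W_le : W <= K * n%:R.
Proof.
rewrite total_weightE big_nat_cond; apply: (@le_trans _ _ (\sum_(1 <= k < n.+1) K)).
  rewrite [leRHS]big_nat_cond; apply: ler_sum => k /andP[/andP[k0 _] _]; exact: m_le.
by rewrite sumr_const_nat subn1 /= mulr_natr.
Qed.

(** The increment [V] lives on the lattice of multiples of [1 / n], which no
uniform variable can follow closer than order [1 / n]: compare the means of
[cos (2 pi n x)] under both laws. *)
Lemma lattice_gap : W != 0 -> n%:R^-1 <= 2 * pi * delta.
Proof.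
move=> W0; have ig := gap_norm_integrable W0.
pose psi (k : nat) (x : R) := cos (2 * pi * (k%:R * x)).
have mpsi k : measurable_fun setT (psi k).
  by apply: (measurableT_comp (@measurable_cos R)); do 2 apply: measurable_funM => //.
have bpsi k : bounded_measurable (psi k).
  by split => //; exists 1 => x; exact: norm_cos_le1.
have ipsi k : has_mean P (fun w => psi k (Xs k w)).
  apply: has_mean_bounded; split; first exact: measurableT_comp.
  by exists 1 => w; exact: norm_cos_le1.
have [iV EV] := mean_random_index I_index W0 mpsi (fun k _ _ => ipsi k).
have V1 : mean P (fun w => psi (I w) (Xs (I w) w)) = 1.
  apply: (mulfI W0); rewrite EV mulr1 total_weightE; apply: eq_big_nat => k /andP[k0 _].
  have := size_bias_mean (X_integrable k0) (biased k0) (bpsi k).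
  have intX w : k%:R * X k w \is a Num.int by rewrite rpredM ?rpred_nat ?X_int.
  rewrite (eq_mean P (g := X k)); last first.
    move=> w; rewrite /psi -[2 * pi * _]add0r cosD2pi_int// cos0 mulr1; done.
  have -> : mean P (fun w => psi k (X k w + Xs k w)) = mean P (fun w => psi k (Xs k w)).
    apply: eq_mean => w; rewrite /psi.
    have -> : 2 * pi * (k%:R * (X k w + Xs k w)) =
      2 * pi * (k%:R * Xs k w) + 2 * pi * (k%:R * X k w) by ring.
    by rewrite cosD2pi_int.
  by rewrite -mulrA => <-.
have U0 : mean P (fun w => cos (2 * pi * (n%:R * U w))) = 0.
  have bh : bounded_measurable (fun x : R => cos (2 * pi * (n%:R * x))).
    split; last by exists 1 => x; exact: norm_cos_le1.
    by apply: (measurableT_comp (@measurable_cos R)); do 2 apply: measurable_funM => //.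
  rewrite (mean_uniform01 U_unif bh).
  rewrite (eq_mean unif (g := fun x => cos ((2 * pi * n%:R) * x))); last first.
    by move=> x; rewrite mulrA.
  have pn : 2 * pi * n%:R != 0 :> R by rewrite !mulf_neq0// ?gt_eqF ?pi_gt0.
  apply: (mulfI pn); rewrite mean_cos_scale mulr0.
  have := cos2Dsin2 (2 * pi * n%:R : R).
  have -> : cos (2 * pi * n%:R) = 1 :> R by rewrite -[2 * pi * _]add0r cosD2pi_nat cos0.
  rewrite expr1n => /eqP; rewrite eq_sym addrC -subr_eq subrr eq_sym sqrf_eq0.
  by move/eqP.
have iU : has_mean P (fun w => cos (2 * pi * (n%:R * U w))).
  apply: has_mean_bounded; split; last by exists 1 => w; exact: norm_cos_le1.
  by apply: (measurableT_comp (@measurable_cos R)); do 2 apply: measurable_funM => //.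
have : `|mean P (fun w => cos (2 * pi * (n%:R * U w))) -
         mean P (fun w => psi (I w) (Xs (I w) w))| <= 2 * pi * n%:R * delta.
  rewrite -meanB// -meanZ//; apply: norm_mean_le => [||w].
  - by apply: (@has_mean_measurable _ _ _ P); exact: has_meanB.
  - exact: has_meanZ.
  - apply: le_trans (cos_lipschitz _ _) _; rewrite -mulrBr.
    rewrite normrM (ger0_norm (x := 2 * pi)); last by rewrite mulr_ge0// pi_ge0.
    rewrite -mulrA ler_wpM2l ?mulr_ge0 ?pi_ge0//.
    have -> : n%:R * U w - (I w)%:R * Xs (I w) w = n%:R * (U w - V w).
      by field; rewrite gt_eqF.
    by rewrite normrM ger0_norm.
rewrite U0 V1 sub0r normrN normr1 => H.
rewrite -(ler_pM2l n0) mulfV ?gt_eqF//; apply: le_trans H _.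
by rewrite le_eqVlt; apply/orP; left; apply/eqP; ring.
Qed.

Let mean_eq0 : W = 0 -> forall k, (1 <= k <= n)%N -> m k = 0.
Proof.
move=> W0 k /andP[k0 kn]; apply/eqP; rewrite eq_le m_ge0// andbT.
have : k%:R * m k <= W.
  rewrite total_weightE (bigD1_seq k) ?iota_uniq//= ?mem_index_iota ?ltnS ?k0//.
  rewrite lerDl big_seq_cond; apply: sumr_ge0 => j /andP[].
  by rewrite mem_index_iota => /andP[j0 _] _; rewrite mulr_ge0// m_ge0.
by rewrite W0 pmulr_rle0// ltr0n.
Qed.

(** With [phi] as test function, [E (Tn * phi Tn)] is within [O(1 / n)] of
[W / n * E (phi (Tn + V))], where [V] is independent of [Tn]: the errors of the
single summands add up to a multiple of the sum of [(k * m k / n) ^+ 2]. The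
lattice estimate absorbs [1 / n] into [delta], and comparing [V] with [U], [W / n]
with [theta] gives the rest. *)
Lemma stein_bound :
  `|mean P (fun w => Tn w * phi (Tn w)) -
    theta * mean P (fun w => mean unif (fun v => phi (Tn w + v)))| <=
  (a + (4 * pi * K ^+ 2 + K) * L) * (`|theta - W / n%:R| + delta).
Proof.
have mT := measurable_weighted_sum; have [iTp ETp] := has_mean_weighted.
have a0 : 0 <= a by exact: le_trans (phi_bound 0).
have delta0 : 0 <= delta by exact: mean_ge0.
pose chi k w' := mean P (fun w => phi (Tn w' + c k * Xs k w)).
pose u w' := mean unif (fun v => phi (Tn w' + v)).
have mchi k : bounded_measurable (chi k).
  apply: (mean_bounded (f := fun p => Tn p.1 + c k * Xs k p.2)).
  apply: measurable_funD; first exact: measurableT_comp.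
  by apply: measurable_funM => //; exact: measurableT_comp.
have mu : bounded_measurable u.
  have bf : bounded_measurable (fun p : T * measurableTypeR R => phi (Tn p.1 + p.2)).
    apply: bphi; apply: measurable_funD; first exact: measurableT_comp.
    exact: measurable_snd.
  split; first exact: (measurable_mean2 P unif bf).
  exists a => w; apply: norm_mean_le_cst => // .
  by apply: (measurableT_comp mphi); apply: measurable_funD.
pose Q w' := \sum_(1 <= k < n.+1) c k * m k * chi k w'.
have iQ : has_mean P Q.
  by apply: has_mean_sum => k; apply: has_meanZ; exact: has_mean_bounded.
have EQ : mean P Q = \sum_(1 <= k < n.+1) c k * m k * mean P (chi k).
  rewrite mean_sum => [|k]; last by apply: has_meanZ; exact: has_mean_bounded.
  by apply: eq_bigr => k _; rewrite meanZ//; exact: has_mean_bounded.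
have step1 : `|mean P (fun w => Tn w * phi (Tn w)) - mean P Q| <=
    4 * pi * K ^+ 2 * L * delta.
  rewrite ETp EQ -sumrB.
  apply: (@le_trans _ _ (\sum_(1 <= k < n.+1) 2 * L * (c k * m k) ^+ 2)).
    apply: le_trans (ler_norm_sum _ _ _) _.
    rewrite big_nat_cond [leRHS]big_nat_cond; apply: ler_sum => k /andP[/andP[k0 kn] _].
    rewrite -mulrA -mulrBr normrM (ger0_norm (c_ge0 k)).
    have kn' : (1 <= k <= n)%N by rewrite k0 -ltnS.
    have := ler_wpM2l (c_ge0 k) (stein_term kn') => /le_trans; apply.
    by rewrite le_eqVlt; apply/orP; left; apply/eqP; ring.
  have [W0|W0] := eqVneq W 0.
    rewrite big_nat_cond big1 ?mulr_ge0 ?pi_ge0 ?sqr_ge0//.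
    move=> k /andP[/andP[k0 kn] _].
    have kn' : (1 <= k <= n)%N by rewrite k0 -ltnS.
    by rewrite (mean_eq0 W0 kn') mulr0 expr0n mulr0.
  apply: (@le_trans _ _ (\sum_(1 <= k < n.+1) 2 * L * (K / n%:R) ^+ 2)).
    rewrite big_nat_cond [leRHS]big_nat_cond; apply: ler_sum => k /andP[/andP[k0 kn] _].
    rewrite ler_wpM2l ?mulr_ge0// lerXn2r ?nnegrE ?mulr_ge0 ?invr_ge0 ?m_ge0 ?(ltW n0)//.
    by rewrite -mulrA mulrC ler_pM2r ?invr_gt0// m_le.
  rewrite sumr_const_nat subn1 -pred_Sn -[_ *+ n]mulr_natr.
  have -> : 2 * L * (K / n%:R) ^+ 2 * n%:R = 2 * L * K ^+ 2 * n%:R^-1.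
    by field; rewrite gt_eqF.
  have -> : 4 * pi * K ^+ 2 * L * delta = 2 * L * K ^+ 2 * (2 * pi * delta) by ring.
  by apply: ler_wpM2l (lattice_gap W0); rewrite !mulr_ge0// sqr_ge0.
have step2 w' : `|Q w' - theta * u w'| <= K * L * delta + a * `|theta - W / n%:R|.
  have u_le : `|u w'| <= a.
    apply: norm_mean_le_cst => //.
    by apply: (measurableT_comp mphi); apply: measurable_funD.
  have [W0|W0] := eqVneq W 0.
    have -> : Q w' = 0.
      rewrite /Q big_nat_cond big1// => k /andP[/andP[k0 kn] _].
      have kn' : (1 <= k <= n)%N by rewrite k0 -ltnS.
      by rewrite (mean_eq0 W0 kn') mulr0 mul0r.
    rewrite sub0r normrN W0 mul0r subr0 normrM mulrC.
    by rewrite ler_wpDl ?mulr_ge0// ler_wpM2r.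
  have bpsi k : bounded_measurable (fun x : R => phi (Tn w' + k%:R * x / n%:R)).
    by apply: bphi; apply: measurable_funD => //; apply: measurable_funM.
  have ipsi k : has_mean P (fun w => phi (Tn w' + k%:R * Xs k w / n%:R)).
    apply: has_mean_bounded; apply: bphi; apply: measurable_funD => //.
    by apply: measurable_funM => //; exact: measurable_funM.
  have [iV EV] := mean_random_index (psi := fun k (x : R) => phi (Tn w' + k%:R * x / n%:R))
    I_index W0 (fun k => proj1 (bpsi k)) (fun k _ _ => ipsi k).
  have QE : Q w' = W / n%:R * mean P (fun w => phi (Tn w' + V w)).
    rewrite mulrAC EV mulr_suml; apply: eq_bigr => k _.
    have -> : chi k w' = mean P (fun w => phi (Tn w' + k%:R * Xs k w / n%:R)).
      by apply: eq_mean => w; congr (phi (_ + _)); ring.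
    by ring.
  have uE : u w' = mean P (fun w => phi (Tn w' + U w)).
    rewrite (mean_uniform01 U_unif (h := fun v => phi (Tn w' + v)))//.
    by apply: bphi; apply: measurable_funD.
  have iU : has_mean P (fun w => phi (Tn w' + U w)).
    by apply: has_mean_bounded; apply: bphi; apply: measurable_funD.
  have close : `|mean P (fun w => phi (Tn w' + V w)) - u w'| <= L * delta.
    rewrite uE -meanB// -meanZ; last exact: gap_norm_integrable.
    apply: norm_mean_le => [||w].
    - by apply: (@has_mean_measurable _ _ _ P); exact: has_meanB.
    - by apply: has_meanZ; exact: gap_norm_integrable.
    - apply: le_trans (phi_lipschitz _ _) _; rewrite ler_wpM2l// distrC.
      by have -> : Tn w' + U w - (Tn w' + V w) = U w - V w by ring.
  have -> : Q w' - theta * u w' =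
      W / n%:R * (mean P (fun w => phi (Tn w' + V w)) - u w') + u w' * (W / n%:R - theta).
    by rewrite QE; ring.
  apply: le_trans (ler_normD _ _) _; rewrite lerD//.
    rewrite normrM -[K * L * _]mulrA (ger0_norm (x := W / _)) ?divr_ge0// ler_pM ?divr_ge0//.
    by rewrite ler_pdivrMr.
  by rewrite normrM distrC ler_wpM2r.
have step3 : `|mean P Q - theta * mean P u| <= K * L * delta + a * `|theta - W / n%:R|.
  rewrite -meanZ -?meanB; [|exact: iQ|apply: has_meanZ|]; try exact: has_mean_bounded.
  apply: norm_mean_le_cst => //; apply: (@has_mean_measurable _ _ _ P).
  by apply: has_meanB => //; apply: has_meanZ; exact: has_mean_bounded.
rewrite -(subrK (mean P Q) (mean P _)) -addrA.
apply: le_trans (ler_normD _ _) _; apply: le_trans (lerD step1 step3) _.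
have KL : 0 <= K * L * `|theta - W / n%:R| by rewrite !mulr_ge0.
have KL2 : 0 <= 4 * pi * K ^+ 2 * L * `|theta - W / n%:R|.
  by rewrite !mulr_ge0// pi_ge0.
have ad : 0 <= a * delta by rewrite mulr_ge0.
by lra.
Qed.

End SteinBound.

(** * Comparison of means along the iterates *)

Section Comparison.
Context d (T : measurableType d) (R : realType) (P : probability T R).
Variables (X Xs : nat -> {RV P >-> R}) (K theta : R).
Hypothesis theta_gt0 : 0 < theta.
Hypothesis X_indep : mutually_independent P [set i | (0 < i)%N] X.
Hypothesis X_int : forall i, (0 < i)%N -> integer_valued (X i).
Hypothesis X_integrable : forall i, (0 < i)%N -> has_mean P (X i).
Hypothesis biased : forall i, (0 < i)%N -> size_bias_increment P (X i) (Xs i).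
Hypothesis m_ge0 : forall i, (0 < i)%N -> 0 <= mean P (X i).
Hypothesis m_le : forall i, (0 < i)%N -> i%:R * mean P (X i) <= K.
Variables (n : nat) (I : {RV P >-> nat}) (U Z : {RV P >-> R}).
Hypothesis n_gt0 : (0 < n)%N.
Hypothesis I_index : random_index P X Xs n I.
Hypothesis U_unif : uniform01 P U.
Notation W := (total_weight P X n).
Hypothesis gap_integrable : W != 0 ->
  has_mean P (fun w => U w - (I w)%:R * Xs (I w) w / n%:R).
Hypothesis dickmanZ : generalized_dickman theta P Z.
Notation Tn := (weighted_sum X n).
Notation unif := (uniform_prob (@ltr01 R)).
Notation rho := (pull_mean theta).
Notation discrepancy := (`|theta - W / n%:R| +
  mean P (fun w => `|U w - (I w)%:R * Xs (I w) w / n%:R|)).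

Variables (h dh : R -> R).
Hypothesis h_smooth : smooth 1 1 h dh.
Hypothesis h_bound : forall x, `|h x| <= 1.

Let g j := iter j (step theta) h.
Let dg j := iter j (dstep theta) dh.

Let g_smooth j : smooth (rho ^+ j) (rho ^+ j) (g j) (dg j).
Proof. by elim: j => [//|j IH]; rewrite exprSr; exact: smooth_step. Qed.

Let g_bound j x : `|g j x| <= 1.
Proof.
elim: j x => [//|j IH] x; apply: avg_bounded => //.
exact: smooth_continuous (g_smooth j).
Qed.

Let mg j d' (T' : measurableType d') (f : T' -> R) : measurable_fun setT f ->
  bounded_measurable (fun w => g j (f w)).
Proof.
move=> mf; split; last by exists 1.
apply: (measurableT_comp (f := g j)) => //.
apply: continuous_measurableT; exact: smooth_continuous (g_smooth j).
Qed.

Let mT : measurable_fun setT Tn. Proof. exact: measurable_weighted_sum. Qed.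

Let C := 1 + (4 * pi * K ^+ 2 + K) * 2.

(** The Stein bound for the derivative of [avg (g j)], whose size and Lipschitz
constant are of order [rho ^+ j]. *)
Lemma one_step j : theta * `|mean P (fun w => g j (Tn w)) - mean P (fun w => g j.+1 (Tn w))| <=
  rho ^+ j * (C * discrepancy).
Proof.
have r0 : 0 <= rho ^+ j by rewrite exprn_ge0// pull_mean_ge0.
have r1 := ltW (pull_mean_lt1 theta_gt0).
have sa := smooth_avg theta (g_smooth j).
pose phi := davg theta (dg j).
have phi_bound x : `|phi x| <= rho ^+ j.
  by case: sa => /(_ x) H _; apply: le_trans H _; rewrite ler_piMr.
have phi_lip x y : `|phi x - phi y| <= rho ^+ j * 2 * `|x - y|.
  apply: le_trans (smooth_derivative_lipschitz sa x y) _.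
  by rewrite ler_wpM2r// mulrC ler_wpM2r// ler_piMr.
have bound := stein_bound X_indep X_int X_integrable biased m_ge0 m_le n_gt0
  phi_bound phi_lip theta I_index U_unif gap_integrable.
have [iT _] := has_mean_weighted X_integrable n phi_bound phi_lip.
have mphi : measurable_fun setT phi.
  by apply: continuous_measurableT; exact: smooth_continuous_derivative sa.
pose u w := mean unif (fun v => phi (Tn w + v)).
have bu : bounded_measurable u.
  have bf : bounded_measurable (fun p : T * measurableTypeR R => phi (Tn p.1 + p.2)).
    split; last by exists (rho ^+ j) => p.
    apply: (measurableT_comp mphi); apply: measurable_funD; first exact: measurableT_comp.
    exact: measurable_snd.
  split; first exact: (measurable_mean2 P unif bf).
  exists (rho ^+ j) => w; apply: norm_mean_le_cst => //.
  by apply: (measurableT_comp mphi); apply: measurable_funD.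
have i1 := has_mean_bounded P (mg j mT).
have i2 := has_mean_bounded P (mg j.+1 mT).
rewrite -[X in X * _ <= _](ger0_norm (ltW theta_gt0)) -normrM -meanB// -meanZ; last exact: has_meanB.
rewrite (eq_mean P (g := fun w => Tn w * phi (Tn w) - theta * u w)); last first.
  by move=> w; rewrite -(step_stein theta_gt0 _ (g_smooth j)).
rewrite meanB// ?meanZ; [|exact: has_mean_bounded|by apply: has_meanZ; exact: has_mean_bounded].
apply: le_trans bound _.
by rewrite le_eqVlt; apply/orP; left; apply/eqP; rewrite /C; ring.
Qed.

Lemma telescope j : theta * `|mean P (fun w => h (Tn w)) - mean P (fun w => g j (Tn w))| <=
  (1 - rho)^-1 * (C * discrepancy).
Proof.
have K0 : 0 <= K by apply: le_trans (m_le (ltn0Sn 0)); rewrite mul1r m_ge0.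
have CD0 : 0 <= C * discrepancy.
  apply: mulr_ge0.
    by rewrite /C addr_ge0// mulr_ge0// addr_ge0// mulr_ge0 ?sqr_ge0// mulr_ge0// pi_ge0.
  by rewrite addr_ge0// mean_ge0.
have r0 : 0 < 1 - rho by rewrite subr_gt0 pull_mean_lt1.
have rj i : 0 <= rho ^+ i by rewrite exprn_ge0// pull_mean_ge0.
suff H : (1 - rho) * (theta * `|mean P (fun w => h (Tn w)) - mean P (fun w => g j (Tn w))|) <=
    (1 - rho ^+ j) * (C * discrepancy).
  rewrite ler_pdivlMl//; apply: le_trans H _.
  by rewrite ler_piMl// lerBlDr lerDl.
elim: j => [|j IH]; first by rewrite subrr normr0 !mulr0 expr0 subrr mul0r.
have os := ler_wpM2l (ltW r0) (one_step j).
have tri : theta * `|mean P (fun w => h (Tn w)) - mean P (fun w => g j.+1 (Tn w))| <=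
    theta * `|mean P (fun w => h (Tn w)) - mean P (fun w => g j (Tn w))| +
    theta * `|mean P (fun w => g j (Tn w)) - mean P (fun w => g j.+1 (Tn w))|.
  by rewrite -mulrDr ler_wpM2l ?(ltW theta_gt0)// ler_distD.
apply: le_trans (ler_wpM2l (ltW r0) tri) _; rewrite mulrDr.
apply: le_trans (lerD IH os) _.
by rewrite le_eqVlt; apply/orP; left; apply/eqP; rewrite exprS; ring.
Qed.

(** The Lipschitz constants of the iterates tend to 0, so [g j] ends up taking
the same values at [Tn] and at [Z], and [g j] and [h] have the same mean under
the law of [Z]. *)
Lemma iterates_forget :
  (fun j => mean P (fun w => g j (Tn w)) - mean P (fun w => h (Z w))) @ \oo --> (0 : R).
Proof.
have EZ j : mean P (fun w => h (Z w)) = mean P (fun w => g j (Z w)).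
  elim: j => [//|j ->]; apply: (dickman_step theta_gt0 _ dickmanZ) => //.
  exact: (mg j (@measurable_id _ R setT)).
have mZ : measurable_fun setT Z by [].
have -> : (fun j => mean P (fun w => g j (Tn w)) - mean P (fun w => h (Z w))) =
   (fun j => mean P (fun w => g j (Tn w) - g j (Z w))).
  apply/funext => j; rewrite (EZ j) -meanB//; exact: has_mean_bounded (mg j _).
rewrite -[X in _ --> X](mean_cst P 0).
apply: (mean_dominated_cvg (c := 2)) => //.
- move=> j; apply: (@has_mean_measurable _ _ _ P).
  by apply: has_meanB; apply: has_mean_bounded; exact: mg.
- move=> w; apply/cvgr0Pnorm_le => e e0.
  have rn : `|rho| < 1 by rewrite ger0_norm ?pull_mean_ge0// pull_mean_lt1.
  have lim : (fun j => rho ^+ j * `|Tn w - Z w|) @ \oo --> (0 : R).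
    by rewrite -(mul0r `|Tn w - Z w|); apply: cvgMl; exact: cvg_expr.
  have /cvgr0Pnorm_le /(_ _ e0) := lim.
  apply: filterS => j; apply: le_trans.
  apply: le_trans (smooth_lipschitz (g_smooth j) _ _) _.
  exact: ler_norm.
- move=> j w; apply: le_trans (ler_normB _ _) _.
  by rewrite -[2]/(1 + 1) lerD.
Qed.

(** The costs of the successive steps from [h] to its iterates form a geometric
series, and the iterates have asymptotically the same mean at [Tn] as [h] has at
[Z]. *)
Lemma mean_comparison :
  `|mean P (fun w => h (Tn w)) - mean P (fun w => h (Z w))| <=
  (theta^-1 * (1 - rho)^-1 * C) * discrepancy.
Proof.
have th := telescope; have lim := iterates_forget.
set A := mean P (fun w => h (Tn w)); set B := mean P (fun w => h (Z w)).
apply/ler_addgt0Pr => e e0.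
have /cvgr0Pnorm_le /(_ _ e0) [j _ /(_ j (leqnn j)) /= Hj] := lim.
have Tj := th j.
have -> : A - B = (A - mean P (fun w => g j (Tn w))) + (mean P (fun w => g j (Tn w)) - B) by ring.
apply: le_trans (ler_normD _ _) _; apply: lerD => //.
by rewrite -[leRHS]mulrA -[leRHS]mulrA ler_pdivlMl.
Qed.

End Comparison.

(** * Moments of size-biased increments *)

Section AlmostEverywhere.
Context d (T : measurableType d) (R : realType) (P : probability T R).
Implicit Types f g : T -> R.

Lemma has_mean_le_ae f g : measurable_fun setT f -> has_mean P g ->
  {ae P, forall x, `|f x| <= g x} -> has_mean P f.
Proof.
move=> mf ig fg; apply/integrableP; split; first exact/measurable_EFinP.
have /integrableP[mg] := has_mean_norm ig.
apply: le_lt_trans; apply: ae_ge0_le_integral => //.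
- by apply: measurableT_comp => //; exact/measurable_EFinP.
- exact: measurableT_comp.
- by apply: filterS fg => x /= H _; rewrite lee_fin normr_id (le_trans H)// ler_norm.
Qed.

Lemma le_mean_ae f g : has_mean P f -> has_mean P g ->
  {ae P, forall x, f x <= g x} -> mean P f <= mean P g.
Proof.
move=> if_ ig fg; rewrite -subr_ge0 -meanB//.
have id_ := has_meanB ig if_.
have -> : mean P (fun x => g x - f x) = mean P (fun x => `|g x - f x|).
  apply: ae_eq_mean; first exact: has_mean_measurable id_.
    exact: has_mean_measurable (has_mean_norm id_).
  by apply: filterS fg => x H; rewrite ger0_norm// subr_ge0.
exact: mean_ge0.
Qed.

Lemma mean_eq0_ae f : has_mean P f -> (forall x, 0 <= f x) -> mean P f = 0 ->
  {ae P, forall x, f x = 0}.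
Proof.
move=> if_ f0 m0.
have mf : measurable_fun setT (EFin \o f) by case/integrableP : if_.
have : (\int[P]_(x in setT) `|(EFin \o f) x| = 0)%E.
  have -> : (\int[P]_(x in setT) `|(EFin \o f) x| = \int[P]_(x in setT) (f x)%:E)%E.
    by apply: eq_integral => x _; rewrite /= ger0_norm.
  by rewrite -(fineK (integrable_fin_num measurableT if_)) -/(Rintegral P setT f) -/(mean P f) m0.
move=> /(ae_eq_integral_abs P measurableT mf).
by apply: filterS => x /(_ I) /= [].
Qed.

Lemma has_mean_truncation f c : measurable_fun setT f -> (forall x, 0 <= f x) ->
  (forall N : nat, mean P (fun x => Num.min (f x) N%:R) <= c) ->
  has_mean P f /\ mean P f <= c.
Proof.
move=> mf f0 fc.
have mmin (N : nat) : bounded_measurable (fun x => Num.min (f x) N%:R).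
  split; first exact: measurable_minr.
  exists N%:R => x; rewrite ger0_norm; first by rewrite ge_min lexx orbT.
  by rewrite le_min f0 ler0n.
pose F (N : nat) x := (Num.min (f x) N%:R)%:E.
have lim : (\int[P]_x (f x)%:E <= c%:E)%E.
  have -> : (\int[P]_x (f x)%:E = \int[P]_x (limn (F^~ x)))%E.
    apply: eq_integral => x _; apply/esym/cvg_lim => //.
    apply: cvg_near_cst; near=> N.
    rewrite /F; congr EFin; apply/min_idPl.
    by near: N; exact: nbhs_infty_ger.
  rewrite monotone_convergence//.
  - apply: lime_le.
      apply: ereal_nondecreasing_is_cvgn => N M NM; apply: ge0_le_integral => //.
      + by move=> x _; rewrite lee_fin le_min f0 ler0n.
      + by apply/measurable_EFinP; case: (mmin N).
      + by apply/measurable_EFinP; case: (mmin M).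
      + move=> x _; rewrite lee_fin le_min ge_min lexx/= ge_min.
        by rewrite ler_nat NM orbT.
    apply: nearW => N.
    have := fc N; rewrite -lee_fin (EFin_mean (has_mean_bounded P (mmin N))).
    by rewrite unlock.
  - by move=> N; apply/measurable_EFinP; case: (mmin N).
  - by move=> N x _; rewrite lee_fin le_min f0 ler0n.
  - move=> x _ N M NM; rewrite lee_fin le_min ge_min lexx/= ge_min.
    by rewrite ler_nat NM orbT.
have if_ : has_mean P f.
  apply/integrableP; split; first exact/measurable_EFinP.
  have -> : (\int[P]_x `|(EFin \o f) x| = \int[P]_x (f x)%:E)%E.
    by apply: eq_integral => x _; rewrite /= ger0_norm.
  by apply: le_lt_trans lim _; rewrite ltry.
split => //; rewrite -lee_fin (EFin_mean if_) unlock; exact: lim.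
Unshelve. all: by end_near. Qed.

End AlmostEverywhere.

Section SizeBiasMoments.
Context d (T : measurableType d) (R : realType) (P : probability T R).
Variables X Xs : {RV P >-> R}.
Hypothesis X_integrable : has_mean P X.
Hypothesis biased : size_bias_increment P X Xs.
Notation m := (mean P X).
Hypothesis m_ge0 : 0 <= m.

Lemma size_bias_ae_ge0 : {ae P, forall w, 0 <= X w}.
Proof.
have E := size_bias_mean_norm X_integrable biased m_ge0.
have i1 : has_mean P (fun w => `|X w| - X w).
  by apply: has_meanB => //; exact: has_mean_norm.
have : mean P (fun w => `|X w| - X w) = 0.
  by rewrite meanB//; [rewrite E subrr|exact: has_mean_norm].
move=> /(mean_eq0_ae i1) H; apply: filterS (H _) => [w /eqP|w].
  by rewrite subr_eq0 => /eqP <-.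
by rewrite subr_ge0 ler_norm.
Qed.

(** The size-bias identity, applied to truncations of [x -> `|x - 1|] and
extended by monotone convergence, controls [X + Xs - 1]; subtracting [X] costs
its mean. *)
Lemma size_bias_increment_moment :
  has_mean P (fun w => X w * `|X w - 1|) -> m != 0 ->
  has_mean P (fun w => `|Xs w - 1|) /\
  m * mean P (fun w => `|Xs w - 1|) <= mean P (fun w => X w * `|X w - 1|) + m ^+ 2.
Proof.
move=> iq m0.
have mp : 0 < m by rewrite lt_neqAle eq_sym m0.
set q := mean P (fun w => X w * `|X w - 1|).
have mX1 : measurable_fun setT (fun w => `|X w + Xs w - 1|).
  apply: measurableT_comp => //; apply: measurable_funB => //; exact: measurable_funD.
have tr (N : nat) : mean P (fun w => Num.min `|X w + Xs w - 1| N%:R) <= q / m.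
  have bphi : bounded_measurable (fun x : R => Num.min `|x - 1| N%:R).
    split; last first.
      exists N%:R => x; rewrite ger0_norm; first by rewrite ge_min lexx orbT.
      by rewrite le_min normr_ge0 ler0n.
    apply: measurable_minr => //; apply: measurableT_comp => //.
    exact: measurable_funB.
  rewrite ler_pdivlMr// mulrC -(size_bias_mean X_integrable biased bphi).
  apply: le_mean_ae => //.
    apply: (has_mean_le (g := fun w => N%:R * X w)) => [||w].
    - apply: measurable_funM => //; case: bphi => mb _; exact: (measurableT_comp mb).
    - exact: has_meanZ.
    - rewrite !normrM mulrC ler_wpM2r// ger0_norm.
        by rewrite ger0_norm// ge_min lexx orbT.
      by rewrite le_min normr_ge0 ler0n.
  apply: filterS size_bias_ae_ge0 => w X0; rewrite ler_wpM2l//.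
  by rewrite ge_min lexx.
have [i1 l1] := has_mean_truncation mX1 (fun w => normr_ge0 _) tr.
have i2 : has_mean P (fun w => `|X w + Xs w - 1| + `|X w|).
  by apply: has_meanD => //; exact: has_mean_norm.
have le w : `|Xs w - 1| <= `|X w + Xs w - 1| + `|X w|.
  have -> : Xs w - 1 = X w + Xs w - 1 - X w by ring.
  exact: ler_normB.
have mXs : measurable_fun setT (fun w => `|Xs w - 1|).
  by apply: measurableT_comp => //; exact: measurable_funB.
have i3 : has_mean P (fun w => `|Xs w - 1|).
  apply: has_mean_le i2 _ => // w; rewrite normr_id (le_trans (le w))//.
  exact: ler_norm.
split => //; apply: le_trans (ler_wpM2l m_ge0 (le_mean i3 i2 le)) _.
rewrite meanD// ?(size_bias_mean_norm X_integrable biased m_ge0); last exact: has_mean_norm.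
by rewrite mulrDr -expr2 lerD2r mulrC -ler_pdivlMr.
Qed.

End SizeBiasMoments.

Section ExponentialMoments.
Context (R : realType).

(** For nonnegative integers [y] the product [y * (y - 1)] vanishes at
0 and 1; beyond, it is at most [M] times the linear term when [c * y <= M] and
small with respect to the exponential, by its cubic term, otherwise. *)
Lemma square_le_exponential (gamma M c y : R) : 0 < gamma -> 0 < M -> 0 <= c ->
  0 <= y -> y \is a Num.int ->
  c ^+ 2 * (y * `|y - 1|) <=
  M * (c * (y - (y == 1)%:R)) + 6 / (gamma ^+ 3 * M) * (expR (c * y * gamma) - 1).
Proof.
move=> g0 M0 c0 y0 yint.
have z0 : 0 <= c * y by rewrite mulr_ge0.
have e3 : (c * y * gamma) ^+ 3 <= 6 * (expR (c * y * gamma) - 1).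
  have := @expR_ge1Dxn R (c * y * gamma) 2 (mulr_ge0 z0 (ltW g0)).
  have -> : 3`! = 6%N by []; rewrite -lerBrDl ler_pdivrMr//.
  by rewrite [6 * _]mulrC.
have e0 : 0 <= expR (c * y * gamma) - 1.
  by rewrite subr_ge0 -[leLHS]expR0 ler_expR mulr_ge0// ltW.
have r0 : 0 <= 6 / (gamma ^+ 3 * M) * (expR (c * y * gamma) - 1).
  by rewrite mulr_ge0// divr_ge0// mulr_ge0 ?exprn_ge0// ltW.
have [y1|y1] := eqVneq y 1.
  by rewrite [in leLHS]y1 subrr normr0 !mulr0 {1}y1 subrr !mulr0 add0r.
have [yn0|yn0] := eqVneq y 0.
  by rewrite [in leLHS]yn0 mul0r mulr0 {1}yn0 subr0 !mulr0 add0r.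
have y2 : 2 <= y.
  move: yint y0 y1 yn0 => /intrP[[k|k] ->].
    by case: k => [|[|k]] _; rewrite -pmulrn ?eqxx// ler_nat.
  by rewrite NegzE mulrNz oppr_ge0 -pmulrn lern0.
rewrite subr0 ger0_norm; last by rewrite subr_ge0; lra.
apply: (@le_trans _ _ ((c * y) ^+ 2)).
  by rewrite exprMn ler_wpM2l ?sqr_ge0// expr2 ler_wpM2l// lerBlDr lerDl.
have [zM|Mz] := leP (c * y) M.
  apply: (@le_trans _ _ (M * (c * y))); last by rewrite lerDl.
  by rewrite expr2 ler_wpM2r.
apply: (@le_trans _ _ (6 / (gamma ^+ 3 * M) * (expR (c * y * gamma) - 1))); last first.
  by rewrite lerDr mulr_ge0// ltW.
have gM : 0 < gamma ^+ 3 * M by rewrite mulr_gt0// exprn_gt0.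
rewrite mulrAC ler_pdivlMr//; apply: le_trans e3.
have -> : (c * y * gamma) ^+ 3 = (c * y) ^+ 2 * (gamma ^+ 3 * (c * y)) by ring.
by rewrite ler_wpM2l ?sqr_ge0// ler_wpM2l ?exprn_ge0 ?ltW.
Qed.

Lemma exp_minus1_le (x b : R) : 0 <= x <= b -> expR x - 1 <= expR b * x.
Proof.
move=> /andP[x0 xb].
have H2 : (1 - x) * expR x <= 1 by rewrite -ler_pdivlMr ?expR_gt0// mul1r -expRN; exact: expR_ge1Dx.
have H3 : expR x * x <= expR b * x by rewrite ler_wpM2r// ler_expR.
lra.
Qed.

End ExponentialMoments.

Section LogMoments.
Context d (T : measurableType d) (R : realType) (P : probability T R).
Variables (X : nat -> {RV P >-> R}) (gamma : R).
Hypothesis gamma_gt0 : 0 < gamma.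
Hypothesis X_integrable : forall i, (0 < i)%N -> has_mean P (X i).
Hypothesis m_ge0 : forall i, (0 < i)%N -> 0 <= mean P (X i).
Notation E n k := (fun w => expR (k%:R * X k w * gamma / n%:R)).
Hypothesis log_bound : (ereal_sup
  [set \sum_(1 <= k < n.+1) lne 'E_P[E n k] | n in [set n | (0 < n)%N]] < +oo)%E.

Let mE n k : measurable_fun setT (E n k).
Proof.
by apply: measurableT_comp => //; do 3 apply: measurable_funM => //.
Qed.

(** Jensen's inequality, by the tangent line of the exponential. *)
Lemma expectation_exp_ge1 n k : (0 < k)%N -> (1 <= 'E_P[E n k])%E.
Proof.
move=> k0; case: (boolP (('E_P[E n k])%E \is a fin_num)) => [Ef|].
  have iE : has_mean P (E n k).
    apply/integrableP; split; first exact/measurable_EFinP.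
    have -> : (\int[P]_x `|(EFin \o E n k) x| = 'E_P[E n k])%E.
      by rewrite unlock; apply: eq_integral => x _; rewrite /= ger0_norm// expR_ge0.
    by rewrite -ge0_fin_numE// expectation_ge0// => x; exact: expR_ge0.
  rewrite -(EFin_mean iE) lee_fin.
  have i1 : has_mean P (fun w => k%:R * gamma / n%:R * X k w).
    by apply: has_meanZ; exact: X_integrable.
  apply: (@le_trans _ _ (mean P (fun w => 1 + k%:R * gamma / n%:R * X k w))).
    rewrite meanD//; last exact: has_mean_cst.
    rewrite mean_cst lerDl meanZ; last exact: X_integrable.
    by rewrite mulr_ge0 ?m_ge0// divr_ge0// mulr_ge0// ltW.
  apply: le_mean => //; first by apply: has_meanD => //; exact: has_mean_cst.
  move=> w; have -> : k%:R * gamma / n%:R * X k w = k%:R * X k w * gamma / n%:R by ring.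
  exact: expR_ge1Dx.
have : (0 <= 'E_P[E n k])%E by apply: expectation_ge0 => x; exact: expR_ge0.
by case: ('E_P[E n k])%E => // _ _; rewrite leey.
Qed.

(** All logarithms are nonnegative, so each is at most the bound of their sum;
on a bounded range [x - 1] is at most a multiple of [ln x] for [x >= 1]. *)
Lemma exponential_moments : exists2 B : R, 0 <= B & forall n, (0 < n)%N ->
  (forall k, (1 <= k <= n)%N -> has_mean P (E n k)) /\
  \sum_(1 <= k < n.+1) (mean P (E n k) - 1) <= B.
Proof.
have [b b0 bP] : exists2 b : R, 0 <= b & forall n, (0 < n)%N ->
    (\sum_(1 <= k < n.+1) lne 'E_P[E n k] <= b%:E)%E.
  pose s := ereal_sup [set \sum_(1 <= k < n.+1) lne 'E_P[E n k] | n in [set n | (0 < n)%N]].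
  exists (Num.max 0 (fine s)); first by rewrite le_max lexx.
  move=> n n0; apply: (@le_trans _ _ s).
    by apply: ereal_sup_ubound; exists n.
  move: log_bound; rewrite -/s; case: s => [r _|//|_]; last by rewrite leNye.
  by rewrite lee_fin le_max lexx orbT.
have l0 n k : (0 < k)%N -> (0 <= lne 'E_P[E n k])%E.
  by move=> k0; rewrite lne_ge0 expectation_exp_ge1.
exists (expR b * b); first by rewrite mulr_ge0// expR_ge0.
move=> n n0.
have lk k : (1 <= k <= n)%N -> (lne 'E_P[E n k] <= b%:E)%E.
  move=> kn; apply: le_trans (bP n n0).
  rewrite (bigD1_seq k) ?iota_uniq//= ?mem_index_iota ?ltnS//.
  rewrite leeDl// big_seq_cond; apply: sume_ge0 => j /andP[].
  by rewrite mem_index_iota => /andP[j0 _] _; exact: l0.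
have iE k : (1 <= k <= n)%N -> has_mean P (E n k).
  move=> kn; apply/integrableP; split; first exact/measurable_EFinP.
  have -> : (\int[P]_x `|(EFin \o E n k) x| = 'E_P[E n k])%E.
    by rewrite unlock; apply: eq_integral => x _; rewrite /= ger0_norm// expR_ge0.
  have := lk k kn; case: ('E_P[E n k])%E => [r _|//|_]; first by rewrite ltry.
  by [].
split => //.
have EL k : (1 <= k <= n)%N -> lne 'E_P[E n k] = (ln (mean P (E n k)))%:E.
  move=> kn; have k0 : (0 < k)%N by case/andP: kn.
  rewrite -(EFin_mean (iE k kn)) lne_EFin//.
  have := expectation_exp_ge1 n k0; rewrite -(EFin_mean (iE k kn)) lee_fin.
  exact: lt_le_trans.
have sumL : \sum_(1 <= k < n.+1) ln (mean P (E n k)) <= b.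
  rewrite -lee_fin -sumEFin; apply: le_trans (bP n n0).
  rewrite le_eqVlt; apply/orP; left; apply/eqP; apply: eq_big_nat => k.
  by rewrite ltnS => kn; rewrite EL.
apply: le_trans (ler_wpM2l (expR_ge0 b) sumL).
rewrite mulr_sumr big_nat_cond [leRHS]big_nat_cond; apply: ler_sum => k /andP[].
rewrite ltnS => kn _; have k0 : (0 < k)%N by case/andP: kn.
have e1 : 1 <= mean P (E n k).
  by rewrite -lee_fin (EFin_mean (iE k kn)) expectation_exp_ge1.
have := @exp_minus1_le R (ln (mean P (E n k))) b.
rewrite lnK; last by rewrite posrE (lt_le_trans _ e1).
by apply; rewrite ln_ge0//= -lee_fin -EL// lk.
Qed.

End LogMoments.

(** * The discrepancy is eventually away from 1 *)

Section Uniform01.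
Context d (T : measurableType d) (R : realType) (P : probability T R).
Variable U : {RV P >-> R}.
Hypothesis U_unif : uniform01 P U.

Lemma uniform01_ae : {ae P, forall w, 0 <= U w <= 1}.
Proof.
have mA : measurable (~` `[0, 1]%classic : set R) by apply: measurableC.
exists (U @^-1` (~` `[0, 1]%classic)); split.
- exact: measurable_funPTI.
- rewrite U_unif// /uniform_prob; apply: integral0_eq => x /= Ux.
  by rewrite /uniform_pdf; case: ifPn => // x01; exfalso; apply: Ux.
- by move=> w /= H U01; apply: H; move: U01; rewrite /= in_itv.
Qed.

(** By [`|v| <= v ^+ 2 + 1 / 4], with [1 / 12] for the variance of the uniform
law. *)
Lemma uniform01_centred : has_mean P U /\ mean P (fun w => `|U w - 2^-1|) <= 3^-1.
Proof.
have hU : has_mean P U.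
  apply: (has_mean_le_ae _ (has_mean_cst P 1)) => //.
  by apply: filterS uniform01_ae => w /andP[U0 U1]; rewrite ger0_norm.
split => //.
pose h (u : R) := (clamp u - 2^-1) ^+ 2 + 4^-1.
have h0 u : 0 <= h u by rewrite addr_ge0 ?sqr_ge0// invr_ge0.
have bh : bounded_measurable h.
  split.
    apply: measurable_funD => //; apply: measurable_funX; apply: measurable_funB => //.
    exact: measurable_clamp.
  exists 1 => u; rewrite ger0_norm// /h; have := clamp_ge0 u; have := clamp_le1 u.
  nra.
have bhU : bounded_measurable (fun w => h (U w)).
  by case: bh => mh [M hM]; split; [exact: measurableT_comp|exists M].
apply: (@le_trans _ _ (mean P (fun w => h (U w)))).
  apply: le_mean_ae.
  - by apply: has_mean_norm; apply: has_meanB => //; exact: has_mean_cst.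
  - exact: has_mean_bounded.
  apply: filterS uniform01_ae => w U01; rewrite /h clamp01//.
  have : 0 <= (`|U w - 2^-1| - 2^-1) ^+ 2 by rewrite sqr_ge0.
  rewrite sqrrB real_normK ?num_real//; lra.
rewrite mean_uniform01//.
pose F (u : R) := 3^-1 * (u - 2^-1) ^+ 3 + 4^-1 * u.
have dF (x : R) : is_derive x 1 F ((x - 2^-1) ^+ 2 + 4^-1).
  by apply: is_derive_eq; rewrite /GRing.scale/=; field.
have cF (x : R) : {for x, continuous F} := is_derive_continuous (dF x).
have -> : mean (uniform_prob (@ltr01 R)) h = F 1 - F 0; last by rewrite /F; lra.
apply: mean_uniform_FTC => //.
- rewrite /h; apply: continuous_subspaceT => x.
  apply: cvgD; last exact: cvg_cst.
  apply: (@continuous_comp _ _ _ (fun u => clamp u - 2^-1) (fun v : R => v ^+ 2)); last exact: exprn_continuous.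
  apply: cvgB; last exact: cvg_cst.
  rewrite /clamp; apply: continuous_max; first exact: cvg_cst.
  by apply: continuous_min; [exact: cvg_cst|exact: cvg_id].
- exact/cvg_at_right_filter/cF.
- exact/cvg_at_left_filter/cF.
- by move=> x /andP[x0 x1]; rewrite /h clamp01 ?ltW.
Qed.

End Uniform01.

Lemma average_cvg (R : realType) (u : nat -> R) (l : R) : u @ \oo --> l ->
  (fun n => n%:R^-1 * \sum_(1 <= k < n.+1) u k) @ \oo --> l.
Proof.
move=> ul; rewrite -cvg_shiftS.
have /cesaro : (fun n => u n.+1) @ \oo --> l by rewrite cvg_shiftS.
apply: cvg_trans; apply: near_eq_cvg; apply: nearW => n.
rewrite /arithmetic_mean /series /=; congr (_ * _).
by rewrite [RHS]big_add1.
Qed.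

Section Discrepancy.
Context d (T : measurableType d) (R : realType) (P : probability T R).
Variables (X Xs : nat -> {RV P >-> R}) (theta K gamma : R).
Hypothesis theta_gt0 : 0 < theta.
Hypothesis gamma_gt0 : 0 < gamma.
Hypothesis X_int : forall i, (0 < i)%N -> integer_valued (X i).
Hypothesis X_integrable : forall i, (0 < i)%N -> has_mean P (X i).
Hypothesis biased : forall i, (0 < i)%N -> size_bias_increment P (X i) (Xs i).
Notation m k := (mean P (X k)).
Hypothesis m_ge0 : forall i, (0 < i)%N -> 0 <= m i.
Hypothesis m_le : forall i, (0 < i)%N -> i%:R * m i <= K.
Notation p k := (mean P (fun w => (X k w == 1)%:R)).
Hypothesis p_lim : (fun k => k%:R * p k) @ \oo --> theta.
Hypothesis m_lim : (fun k => k%:R * m k) @ \oo --> theta.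
Notation E n k := (fun w => expR (k%:R * X k w * gamma / n%:R)).
Variable B : R.
Hypothesis B_ge0 : 0 <= B.
Hypothesis exp_moments : forall n, (0 < n)%N ->
  (forall k, (1 <= k <= n)%N -> has_mean P (E n k)) /\
  \sum_(1 <= k < n.+1) (mean P (E n k) - 1) <= B.
Notation q k := (mean P (fun w => X k w * `|X k w - 1|)).

Let X_ge0 k : (0 < k)%N -> {ae P, forall w, 0 <= X k w}.
Proof.
by move=> k0; exact: size_bias_ae_ge0 (X_integrable k0) (biased k0) (m_ge0 k0).
Qed.

Let has_p k : has_mean P (fun w => (X k w == 1)%:R).
Proof.
have -> : (fun w => (X k w == 1)%:R) = \1_(X k @^-1` [set 1]) :> (T -> R).
  apply/funext => w; rewrite indicE; congr (_%:R).
  by apply: congr1; apply/eqP/idP => [|]; rewrite inE.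
apply: has_mean_bounded; apply: bounded_measurable_indic.
by apply: measurable_funPTI; exact: measurable_set1.
Qed.

(** The pointwise bound of the square by the exponential, in the mean and with
[c = k / n]. *)
Lemma quadratic_term n k M : (1 <= k <= n)%N -> 0 < M ->
  has_mean P (fun w => X k w * `|X k w - 1|) /\
  (k%:R / n%:R) ^+ 2 * q k <=
  M * (k%:R / n%:R * (m k - p k)) + 6 / (gamma ^+ 3 * M) * (mean P (E n k) - 1).
Proof.
move=> kn M0; have k0 : (0 < k)%N by case/andP: kn.
have n0 : (0 < n)%N by case/andP: kn => _; exact: leq_trans.
have c0 : 0 < k%:R / n%:R :> R by rewrite divr_gt0// ltr0n.
have [/(_ k kn) iE _] := exp_moments n0.
have iX := X_integrable k0.
pose rhs w := M * (k%:R / n%:R * (X k w - (X k w == 1)%:R)) +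
  6 / (gamma ^+ 3 * M) * (E n k w - 1).
have i1 : has_mean P (fun w => X k w - (X k w == 1)%:R) by exact: has_meanB.
have i2 : has_mean P (fun w => E n k w - 1).
  by apply: has_meanB => //; exact: has_mean_cst.
have i3 : has_mean P (fun w => k%:R / n%:R * (X k w - (X k w == 1)%:R)).
  exact: has_meanZ.
have irhs : has_mean P rhs by apply: has_meanD; exact: has_meanZ.
have mean_rhs : mean P rhs =
    M * (k%:R / n%:R * (m k - p k)) + 6 / (gamma ^+ 3 * M) * (mean P (E n k) - 1).
  rewrite meanD; [|exact: has_meanZ|exact: has_meanZ].
  rewrite !meanZ// !meanB//; last exact: has_mean_cst.
  by rewrite mean_cst.
have le : {ae P, forall w, (k%:R / n%:R) ^+ 2 * (X k w * `|X k w - 1|) <= rhs w}.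
  apply: filterS (X_ge0 k0) => w Xw0.
  have := square_le_exponential gamma_gt0 M0 (ltW c0) Xw0 (X_int k0 w).
  suff -> : k%:R / n%:R * X k w * gamma = k%:R * X k w * gamma / n%:R by [].
  by ring.
have mq : measurable_fun setT (fun w => X k w * `|X k w - 1|).
  by apply: measurable_funM => //; apply: measurableT_comp => //; exact: measurable_funB.
have iq2 : has_mean P (fun w => (k%:R / n%:R) ^+ 2 * (X k w * `|X k w - 1|)).
  apply: (has_mean_le_ae _ irhs); first exact: measurable_funM.
  apply: filterS2 (X_ge0 k0) le => w Xw0 lew; rewrite [leLHS]ger0_norm//.
  by rewrite !mulr_ge0// ?exprn_ge0// ltW.
have iq : has_mean P (fun w => X k w * `|X k w - 1|).
  have := has_meanZ ((k%:R / n%:R) ^- 2) iq2.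
  congr (has_mean P _); apply/funext => w.
  by rewrite mulrA mulVf ?mul1r// expf_neq0// gt_eqF.
by split => //; rewrite -mean_rhs -meanZ//; exact: le_mean_ae.
Qed.

Lemma quadratic_sum_le n M : (0 < n)%N -> 0 < M ->
  \sum_(1 <= k < n.+1) (k%:R / n%:R) ^+ 2 * q k <=
  M * (n%:R^-1 * \sum_(1 <= k < n.+1) (k%:R * m k - k%:R * p k)) +
  6 / (gamma ^+ 3 * M) * B.
Proof.
move=> n0 M0; have [_ leB] := exp_moments n0.
apply: (@le_trans _ _ (\sum_(1 <= k < n.+1) (M * (k%:R / n%:R * (m k - p k)) +
    6 / (gamma ^+ 3 * M) * (mean P (E n k) - 1)))).
  rewrite big_nat_cond [leRHS]big_nat_cond; apply: ler_sum => k /andP[].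
  by rewrite ltnS => kn _; have [] := quadratic_term kn M0.
rewrite big_split/= -!mulr_sumr; apply: lerD.
  rewrite ler_wpM2l ?(ltW M0)// mulr_sumr le_eqVlt; apply/orP; left; apply/eqP.
  by apply: eq_bigr => k _; ring.
by rewrite ler_wpM2l// divr_ge0// mulr_ge0 ?exprn_ge0// ltW.
Qed.

(** The parameter [M] balances the two terms: it is chosen large enough for the
exponential moments, and then the Cesaro means of [k * (m k - p k)] are small
because [k * m k] and [k * p k] have the same limit. *)
Lemma quadratic_sum_small (e : R) : 0 < e ->
  \forall n \near \oo, \sum_(1 <= k < n.+1) (k%:R / n%:R) ^+ 2 * q k <= e.
Proof.
move=> e0; have g3 : 0 < gamma ^+ 3 by rewrite exprn_gt0.
pose M := 12 * B / (gamma ^+ 3 * e) + 1.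
have M0 : 0 < M by rewrite ltr_wpDl// divr_ge0 ?mulr_ge0// ltW// mulr_gt0.
have d_lim : (fun k => k%:R * m k - k%:R * p k) @ \oo --> (0 : R).
  by rewrite -(subrr theta); exact: cvgB.
have := average_cvg d_lim => /cvgr0Pnorm_le /(_ (e / (2 * M))).
rewrite divr_gt0 ?mulr_gt0// => /(_ isT) H.
near=> n.
have n0 : (0 < n)%N by near: n; exact: nbhs_infty_gt.
apply: le_trans (quadratic_sum_le n0 M0) _.
have -> : e = M * (e / (2 * M)) + e / 2 by field; rewrite gt_eqF.
apply: lerD.
  rewrite ler_wpM2l ?(ltW M0)//; apply: le_trans (ler_norm _) _.
  by near: n; exact: H.
rewrite mulrAC ler_pdivrMr ?mulr_gt0//.
have -> : e / 2 * (gamma ^+ 3 * M) = 6 * B + e * gamma ^+ 3 / 2.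
  by rewrite /M; field; rewrite !gt_eqF.
by rewrite lerDl divr_ge0// mulr_ge0// ltW.
Unshelve. all: by end_near. Qed.

Section OneIndex.
Variables (n : nat) (I : {RV P >-> nat}) (U : {RV P >-> R}).
Hypothesis n_gt0 : (0 < n)%N.
Hypothesis I_index : random_index P X Xs n I.
Hypothesis U_unif : uniform01 P U.
Notation W := (total_weight P X n).
Hypothesis W_neq0 : W != 0.

Let Xs_moment k : (1 <= k <= n)%N -> m k != 0 ->
  has_mean P (fun w => `|Xs k w - 1|) /\
  m k * mean P (fun w => `|Xs k w - 1|) <= q k + m k ^+ 2.
Proof.
move=> kn mk; have k0 : (0 < k)%N by case/andP: kn.
have [iq _] := quadratic_term kn ltr01.
exact: size_bias_increment_moment (X_integrable k0) (biased k0) (m_ge0 k0) iq mk.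
Qed.

Lemma gap_has_mean : has_mean P (fun w => U w - (I w)%:R * Xs (I w) w / n%:R).
Proof.
apply: has_meanB; first by have [] := uniform01_centred U_unif.
have := @mean_random_index _ _ _ _ _ _ _ _ I_index W_neq0 (fun k x => k%:R * x / n%:R).
case=> // [k|k kn mk].
  by apply: measurable_funM => //; exact: measurable_funM.
have [i1 _] := Xs_moment kn mk.
have i2 : has_mean P (Xs k).
  apply: (has_mean_le (g := fun w => `|Xs k w - 1| + 1)) => // [|w].
    by apply: has_meanD => //; exact: has_mean_cst.
  rewrite [leRHS]ger0_norm ?addr_ge0// -[X in `|X| <= _](subrK 1).
  by apply: le_trans (ler_normD _ _) _; rewrite normr1.
have := has_meanZ (k%:R / n%:R) i2.
by congr (has_mean P _); apply/funext => w; ring.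
Qed.

Let q_ge0 k : (1 <= k <= n)%N -> 0 <= q k.
Proof.
move=> kn; have k0 : (0 < k)%N by case/andP: kn.
have [iq _] := quadratic_term kn ltr01.
rewrite -(mean_cst P 0); apply: le_mean_ae => //; first exact: has_mean_cst.
by apply: filterS (X_ge0 k0) => w X0; rewrite mulr_ge0.
Qed.

Lemma index_moment :
  has_mean P (fun w => (I w)%:R / n%:R * `|Xs (I w) w - 1|) /\
  W / n%:R * mean P (fun w => (I w)%:R / n%:R * `|Xs (I w) w - 1|) <=
  \sum_(1 <= k < n.+1) (k%:R / n%:R) ^+ 2 * q k + K ^+ 2 / n%:R.
Proof.
have n0 : 0 < n%:R :> R by rewrite ltr0n.
have [||i1 E1] := @mean_random_index _ _ _ _ _ _ _ _ I_index W_neq0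
  (fun k x => k%:R / n%:R * `|x - 1|).
- move=> k; apply: measurable_funM => //; apply: measurableT_comp => //.
  exact: measurable_funB.
- by move=> k kn mk; apply: has_meanZ; have [] := Xs_moment kn mk.
split => //; rewrite mulrAC E1 ler_pdivrMr//.
apply: (@le_trans _ _ (\sum_(1 <= k < n.+1)
    (n%:R * ((k%:R / n%:R) ^+ 2 * q k) + K ^+ 2 / n%:R))).
  rewrite big_nat_cond [leRHS]big_nat_cond; apply: ler_sum => k /andP[].
  rewrite ltnS => kn _; have k0 : (0 < k)%N by case/andP: kn.
  have km : (k%:R * m k) ^+ 2 <= K ^+ 2.
    by rewrite lerXn2r ?nnegrE ?m_le ?mulr_ge0 ?m_ge0// (le_trans _ (m_le k0))// mulr_ge0 ?m_ge0.
  have bound : k%:R * m k * mean P (fun w => k%:R / n%:R * `|Xs k w - 1|) <=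
      k%:R ^+ 2 / n%:R * (q k + m k ^+ 2).
    have [->|mk] := eqVneq (m k) 0.
      rewrite mulr0 mul0r mulr_ge0 ?divr_ge0 ?sqr_ge0// ?(ltW n0)//.
      by rewrite addr_ge0 ?sqr_ge0// q_ge0.
    have [i2 l2] := Xs_moment kn mk.
    apply: le_trans (ler_wpM2l _ l2); last by rewrite divr_ge0 ?sqr_ge0// ltW.
    by rewrite meanZ// le_eqVlt; apply/orP; left; apply/eqP; ring.
  apply: le_trans bound _.
  have -> : k%:R ^+ 2 / n%:R * (q k + m k ^+ 2) =
    n%:R * ((k%:R / n%:R) ^+ 2 * q k) + (k%:R * m k) ^+ 2 / n%:R.
    by field; rewrite gt_eqF.
  by rewrite lerD2l ler_pM2r ?invr_gt0.
rewrite big_split/= -mulr_sumr sumr_const_nat subn1/= -mulr_natr.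
by rewrite le_eqVlt; apply/orP; left; apply/eqP; field; rewrite gt_eqF.
Qed.

(** Since [I / n] lies in the unit interval, [V] is close to a variable with
values in that interval as soon as [Xs I] is close to 1, and two such variables,
one of them uniform, are at mean distance at most [1 / 3 + 1 / 2]: compare both
with the midpoint. *)
Lemma gap_le : mean P (fun w => `|U w - (I w)%:R * Xs (I w) w / n%:R|) <=
  5 / 6 + mean P (fun w => (I w)%:R / n%:R * `|Xs (I w) w - 1|).
Proof.
have n0 : 0 < n%:R :> R by rewrite ltr0n.
have [iU EU] := uniform01_centred U_unif; have [i1 _] := index_moment.
have iU2 : has_mean P (fun w => `|U w - 2^-1|).
  by apply: has_mean_norm; apply: has_meanB => //; exact: has_mean_cst.
have iU3 : has_mean P (fun w => `|U w - 2^-1| + 2^-1).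
  by apply: has_meanD => //; exact: has_mean_cst.
apply: (@le_trans _ _ (mean P (fun w => (`|U w - 2^-1| + 2^-1) +
    (I w)%:R / n%:R * `|Xs (I w) w - 1|))).
  apply: le_mean.
  - by apply: has_mean_norm; exact: gap_has_mean.
  - exact: has_meanD.
  move=> w; have [/(_ w) /andP[I1 In] _ _] := I_index.
  have c0 : 0 <= (I w)%:R / n%:R :> R by rewrite divr_ge0// ltW.
  have c1 : (I w)%:R / n%:R <= 1 :> R by rewrite ler_pdivrMr// mul1r ler_nat.
  set c := (I w)%:R / n%:R in c0 c1 *.
  have -> : U w - (I w)%:R * Xs (I w) w / n%:R =
    ((U w - 2^-1) + (2^-1 - c)) + (- (c * (Xs (I w) w - 1))) by rewrite /c; ring.
  apply: le_trans (ler_normD _ _) _; rewrite normrN normrM (ger0_norm c0) lerD2r.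
  apply: le_trans (ler_normD _ _) _; rewrite lerD2l ler_norml; lra.
rewrite meanD// meanD//; last exact: has_mean_cst.
by rewrite mean_cst; lra.
Qed.

End OneIndex.

Lemma total_weight_cvg : (fun n => total_weight P X n / n%:R) @ \oo --> theta.
Proof.
have := average_cvg m_lim; apply: cvg_trans; apply: near_eq_cvg; apply: nearW => n.
by rewrite total_weightE mulrC.
Qed.

(** Any bound below 1 serves the logarithmic factor: [W / n] tends to [theta], and
the mean of [I / n * `|Xs I - 1|] to 0, so the left-hand side is eventually below
every constant above [5 / 6]. *)
Lemma discrepancy_le_eventually (I : nat -> {RV P >-> nat}) (U : nat -> {RV P >-> R}) :
  (forall n, (0 < n)%N -> random_index P X Xs n (I n)) ->
  (forall n, (0 < n)%N -> uniform01 P (U n)) ->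
  \forall n \near \oo, `|theta - total_weight P X n / n%:R| +
    mean P (fun w => `|U n w - (I n w)%:R * Xs (I n w) w / n%:R|) <= 9 / 10.
Proof.
move=> I_index U_unif.
(* With [W / n >= theta / 2], two errors of size [theta / 160] contribute at most
   [1 / 40], and [1 / 30 + 5 / 6 + 1 / 40 < 9 / 10]. *)
pose e := theta / 160.
have e0 : 0 < e by rewrite divr_gt0.
have K2 : (fun n : nat => K ^+ 2 / n%:R) @ \oo --> (0 : R).
  rewrite -(mulr0 (K ^+ 2)); apply: cvgMr; rewrite -cvg_shiftS; exact: cvg_harmonic.
have /cvgr0Pnorm_le/(_ e e0) H2 := K2.
have H1 := quadratic_sum_small e0.
have /cvgrPdist_le H3 := total_weight_cvg.
have t2 : 0 < theta / 2 by rewrite divr_gt0.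
have H3a := H3 _ t2; have H3b := H3 (1 / 30) ltac:(lra).
near=> n.
have n0 : (0 < n)%N by near: n; exact: nbhs_infty_gt.
have n0R : 0 < n%:R :> R by rewrite ltr0n.
have h1 : \sum_(1 <= k < n.+1) (k%:R / n%:R) ^+ 2 * q k <= e by near: n.
have h2 : K ^+ 2 / n%:R <= e.
  by apply: le_trans (ler_norm _) _; near: n.
have h3a : `|theta - total_weight P X n / n%:R| <= theta / 2 by near: n.
have h3b : `|theta - total_weight P X n / n%:R| <= 1 / 30 by near: n.
have Wn : theta / 2 <= total_weight P X n / n%:R.
  by move: h3a; rewrite ler_norml => /andP[_]; lra.
have W0 : total_weight P X n != 0.
  by apply: contraTneq Wn => ->; rewrite mul0r -ltNge.
have := gap_le n0 (I_index n n0) (U_unif n n0) W0.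
have [_] := index_moment n0 (I_index n n0) W0.
set M := mean P _ => hM hg.
have M0 : 0 <= M by apply: mean_ge0 => w; rewrite mulr_ge0// divr_ge0// ltW.
have hM2 : theta / 2 * M <= theta / 2 * (1 / 40).
  apply: le_trans (ler_wpM2r M0 Wn) _; apply: le_trans hM _.
  by move: h1 h2; rewrite /e; lra.
have hM3 : M <= 1 / 40 by rewrite -(ler_pM2l t2).
lra.
Unshelve. all: by end_near. Qed.

End Discrepancy.

(** * Distance and logarithmic factor *)

Section TestFunctions.
Context (R : realType).

Lemma W3_test_smooth (h : R -> R) : W3_test h ->
  smooth 1 1 h (derive1 h) /\ forall x, `|h x| <= 1.
Proof.
move=> [[dh _] hb].
have d1 (x : R) : is_derive x 1 h (derive1 h x).
  by rewrite derive1E; apply: derivableP; exact: (dh 0%N).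
have d2 (x : R) : is_derive x 1 (derive1 h) (derive1n 2 h x).
  by rewrite /= derive1E; apply: derivableP; exact: (dh 1%N).
split; last exact: (hb 0%N).
apply: lipschitz_derivative_smooth => //; first exact: (hb 1%N).
exact: (derivative_bound_lipschitz d2 (hb 2%N isT)).
Qed.

Lemma W3_le d (T : measurableType d) (P : probability T R) (X Y : T -> R) (c : R) :
  measurable_fun setT X -> measurable_fun setT Y ->
  (forall h dh, smooth 1 1 h dh -> (forall x, `|h x| <= 1) ->
    `|mean P (fun w => h (X w)) - mean P (fun w => h (Y w))| <= c) ->
  (W3 P X Y <= c%:E)%E.
Proof.
move=> mX mY le; apply: ge_ereal_sup => _ [h /W3_test_smooth[sh hb] <-].
have hm (Z : T -> R) : measurable_fun setT Z -> has_mean P (h \o Z).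
  move=> mZ; apply: has_mean_bounded; split; last by exists 1 => x; exact: hb.
  apply: measurableT_comp => //; apply: continuous_measurableT.
  exact: smooth_continuous sh.
rewrite -!EFin_mean//; try exact: hm.
by rewrite -EFinB abse_EFin lee_fin; exact: le sh hb.
Qed.

End TestFunctions.

(** For positive [D] different from 1 the factor [sqrt |ln D|] is positive, and
it is bounded below while [D <= 9 / 10]; the finitely many remaining terms only
change the constant. *)
Lemma log_factor_bound (R : realType) (D : nat -> R) (c : R) : 0 <= c ->
  (forall n, 0 <= D n) -> (\forall n \near \oo, D n <= 9 / 10) ->
  exists2 C : R, 0 < C & forall n, D n != 1 ->
    c * D n <= C * (D n * Num.sqrt `|ln (D n)|).
Proof.
move=> c0 D0 [N _ DN].
pose s (x : R) := Num.sqrt `|ln x|.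
have s0 x : 0 <= s x by exact: sqrtr_ge0.
pose S := \sum_(0 <= n < N) c / s (D n).
have S0 : 0 <= S by apply: sumr_ge0 => n _; rewrite divr_ge0.
exists (1 + S + c / s (9 / 10)); first by rewrite ltr_wpDr ?divr_ge0// ltr_wpDr.
move=> n Dn1; have [->|Dn0] := eqVneq (D n) 0; first by rewrite mul0r !mulr0.
have Dn : 0 < D n by rewrite lt_neqAle eq_sym Dn0 D0.
have sn : 0 < s (D n).
  by rewrite sqrtr_gt0 normr_gt0 ln_eq0.
suff le : c / s (D n) <= 1 + S + c / s (9 / 10).
  by rewrite -/(s _) [D n * _]mulrC mulrA ler_wpM2r// -ler_pdivrMr.
have [nN|Nn] := ltnP n N.
  apply: (@le_trans _ _ S); last first.
    by rewrite addrAC lerDr addr_ge0// divr_ge0.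
  rewrite /S (bigD1_seq n) ?iota_uniq ?mem_index_iota//= lerDl.
  by apply: sumr_ge0 => i _; rewrite divr_ge0.
apply: (@le_trans _ _ (c / s (9 / 10))); last by rewrite lerDr addr_ge0.
have D9 := DN n Nn.
have l9 : ln (9 / 10 : R) < 0 by apply: ln_lt0; rewrite divr_gt0//= ltr_pdivrMr; lra.
have lD : ln (D n) <= ln (9 / 10) by rewrite ler_ln ?posrE.
apply: ler_wpM2l => //; rewrite lef_pV2 ?posrE// ?sqrtr_gt0 ?normr_gt0 ?lt_eqF//.
rewrite ler_wsqrtr// !ltr0_norm ?lerN2//; exact: le_lt_trans l9.
Qed.

Theorem theorem4 (R : realType) (d : measure_display) (T : measurableType d)
  (P : probability T R) (theta : R) (X Xs : nat -> {RV P >-> R})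
  (I : nat -> {RV P >-> nat}) (U : nat -> {RV P >-> R}) (Z : {RV P >-> R})
  (theta_gt0 : 0 < theta)
  (X_indep : mutually_independent P [set i | (0 < i)%N] X)
  (X_int : forall i, (0 < i)%N -> integer_valued (X i))
  (X_integrable : forall i, (0 < i)%N -> P.-integrable setT (EFin \o X i))
  (A1_prob : (i%:R%:E * P (X i @^-1` [set 1%R]))%E @[i --> \oo] --> theta%:E)
  (A1_mean : (i%:R%:E * 'E_P[X i])%E @[i --> \oo] --> theta%:E)
  (A2 : forall i, (0 < i)%N -> size_bias_increment P (X i) (Xs i))
  (A3 : (ereal_sup [set i%:R%:E * 'E_P[X i] | i in [set i | (0 < i)%N]]
         < +oo)%E)
  (A4 : exists2 gamma : R, 0 < gamma &
        (ereal_sup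
           [set \sum_(1 <= k < n.+1)
                  lne 'E_P[fun w => expR (k%:R * X k w * gamma / n%:R)]
           | n in [set n | (0 < n)%N]] < +oo)%E)
  (I_spec : forall n, (0 < n)%N -> random_index P X Xs n (I n))
  (U_unif : forall n, (0 < n)%N -> uniform01 P (U n))
  (Z_dickman : generalized_dickman theta P Z)
  (U_Z_indep : forall n, (0 < n)%N -> independent_pair P (U n) Z) :
  exists2 C : R, 0 < C &
    forall n : nat, (0 < n)%N ->
      let D := Delta P theta X Xs n (I n) (U n) in
      D != 1 ->
      (W3 P (weighted_sum X n) Z <= (C * (D * Num.sqrt `|ln D|))%:E)%E.
Proof.
have iX i : (0 < i)%N -> has_mean P (X i) by exact: X_integrable.
have m_lim : (fun i => i%:R * mean P (X i)) @ \oo --> theta.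
  apply: (cvg_trans _ (fine_cvg A1_mean)); apply: near_eq_cvg; near=> i.
  have i0 : (0 < i)%N by near: i; exact: nbhs_infty_gt.
  by rewrite /= -(EFin_mean (iX i i0)).
have p_lim : (fun i => i%:R * mean P (fun w => (X i w == 1)%:R)) @ \oo --> theta.
  apply: (cvg_trans _ (fine_cvg A1_prob)); apply: near_eq_cvg; near=> i.
  have m1 : measurable (X i @^-1` [set 1]).
    by apply: measurable_funPTI; exact: measurable_set1.
  rewrite /= fineM ?fin_num_measure// -mean_indic//; congr (_ * _).
  apply: eq_mean => w; rewrite indicE; congr (_%:R).
  by apply: congr1; apply/idP/eqP => [|]; rewrite inE.
have W_lim := total_weight_cvg m_lim.
(* Nonnegativity of the means is hidden in the law of the index: the weights of
   a probability are nonnegative, and [W] is positive for large [n]. *)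
have m_ge0 i : (0 < i)%N -> 0 <= mean P (X i).
  move=> i0; have /cvgr_gt /(_ _ theta_gt0) [N _ WN] := W_lim.
  pose n := maxn N i; have n0 : (0 < n)%N by rewrite leq_max i0 orbT.
  have Wn : 0 < total_weight P X n.
    by have := WN n (leq_maxl _ _); rewrite /= pmulr_lgt0 ?invr_gt0 ?ltr0n.
  have [_ _ /(_ (lt0r_neq0 Wn) i)] := I_spec n n0.
  rewrite i0 leq_maxr => /(_ isT) Pi.
  have : (0 <= (i%:R * fine 'E_P[X i] / total_weight P X n)%:E)%E.
    by rewrite -Pi measure_ge0.
  rewrite lee_fin -meanE.
  by rewrite pmulr_lge0 ?invr_gt0// pmulr_rge0 ?ltr0n.
have [K m_le] : exists K, forall i, (0 < i)%N -> i%:R * mean P (X i) <= K.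
  set s := ereal_sup _ in A3; exists (fine s) => i i0.
  have : ((i%:R * mean P (X i))%:E <= s)%E.
    by rewrite EFinM (EFin_mean (iX i i0)) /s; apply: ereal_sup_ubound; exists i.
  by case: s A3 => [r _|//|_].
have [gamma gamma_gt0 log_bound] := A4.
have [B B_ge0 exp_moments] := exponential_moments gamma_gt0 iX m_ge0 log_bound.
pose W n := total_weight P X n.
pose D n := `|theta - W n / n%:R| +
  mean P (fun w => `|U n w - (I n w)%:R * Xs (I n w) w / n%:R|).
have DE n : (0 < n)%N -> Delta P theta X Xs n (I n) (U n) = D n.
  by move=> n0; rewrite /Delta -!meanE mean_weighted_sum.
have D0 n : 0 <= D n by rewrite addr_ge0// mean_ge0.
have D_small := discrepancy_le_eventually theta_gt0 gamma_gt0 X_int iX A2 m_ge0 m_le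
  p_lim m_lim B_ge0 exp_moments I_spec U_unif.
pose c := theta^-1 * (1 - pull_mean theta)^-1 * (1 + (4 * pi * K ^+ 2 + K) * 2).
have c0 : 0 <= c.
  have K0 : 0 <= K by apply: le_trans (m_le 1%N isT); rewrite mul1r m_ge0.
  have r0 : 0 < 1 - pull_mean theta by rewrite subr_gt0 pull_mean_lt1.
  apply: mulr_ge0; first by rewrite mulr_ge0// invr_ge0 ltW.
  by rewrite addr_ge0// mulr_ge0// addr_ge0// mulr_ge0 ?sqr_ge0// mulr_ge0 ?pi_ge0.
have [C C0 DC] := log_factor_bound c0 D0 D_small.
exists C => // n n0 /=; rewrite DE// => Dn1.
apply: (@le_trans _ _ (c * D n)%:E); last by rewrite lee_fin DC.
apply: W3_le => // [|h dh sh hb]; first exact: measurable_weighted_sum.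
apply: (mean_comparison theta_gt0 X_indep X_int iX A2 m_ge0 m_le n0 (I_spec n n0)
  (U_unif n n0) _ Z_dickman sh hb).
by move=> W0; apply: (gap_has_mean gamma_gt0 X_int iX A2 m_ge0 exp_moments (I_spec n n0) (U_unif n n0)).
Unshelve. all: by end_near. Qed.
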